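(* Let $\Omega=\{(A_1,A_2)\in(\mathbb{R}^{2\times2})^2 : \sigma(A_1)\subset\mathbb{C}\setminus\mathbb{R}, \text{ or } (\sigma(A_1)\subset\mathbb{R} \text{ and } \#\sigma(A_1)=2)\}$, where $\sigma$ denotes the spectrum. Let $P_0,P_1,P_2$ be three totally-real planes in $\mathbb{C}^2$ containing $0$, with $P_0\cap P_j=\{(0,0)\}$ for $j=1,2$, let $g$ be a $\mathbb{C}$-linear isomorphism of $\mathbb{C}^2$ and $A_1,A_2\in\mathbb{R}^{2\times 2}$ with $g(P_0)=\mathbb{R}^2$, $g(P_j)=(A_j+i\mathbb{I})\mathbb{R}^2$ ($j=1,2$), and assume $(A_1,A_2)\in\Omega$. Then there is $T\in GL(2,\mathbb{R})$ with $$TA_1T^{-1}=\begin{pmatrix}\lambda_1&0\\0&\lambda_2\end{pmatrix}\ \text{ or }\ \begin{pmatrix}s&-t\\t&s\end{pmatrix},\qquad \lambda_1\ne\lambda_2\in\mathbb{R},\ s\in\mathbb{R},\ t\in\mathbb{R}\setminus\{0\}, \quad (\ast)$$ and we write $\mathscr{A}_1(T)=TA_1T^{-1}$, $\mathscr{A}_2(T)=TA_2T^{-1}$. Assume further that the pairwise unions of $P_0,P_1,P_2$ are locally polynomially convex at $0$. (i) Suppose $\sigma(A_1)\subset\mathbb{R}$ and $\#\sigma(A_1)=2$. Then either $\det[A_1,A_2]=0$, or there exists $T\in GL(2,\mathbb{R})$ satisfying $(\ast)$ such that $TA_2T^{-1}=\begin{pmatrix}s_{21}&t_2\\t_2&s_{22}\end{pmatrix}$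 or $\begin{pmatrix}s_{21}&-t_2\\t_2&s_{22}\end{pmatrix}$ with $s_{21},s_{22},t_2\in\mathbb{R}$. In the first case ($\det[A_1,A_2]=0$), $P_0\cup P_1\cup P_2$ is locally polynomially convex at $0$. In the second case, $P_0\cup P_1\cup P_2$ is locally polynomially convex at $0$ if, for some such $T$, $\det(\mathscr{A}_j(T)+\mathscr{A}_j(T)^{\mathsf T})>0$ for $j=1,2$. (ii) Suppose $\sigma(A_1)\subset\mathbb{C}\setminus\mathbb{R}$. Then there exists $T\in GL(2,\mathbb{R})$ satisfying $(\ast)$ with $TA_2T^{-1}=\begin{pmatrix}s_{21}&-t_2\\t_2&s_{22}\end{pmatrix}$, $s_{21},s_{22},t_2\in\mathbb{R}$. If $\det(\mathscr{A}_j(T)+\mathscr{A}_j(T)^{\mathsf T})>0$, $j=1,2$, for some such $T$, then $P_0\cup P_1\cup P_2$ is locally polynomially convex at $0$. Moreover, these conditions are optimal in the following sense: let $\Omega^*\subsetneq\Omega$ be the set of pairs $(A_1,A_2)\in\Omega$ satisfying the sufficient conditions in (i) or (ii) (i.e., $\sigma(A_1)\subset\mathbb{R}$ with two elements and either $\det[A_1,A_2]=0$ or some $T$ as in (i) with $\det(\mathscr{A}_j(T)+\mathscr{A}_j(T)^{\mathsf T})>0$ for $j=1,2$; or $\sigma(A_1)\subset\mathbb{C}\setminus\mathbb{R}$ and some $T$ as in (ii) with $\det(\mathscr{A}_j(T)+\mathscr{A}_j(T)^{\mathsf T})>0$ for $j=1,2$). Then there is a one-parameter family of triples $(P_0^\varepsilon,P_1^\varepsilon,P_2^\varepsilon)$,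 with $P_0^\varepsilon=\mathbb{R}^2$ and $P_j^\varepsilon=(A_j^\varepsilon+i\mathbb{I})\mathbb{R}^2$, parametrized by $(A_1^\varepsilon,A_2^\varepsilon)\in\Omega\setminus\Omega^*$, such that the pairwise unions of $P_0^\varepsilon,P_1^\varepsilon,P_2^\varepsilon$ are locally polynomially convex at the origin, the union $P_0^\varepsilon\cup P_1^\varepsilon\cup P_2^\varepsilon$ is not locally polynomially convex at $0$, and $(A_1^\varepsilon,A_2^\varepsilon)$ tends to the boundary $\partial\Omega^*$ (with $\Omega^*$ regarded as a subset of $\Omega$) as $\varepsilon\searrow 0$.
   Context: A real 2-dimensional subspace $P\subset\mathbb{C}^2$ is totally real if $P\cap iP=\{0\}$. A closed set $E\subset\mathbb{C}^n$ is locally polynomially convex at $p\in E$ if $E\cap\overline{\mathbb{B}(p;r)}$ is polynomially convex (equal to its hull with respect to holomorphic polynomials) for some $r>0$. $[A,B]=AB-BA$, $M^{\mathsf T}$ is the transpose. *)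

(* Defs.v *)
From HB Require Import structures.
From mathcomp Require Import all_boot all_order all_algebra.
From mathcomp Require Import complex.
From mathcomp Require Import reals.
Set Implicit Arguments. Unset Strict Implicit. Unset Printing Implicit Defensive.
Import Order.TTheory GRing.Theory Num.Theory.
Local Open Scope ring_scope.
Local Open Scope complex_scope.

Section Defs.
Variable R : realType.
Local Notation C := R[i].
Local Notation C2 := 'cV[C]_2.

Definition cset := C2 -> Prop.

Definition mxC (A : 'M[R]_2) : 'M[C]_2 := map_mx (fun x => x%:C) A.
Definition vC (x : 'cV[R]_2) : C2 := map_mx (fun x => x%:C) x.

Definition R2 : cset := fun z => exists x : 'cV[R]_2, z = vC x.

Definition graph_plane (A : 'M[R]_2) : cset :=
  fun z => exists x : 'cV[R]_2, z = (mxC A + 'i%:M) *m vC x.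

Definition real_plane (P : cset) : Prop :=
  exists u v : C2,
    (forall a b : R, a%:C *: u + b%:C *: v = 0 -> a = 0 /\ b = 0) /\
    (forall z, P z <-> exists a b : R, z = a%:C *: u + b%:C *: v).

Definition iset (P : cset) : cset := fun z => exists w, P w /\ z = 'i *: w.

Definition totally_real_plane (P : cset) : Prop :=
  real_plane P /\ (forall z, (P z /\ iset P z) <-> z = 0).

Definition mx_image (G : 'M[C]_2) (P : cset) : cset :=
  fun z => exists w, P w /\ z = G *m w.

Definition set_eq (P Q : cset) : Prop := forall z, P z <-> Q z.
Definition setU2 (P Q : cset) : cset := fun z => P z \/ Q z.
Definition setU3 (P Q S : cset) : cset := fun z => P z \/ Q z \/ S z.

Definition hpoly := seq ((nat * nat) * C).
Definition heval (p : hpoly) (z : C2) : C :=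
  \sum_(m <- p) m.2 * (z 0 0) ^+ m.1.1 * (z 1 0) ^+ m.1.2.

(** polynomially convex: equal to its polynomial hull
    {z | forall p, |p(z)| <= sup_K |p|} (K contained in its hull trivially) *)
Definition poly_hull (K : cset) : cset :=
  fun z => forall (p : hpoly) (M : R),
    (forall w, K w -> Normc.normc (heval p w) <= M) -> Normc.normc (heval p z) <= M.
Definition poly_convex (K : cset) : Prop := forall z, poly_hull K z -> K z.

Definition cball (p : C2) (r : R) : cset :=
  fun z => Normc.normc (z 0 0 - p 0 0) ^+ 2 + Normc.normc (z 1 0 - p 1 0) ^+ 2 <= r ^+ 2.

Definition loc_poly_convex (E : cset) (p : C2) : Prop :=
  E p /\ exists r : R, 0 < r /\ poly_convex (fun z => E z /\ cball p r z).

Definition spectrum (A : 'M[R]_2) : C -> Prop := fun z => eigenvalue (mxC A) z.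

Definition spec_nonreal (A : 'M[R]_2) : Prop :=
  forall z, spectrum A z -> Im z != 0.
Definition spec_real_two (A : 'M[R]_2) : Prop :=
  (forall z, spectrum A z -> Im z = 0) /\
  exists z1 z2, z1 != z2 /\ (forall z, spectrum A z <-> (z = z1 \/ z = z2)).

Definition Omega (A1 A2 : 'M[R]_2) : Prop := spec_nonreal A1 \/ spec_real_two A1.

Definition comm (A B : 'M[R]_2) := A *m B - B *m A.
Definition conj (T A : 'M[R]_2) := T *m A *m invmx T.

Definition diag2 (a b : R) : 'M[R]_2 :=
  \matrix_(i < 2, j < 2) (if i == j then (if i == 0 then a else b) else 0).
Definition mx2 (a b c d : R) : 'M[R]_2 :=
  \matrix_(i < 2, j < 2)
    (if i == 0 then (if j == 0 then a else b) else (if j == 0 then c else d)).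

Definition star (T A1 : 'M[R]_2) : Prop :=
  T \in unitmx /\
  ((exists l1 l2 : R, l1 != l2 /\ conj T A1 = diag2 l1 l2) \/
   (exists s t : R, t != 0 /\ conj T A1 = mx2 s (- t) t s)).

Definition form_i (T A2 : 'M[R]_2) : Prop :=
  exists s1 s2 t : R, conj T A2 = mx2 s1 t t s2 \/ conj T A2 = mx2 s1 (- t) t s2.
Definition form_ii (T A2 : 'M[R]_2) : Prop :=
  exists s1 s2 t : R, conj T A2 = mx2 s1 (- t) t s2.

Definition det_cond (T A1 A2 : 'M[R]_2) : Prop :=
  0 < \det (conj T A1 + (conj T A1)^T) /\ 0 < \det (conj T A2 + (conj T A2)^T).

Definition OmegaStar (A1 A2 : 'M[R]_2) : Prop :=
  Omega A1 A2 /\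
  ((spec_real_two A1 /\
     (\det (comm A1 A2) = 0 \/
      exists T, star T A1 /\ form_i T A2 /\ det_cond T A1 A2)) \/
   (spec_nonreal A1 /\ exists T, star T A1 /\ form_ii T A2 /\ det_cond T A1 A2)).

Definition mx_near (d : R) (A B : 'M[R]_2) : Prop :=
  forall i j, `|A i j - B i j| < d.

Definition rel_boundary (B1 B2 : 'M[R]_2) : Prop :=
  Omega B1 B2 /\
  forall d : R, 0 < d ->
    (exists C1 C2, OmegaStar C1 C2 /\ mx_near d B1 C1 /\ mx_near d B2 C2) /\
    (exists C1 C2, Omega C1 C2 /\ ~ OmegaStar C1 C2 /\
                   mx_near d B1 C1 /\ mx_near d B2 C2).

End Defs.

(* Main.v *)
(** Sufficiency.  A union of real planes is a real cone, so its local polynomial convexity at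
    the origin means that hulls of its bounded parts stay in the union.  Polynomials approximate
    the sign of the real part on a double sector; hence two such cones which a polynomial [p]
    maps into opposite sectors can be glued, except along the fibre [p = 0] (Kallin).  If both
    symmetric parts are definite, [p = g (z0^2 + z1^2)] with a suitable constant [g] separates
    one plane from the two others and vanishes only at the origin on them.  If
    [det [A1, A2] = 0], both matrices are triangular in a common basis, and [p = g z1^2]
    separates one of the three real lines onto which the planes project from the two others;
    the zero fibre is again a union of three lines.

    Optimality.  With [c n] the coefficients of [(1 - z)^-mu] and [nu + nu' = 2 mu], let
    [J_nu (w)] be the sum of [c n c k / (n + k + nu) e^((2 n + nu) w)].  The map
    [w |-> e^(- al w) (1 - e^(2 w))^al (J_nu (w), J_nu' (w))] on the half strip [Re w <= 0],
    [0 <= Im w <= pi / 2] sends [Im w = 0] into [R^2] and [Im w = pi / 2] into the graph of a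
    diagonal matrix.  It sends [Re w = 0] into a third totally real plane, because [J_nu] and
    [J_nu'] have the same imaginary part there.  By the maximum principle the image lies in the
    hull of the three planes, but an interior point far to the left is in none of them, while
    the planes are pairwise locally polynomially convex.  Conjugating by [diag (e, 1)] preserves
    all this and lets an off-diagonal entry of the third matrix tend to [0], where the
    determinant of the commutator vanishes. *)

Require Import Defs.
From HB Require Import structures.
From mathcomp Require Import all_boot all_order all_algebra.
From mathcomp Require Import complex.
From mathcomp Require Import reals boolp classical_sets functions topology normedtype.
From mathcomp Require Import sequences derive realfun exp trigo.
From mathcomp Require Import ring lra.
Set Implicit Arguments. Unset Strict Implicit. Unset Printing Implicit Defensive.
Import Order.TTheory GRing.Theory Num.Theory.
Import numFieldNormedType.Exports.
Local Open Scope ring_scope.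
Local Open Scope complex_scope.

Local Notation Re := complex.Re.
Local Notation Im := complex.Im.

(** * Complex moduli and polynomial functions on the plane *)

Section ComplexNorm.
Variable R : realType.
Local Notation C := R[i].
Local Notation nc := (@Normc.normc R).
Implicit Types z w : C.

(** The prefactor [e^(- al w) (1 - e^(2 w))^al] has constant argument on each side of the half
    strip, so it only turns the planes. It is there because for [al = 0] the third plane would
    satisfy [Im z0 = Im z1] and meet [R^2] in a line; a positive [al] makes it a graph. The second
    equation of that plane comes from a reflection: on [Re w = 0] the factor [e^(- i pi nu)] turns
    the series at [t] into the conjugate of the series at [pi - t], so the equality of imaginary
    parts is used at both points. The equality itself is the analytic core; it is proved by
    extending both sine sums to functions of two variables that agree at [y = 0] and have the same
    derivative in [y] in the limit. Only partial sums occur in these arguments. They are finite sums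
    of exponentials, for which the maximum principle is elementary, but on [Re w = 0] they reach the
    third plane only up to an error. Hence the estimates there must be uniform along the whole side,
    and polynomials enter through their Lipschitz constants. *)

Lemma nc_ge0 z : 0 <= nc z. Proof. by case: z => a b; rewrite sqrtr_ge0. Qed.

Lemma ncD z w : nc (z + w) <= nc z + nc w. Proof. exact: le_normcD. Qed.

Lemma ncM z w : nc (z * w) = nc z * nc w. Proof. exact: Normc.normcM. Qed.

Lemma ncN z : nc (- z) = nc z. Proof. exact: normcN. Qed.

Lemma ncB z w : nc (z - w) <= nc z + nc w.
Proof. by rewrite -(ncN w); exact: ncD. Qed.

Lemma ncBC z w : nc (z - w) = nc (w - z).
Proof. by rewrite -ncN opprB. Qed.

Lemma nc0 : nc 0 = 0. Proof. exact: Normc.normc0. Qed.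

Lemma nc1 : nc 1 = 1. Proof. exact: Normc.normc1. Qed.

Lemma nc_eq0 z : (nc z == 0) = (z == 0).
Proof.
apply/eqP/eqP => [/Normc.eq0_normc //|->]; exact: nc0.
Qed.

Lemma nc_gt0 z : (0 < nc z) = (z != 0).
Proof. by rewrite lt_def nc_eq0 nc_ge0 andbT. Qed.

Lemma ncX z n : nc (z ^+ n) = nc z ^+ n.
Proof. by elim: n => [|n IH]; rewrite ?expr0 ?nc1 // !exprS ncM IH. Qed.

Lemma ncV z : nc z^-1 = (nc z)^-1. Proof. exact: Normc.normcV. Qed.

Lemma nc_sq z : nc z ^+ 2 = Re z ^+ 2 + Im z ^+ 2.
Proof. by case: z => a b /=; rewrite sqr_sqrtr // addr_ge0 ?sqr_ge0. Qed.

Lemma nc_real (x : R) : nc x%:C = `|x|.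
Proof. by rewrite /= expr0n /= addr0 sqrtr_sqr. Qed.

Lemma Re_le_nc z : `|Re z| <= nc z.
Proof.
rewrite -(@ler_pXn2r _ 2) ?nnegrE ?nc_ge0 //.
by rewrite nc_sq real_normK ?num_real // lerDl sqr_ge0.
Qed.

Lemma Im_le_nc z : `|Im z| <= nc z.
Proof.
rewrite -(@ler_pXn2r _ 2) ?nnegrE ?nc_ge0 //.
by rewrite nc_sq real_normK ?num_real // lerDr sqr_ge0.
Qed.

Lemma nc_le_ReIm z : nc z <= `|Re z| + `|Im z|.
Proof.
rewrite -(@ler_pXn2r _ 2) ?nnegrE ?nc_ge0 ?addr_ge0 //.
rewrite nc_sq sqrrD !real_normK ?num_real //.
have := mulr_ge0 (normr_ge0 (Re z)) (normr_ge0 (Im z)); lra.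
Qed.

Lemma nc_le_sq z (c : R) : 0 <= c -> (nc z <= c) = (nc z ^+ 2 <= c ^+ 2).
Proof. by move=> c0; rewrite ler_pXn2r ?nnegrE ?nc_ge0. Qed.

Lemma cReD z w : Re (z + w) = Re z + Re w. Proof. by case: z; case: w. Qed.
Lemma cImD z w : Im (z + w) = Im z + Im w. Proof. by case: z; case: w. Qed.
Lemma cReN z : Re (- z) = - Re z. Proof. by case: z. Qed.
Lemma cImN z : Im (- z) = - Im z. Proof. by case: z. Qed.
Lemma cReM z w : Re (z * w) = Re z * Re w - Im z * Im w.
Proof. by case: z => a b; case: w. Qed.
Lemma cImM z w : Im (z * w) = Re z * Im w + Im z * Re w.
Proof. by case: z => a b; case: w. Qed.
Lemma cReC (x : R) : Re x%:C = x. Proof. by []. Qed.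
Lemma cImC (x : R) : Im x%:C = 0. Proof. by []. Qed.
Lemma cRe0 : Re (0 : C) = 0. Proof. by []. Qed.
Lemma cIm0 : Im (0 : C) = 0. Proof. by []. Qed.

Lemma complex_ext z w : Re z = Re w -> Im z = Im w -> z = w.
Proof. by case: z => a b; case: w => c d /= -> ->. Qed.

End ComplexNorm.

Section PolynomialFunctions.
Variable R : realType.
Local Notation C := R[i].
Local Notation C2 := 'cV[C]_2.
Local Notation nc := (@Normc.normc R).

Definition mk2 (a b : C) : C2 := \col_i (if i == 0 then a else b).

Lemma mk2_0 a b : mk2 a b 0 0 = a. Proof. by rewrite mxE. Qed.
Lemma mk2_1 a b : mk2 a b 1 0 = b. Proof. by rewrite mxE. Qed.

Lemma eq2 (z w : C2) : z 0 0 = w 0 0 -> z 1 0 = w 1 0 -> z = w.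
Proof.
move=> h0 h1; apply/matrixP => i j; rewrite (ord1 j).
case: i => [[|[|//]] hi].
- by rewrite (_ : Ordinal hi = 0) //; apply/val_inj.
- by rewrite (_ : Ordinal hi = 1) //; apply/val_inj.
Qed.

(** Speaks of functions rather than of coefficient lists, so that hulls can be tested with products,
    powers and composites without handling the lists. *)
Definition polyfun (f : C2 -> C) : Prop := exists p, forall z, heval p z = f z.

Lemma polyfun_cst c : polyfun (fun _ => c).
Proof.
by exists [:: ((0%N, 0%N), c)] => z; rewrite /heval big_seq1 /= !expr0 !mulr1.
Qed.

Lemma polyfun_coord0 : polyfun (fun z => z 0 0).
Proof.
by exists [:: ((1%N, 0%N), 1)] => z; rewrite /heval big_seq1 /= expr0 mul1r mulr1.
Qed.

Lemma polyfun_coord1 : polyfun (fun z => z 1 0).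
Proof.
by exists [:: ((0%N, 1%N), 1)] => z; rewrite /heval big_seq1 /= expr0 !mul1r.
Qed.

Lemma polyfunD f g : polyfun f -> polyfun g -> polyfun (fun z => f z + g z).
Proof.
by move=> [p hp] [q hq]; exists (p ++ q) => z; rewrite /heval big_cat -hp -hq.
Qed.

Lemma polyfunM f g : polyfun f -> polyfun g -> polyfun (fun z => f z * g z).
Proof.
move=> [p hp] [q hq].
exists [seq ((a.1.1 + b.1.1, a.1.2 + b.1.2)%N, a.2 * b.2) | a <- p, b <- q] => z.
rewrite /heval big_allpairs_dep -hp -hq /heval mulr_suml.
apply: eq_bigr => a _; rewrite mulr_sumr; apply: eq_bigr => b _ /=.
by rewrite !exprD; ring.
Qed.

Lemma eq_polyfun f g : f =1 g -> polyfun f -> polyfun g.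
Proof. by move=> fg [p hp]; exists p => z; rewrite hp fg. Qed.

Lemma polyfunX f n : polyfun f -> polyfun (fun z => f z ^+ n).
Proof.
move=> hf; elim: n => [|n IH].
  by apply: eq_polyfun (polyfun_cst 1) => z; rewrite expr0.
by apply: eq_polyfun (polyfunM hf IH) => z; rewrite exprS.
Qed.

Lemma polyfun_sum (I : Type) (r : seq I) (F : I -> C2 -> C) :
  (forall i, polyfun (F i)) -> polyfun (fun z => \sum_(i <- r) F i z).
Proof.
move=> hF; elim: r => [|i r IH].
  by apply: eq_polyfun (polyfun_cst 0) => z; rewrite big_nil.
by apply: eq_polyfun (polyfunD (hF i) IH) => z; rewrite big_cons.
Qed.

Lemma polyfun_comp2 f a b : polyfun f -> polyfun a -> polyfun b ->
  polyfun (fun z => f (mk2 (a z) (b z))).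
Proof.
move=> [p hp] ha hb; apply: (@eq_polyfun (fun z => \sum_(m <- p)
  m.2 * (a z) ^+ m.1.1 * (b z) ^+ m.1.2)).
  by move=> z; rewrite -hp /heval mk2_0 mk2_1.
apply: polyfun_sum => m.
by do ?apply: polyfunM; [exact: polyfun_cst|exact: polyfunX|exact: polyfunX].
Qed.

Lemma polyfun_horner (h : {poly C}) f : polyfun f -> polyfun (fun z => h.[f z]).
Proof.
move=> hf; apply: (@eq_polyfun (fun z => \sum_(i < size h) h`_i * f z ^+ i)).
  by move=> z; rewrite horner_coef.
by apply: polyfun_sum => i; apply: polyfunM; [exact: polyfun_cst|exact: polyfunX].
Qed.

Lemma mulmx2E (G : 'M[C]_2) (z : C2) i :
  (G *m z) i 0 = G i 0 * z 0 0 + G i 1 * z 1 0.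
Proof.
rewrite mxE big_ord_recl big_ord1; congr (_ + G i _ * z _ _); exact/val_inj.
Qed.

Lemma polyfun_lin a b : polyfun (fun z : C2 => a * z 0 0 + b * z 1 0).
Proof.
by apply: polyfunD; apply: polyfunM; do ?exact: polyfun_cst;
  [exact: polyfun_coord0|exact: polyfun_coord1].
Qed.

Lemma polyfun_mulmx (G : 'M[C]_2) f : polyfun f -> polyfun (fun z => f (G *m z)).
Proof.
move=> hf; have := polyfun_comp2 hf (polyfun_lin (G 0 0) (G 0 1))
  (polyfun_lin (G 1 0) (G 1 1)).
apply: eq_polyfun => z; congr f.
by apply: eq2; rewrite ?mk2_0 ?mk2_1 mulmx2E.
Qed.

Lemma poly_hullP (K : cset R) z : poly_hull K z <->
  forall f M, polyfun f -> (forall w, K w -> nc (f w) <= M) -> nc (f z) <= M.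
Proof.
split=> [h f M [p hp] hK|h p M hK].
  by rewrite -hp; apply: h => w /hK; rewrite hp.
by apply: h => //; exists p.
Qed.

Definition sqn (z : C2) : R := nc (z 0 0) ^+ 2 + nc (z 1 0) ^+ 2.

Lemma sqn_ge0 z : 0 <= sqn z. Proof. by rewrite addr_ge0 ?sqr_ge0. Qed.

Lemma coord0_le_sqn (z : C2) (r : R) : 0 <= r -> sqn z <= r ^+ 2 -> nc (z 0 0) <= r.
Proof.
move=> r0 h; rewrite nc_le_sq //; apply: le_trans h; rewrite /sqn.
by rewrite lerDl sqr_ge0.
Qed.

Lemma coord1_le_sqn (z : C2) (r : R) : 0 <= r -> sqn z <= r ^+ 2 -> nc (z 1 0) <= r.
Proof.
move=> r0 h; rewrite nc_le_sq //; apply: le_trans h; rewrite /sqn.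
by rewrite lerDr sqr_ge0.
Qed.

Lemma sqn_bound (z : C2) (a : R) : nc (z 0 0) <= a -> nc (z 1 0) <= a ->
  sqn z <= (a + a) ^+ 2.
Proof.
move=> h0 h1; have n0 := nc_ge0 (z 0 0); have n1 := nc_ge0 (z 1 0).
rewrite /sqn; nra.
Qed.

Lemma cball0 r (z : C2) : cball 0 r z <-> sqn z <= r ^+ 2.
Proof. by rewrite /cball !mxE !subr0. Qed.

Definition disk (r : R) : cset R := fun z => sqn z <= r ^+ 2.

Lemma polyfun_bounded f r : 0 <= r -> polyfun f ->
  exists2 B, 0 <= B & forall z, disk r z -> nc (f z) <= B.
Proof.
move=> r0 [p hp]; pose B := \sum_(m <- p) nc m.2 * r ^+ m.1.1 * r ^+ m.1.2.
exists B.
  by apply: sumr_ge0 => m _; rewrite !mulr_ge0 ?nc_ge0 ?exprn_ge0.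
move=> z hz; rewrite -hp /heval /B; have h0 := coord0_le_sqn r0 hz.
have h1 := coord1_le_sqn r0 hz.
elim: (p) => [|m q IH]; first by rewrite !big_nil nc0.
rewrite !big_cons; apply: le_trans (ncD _ _) _; apply: lerD => //.
rewrite !ncM !ncX; apply: ler_pM; rewrite ?mulr_ge0 ?exprn_ge0 ?nc_ge0 //.
  by apply: ler_pM; rewrite ?exprn_ge0 ?nc_ge0 // lerXn2r ?nnegrE ?nc_ge0.
by rewrite lerXn2r ?nnegrE ?nc_ge0.
Qed.

End PolynomialFunctions.

(** * Hulls of real cones *)

Section Cones.
Variable R : realType.
Local Notation C := R[i].
Local Notation C2 := 'cV[C]_2.
Local Notation nc := (@Normc.normc R).
Implicit Types (E : cset R) (z w : C2).

(** Values of polynomials at nearby points are compared twice: next to the zero fibre of a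
    separating form, and between partial sums and the planes that they approach. *)
Definition lip_on_disk (f : C2 -> C) := forall r, 0 <= r ->
  exists2 L, 0 <= L & forall z w, disk r z -> disk r w ->
    nc (f z - f w) <= L * (nc (z 0 0 - w 0 0) + nc (z 1 0 - w 1 0)).

Lemma lip_on_diskM f g : polyfun f -> polyfun g ->
  lip_on_disk f -> lip_on_disk g -> lip_on_disk (fun z => f z * g z).
Proof.
move=> pf pg lf lg r r0.
have [L L0 hL] := lf _ r0; have [L' L'0 hL'] := lg _ r0.
have [B B0 hB] := polyfun_bounded r0 pf; have [B' B'0 hB'] := polyfun_bounded r0 pg.
exists (B * L' + B' * L); first by rewrite addr_ge0 ?mulr_ge0.
move=> z w hz hw.
have -> : f z * g z - f w * g w = f z * (g z - g w) + g w * (f z - f w) by ring.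
apply: le_trans (ncD _ _) _; rewrite !ncM mulrDl; apply: lerD; rewrite -mulrA.
  by apply: ler_pM; rewrite ?nc_ge0 ?hB ?hL'.
by apply: ler_pM; rewrite ?nc_ge0 ?hB' ?hL.
Qed.

Lemma lip_on_diskX f n : polyfun f -> lip_on_disk f -> lip_on_disk (fun z => f z ^+ n).
Proof.
move=> pf lf; elim: n => [|n IH] r r0.
  exists 0 => // z w _ _; by rewrite !expr0 subrr nc0 mul0r.
have [L L0 hL] := lip_on_diskM pf (polyfunX n pf) lf IH r0.
by exists L => // z w hz hw; rewrite !exprS; exact: hL.
Qed.

Lemma polyfun_lip f : polyfun f -> lip_on_disk f.
Proof.
move=> [p hp] r r0.
have cst c : lip_on_disk (fun _ => c).
  by move=> r' _; exists 0 => // z w _ _; rewrite subrr nc0 mul0r.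
have l0 : lip_on_disk (fun z => z 0 0).
  by move=> r' _; exists 1 => // z w _ _; rewrite mul1r lerDl nc_ge0.
have l1 : lip_on_disk (fun z => z 1 0).
  by move=> r' _; exists 1 => // z w _ _; rewrite mul1r lerDr nc_ge0.
have [L L0 hL] : exists2 L, 0 <= L & forall z w, disk r z -> disk r w ->
    nc (heval p z - heval p w) <= L * (nc (z 0 0 - w 0 0) + nc (z 1 0 - w 1 0)).
  rewrite /heval; elim: (p) => [|m q [L L0 hL]].
    by exists 0 => // z w _ _; rewrite !big_nil subrr nc0 mul0r.
  have pX0 := polyfunX m.1.1 (polyfun_coord0 R).
  have pX1 := polyfunX m.1.2 (polyfun_coord1 R).
  have [L' L'0 hL'] := lip_on_diskM
    (polyfunM (polyfun_cst m.2) pX0) pX1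
    (lip_on_diskM (polyfun_cst m.2) pX0 (cst m.2)
      (lip_on_diskX m.1.1 (polyfun_coord0 R) l0))
    (lip_on_diskX m.1.2 (polyfun_coord1 R) l1) r0.
  exists (L' + L); first by rewrite addr_ge0.
  move=> z w hz hw; rewrite !big_cons opprD addrACA mulrDl.
  by apply: le_trans (ncD _ _) _; apply: lerD; [exact: hL'|exact: hL].
by exists L => // z w hz hw; rewrite -!hp; exact: hL.
Qed.

(** Quantifying over all radii avoids the choice of one; for real cones [loc_cone_cvx] and
    [cone_cvx_loc] relate this to [loc_poly_convex]. The ball is absent from the conclusion because
    [hull_disk] supplies it. *)
Definition cone_cvx E : Prop := forall r, 0 <= r ->
  forall z, poly_hull (fun w => E w /\ disk r w) z -> E z.

Definition real_cone E : Prop := forall (t : R) z, E z -> E (t%:C *: z).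

Lemma eq_cone_cvx E E' : set_eq E E' -> cone_cvx E -> cone_cvx E'.
Proof.
move=> h hE r r0 z hz; apply/h/(hE r) => //; apply/poly_hullP => f M pf hf.
by move/poly_hullP: hz; apply => // w [/h Ew dw]; apply: hf.
Qed.

Lemma sqnZ (t : R) z : sqn (t%:C *: z) = t ^+ 2 * sqn z.
Proof. by rewrite /sqn !mxE !ncM nc_real !exprMn real_normK ?num_real // mulrDr. Qed.

(** Tested with the linear form [w |-> <w, z>], which is [|z|^2] at [z] and at most [|z| r] on the
    ball. *)
Lemma hull_disk E r z : 0 <= r -> poly_hull (fun w => E w /\ disk r w) z -> disk r z.
Proof.
move=> r0 /poly_hullP h.
pose f w := (z 0 0)^*%C * w 0 0 + (z 1 0)^*%C * w 1 0.
have CS w : nc (f w) ^+ 2 <= sqn z * sqn w.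
  rewrite /f /sqn !nc_sq.
  case: (z 0 0) (z 1 0) (w 0 0) (w 1 0) => [a b] [c d] [a' b'] [c' d'] /=.
  rewrite -subr_ge0.
  have -> : (a ^+ 2 + b ^+ 2 + (c ^+ 2 + d ^+ 2)) *
    (a' ^+ 2 + b' ^+ 2 + (c' ^+ 2 + d' ^+ 2)) -
    ((a * a' - - b * b' + (c * c' - - d * d')) ^+ 2 +
    (a * b' + - b * a' + (c * d' + - d * c')) ^+ 2) =
    (a * c' - b * d' - (c * a' - d * b')) ^+ 2 +
    (a * d' + b * c' - (c * b' + d * a')) ^+ 2 by ring.
  by rewrite addr_ge0 ?sqr_ge0.
have fz : f z = (sqn z)%:C.
  rewrite /f /sqn !nc_sq; case: (z 0 0) (z 1 0) => [a b] [c d].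
  by apply: complex_ext => /=; ring.
have sz := sqn_ge0 z.
have : nc (f z) <= Num.sqrt (sqn z) * r.
  apply: h; first exact: polyfun_lin.
  move=> w [_ dw]; rewrite nc_le_sq ?mulr_ge0 ?sqrtr_ge0 //.
  apply: le_trans (CS w) _; rewrite exprMn sqr_sqrtr //.
  by rewrite ler_wpM2l.
rewrite fz nc_real ger0_norm // /disk.
rewrite -{1 3}(sqr_sqrtr sz) => h1.
have [->|s0] := eqVneq (Num.sqrt (sqn z)) 0; first by rewrite expr0n sqr_ge0.
have s1 : 0 < Num.sqrt (sqn z) by rewrite lt_def s0 sqrtr_ge0.
rewrite lerXn2r ?nnegrE ?sqrtr_ge0 //.
by rewrite -(ler_pM2l s1) -expr2.
Qed.

(** A dilation carries the ball of radius [r] into the ball of radius [r0] and preserves both the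
    cone and the polynomials. Its ratio has [r + 1] in the denominator to admit [r = 0]. *)
Lemma loc_cone_cvx E : real_cone E -> loc_poly_convex E 0 -> cone_cvx E.
Proof.
move=> cE [_ [r0 [r0_gt0 hE]]] r r_ge0 z /poly_hullP hz.
pose t := r0 / (r + 1).
have r1 : 0 < r + 1 by rewrite ltr_wpDl.
have t0 : 0 < t by rewrite divr_gt0.
have -> : z = (t^-1)%:C *: (t%:C *: z).
  by rewrite scalerA -rmorphM mulVf ?gt_eqF // scale1r.
apply: (cE); suff [] : E (t%:C *: z) /\ cball 0 r0 (t%:C *: z) by [].
apply: hE; apply/poly_hullP => f M pf hf.
have scE w : t%:C *: w = t%:C%:M *m w by rewrite mul_scalar_mx.
rewrite scE; apply: (hz (fun z => f (t%:C%:M *m z))).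
  exact: polyfun_mulmx.
move=> w [Ew dw]; rewrite -scE; apply: hf; split; first exact: cE.
apply/cball0; rewrite sqnZ.
apply: le_trans (ler_wpM2l (sqr_ge0 _) dw) _.
have tr : t * r <= r0.
  by rewrite /t -mulrA ler_piMr ?(ltW r0_gt0) // mulrC ler_pdivrMr // mul1r lerDl.
rewrite -exprMn; apply: lerXn2r => //; rewrite nnegrE; last exact: ltW.
by rewrite mulr_ge0 // ltW.
Qed.

Lemma cone_cvx_loc E : E 0 -> cone_cvx E -> loc_poly_convex E 0.
Proof.
move=> E0 hE; split=> //; exists 1; split=> // z hz.
have hz' : poly_hull (fun w => E w /\ disk 1 w) z.
  move/poly_hullP: hz => hz; apply/poly_hullP => f M pf hf; apply: hz => // w [Ew].
  by move=> /cball0 dw; apply: hf.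
split; first exact: hE hz'.
by apply/cball0; exact: hull_disk hz'.
Qed.

Lemma cone_cvx_mulmx E (G : 'M[C]_2) : cone_cvx E -> cone_cvx (fun z => E (G *m z)).
Proof.
move=> hE r r0 z /poly_hullP hz.
have [B B0 hB] := polyfun_bounded r0 (polyfun_mulmx G (polyfun_coord0 R)).
have [B' B'0 hB'] := polyfun_bounded r0 (polyfun_mulmx G (polyfun_coord1 R)).
apply: (hE ((B + B') + (B + B'))); first by rewrite !addr_ge0.
apply/poly_hullP => f M pf hf.
apply: (hz (fun z => f (G *m z))); first exact: polyfun_mulmx.
move=> w [Ew dw]; apply: hf; split => //.
apply: sqn_bound; first by rewrite (le_trans (hB _ dw)) // lerDl.
by rewrite (le_trans (hB' _ dw)) // lerDr.
Qed.

(* [|1 + eta * l|^2 = 1 + 2 eta Re l + eta^2 |l|^2], so a linear form whose real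
   part vanishes on [E] has vanishing real part on the hull. *)
Lemma hull_linear (K : cset R) (a b : C) r z : 0 <= r ->
  (forall d : R, 0 < d -> poly_hull (fun w => K w /\ disk r w /\
     `|Re (a * w 0 0 + b * w 1 0)| <= d) z) ->
  Re (a * z 0 0 + b * z 1 0) = 0.
Proof.
move=> r0 hz; pose l w := a * w 0 0 + b * w 1 0.
have pl : polyfun l by exact: polyfun_lin.
have [B B0 hB] := polyfun_bounded r0 pl.
have nE (y : R) (u : C) : nc (1 + y%:C * u) ^+ 2 =
    1 + 2 * y * Re u + y ^+ 2 * nc u ^+ 2.
  by rewrite !nc_sq; case: u => u v /=; ring.
(* The function [1 + y l] at [z] is compared with its bound on the set where [|Re l| <= d], for
   smaller and smaller [d]. *)
have key (y : R) : 2 * y * Re (l z) <= y ^+ 2 * B ^+ 2.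
  rewrite -subr_ge0 -(addrK 0 (_ - _)) subr0; apply/ler_addgt0Pl => e e0.
  pose d := e / (2 * `|y| + 1).
  have y1 : 0 < 2 * `|y| + 1 by have := normr_ge0 y; lra.
  have d0 : 0 < d by rewrite divr_gt0.
  move/poly_hullP: (hz d d0) => /(_ (fun w => 1 + y%:C * l w)
    (Num.sqrt (1 + y ^+ 2 * B ^+ 2 + e))) h.
  have pos : 0 <= 1 + y ^+ 2 * B ^+ 2 + e.
    have := mulr_ge0 (sqr_ge0 y) (sqr_ge0 B); lra.
  have : nc (1 + y%:C * l z) ^+ 2 <= 1 + y ^+ 2 * B ^+ 2 + e.
    rewrite -(sqr_sqrtr pos) lerXn2r ?nnegrE ?nc_ge0 ?sqrtr_ge0 //.
    apply: h.
      apply: polyfunD; first exact: polyfun_cst.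
      by apply: polyfunM; [exact: polyfun_cst|].
    move=> w [_ [dw lw]]; rewrite nc_le_sq ?sqrtr_ge0 // sqr_sqrtr // nE.
    have h1 : y ^+ 2 * nc (l w) ^+ 2 <= y ^+ 2 * B ^+ 2.
      by rewrite ler_wpM2l ?sqr_ge0 // lerXn2r ?nnegrE ?nc_ge0 // hB.
    have h2 : 2 * y * Re (l w) <= e.
      apply: le_trans (ler_norm _) _; rewrite !normrM ger0_norm //.
      apply: (@le_trans _ _ ((2 * `|y| + 1) * d)).
        by apply: ler_pM; rewrite ?mulr_ge0 ?normr_ge0 // lerDl.
      by rewrite /d mulrC divfK ?gt_eqF.
    lra.
  rewrite nE => h1; have := mulr_ge0 (sqr_ge0 y) (sqr_ge0 (nc (l z))); lra.
(* For [y = x / (B^2 + 1)] the inequality [key] becomes [2 x^2 (B^2 + 1) <= x^2 B^2], which forces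
   [x = 0]. *)
set x := Re _; have := key (x / (B ^+ 2 + 1)); rewrite -/x => h.
have B1 : 0 < B ^+ 2 + 1 by rewrite ltr_wpDl ?sqr_ge0.
have {}h : x ^+ 2 * (2 * (B ^+ 2 + 1)) <= x ^+ 2 * B ^+ 2.
  have := ler_wpM2r (sqr_ge0 (B ^+ 2 + 1)) h.
  have -> : 2 * (x / (B ^+ 2 + 1)) * x * (B ^+ 2 + 1) ^+ 2 =
    x ^+ 2 * (2 * (B ^+ 2 + 1)) by field; rewrite gt_eqF.
  by have -> : (x / (B ^+ 2 + 1)) ^+ 2 * B ^+ 2 * (B ^+ 2 + 1) ^+ 2 =
    x ^+ 2 * B ^+ 2 by field; rewrite gt_eqF.
have : x ^+ 2 <= 0 by have := mulr_ge0 (sqr_ge0 x) (sqr_ge0 B); lra.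
by rewrite real_exprn_even_le0 ?num_real //= => /eqP.
Qed.

(** Meant for real subspaces, which are cut out by real parts of complex linear forms; by
    [hull_linear] these real parts vanish on the hull as well. *)
Lemma cone_cvx_linear E :
  (forall z, (forall a b, (forall w, E w -> Re (a * w 0 0 + b * w 1 0) = 0) ->
     Re (a * z 0 0 + b * z 1 0) = 0) -> E z) -> cone_cvx E.
Proof.
move=> hE r r0 z hz; apply: hE => a b hab.
apply: (@hull_linear E a b r) => // d d0.
apply/poly_hullP => f M pf hf; move/poly_hullP: hz; apply=> // w [Ew dw].
by apply: hf; split=> //; split=> //; rewrite hab // normr0 ltW.
Qed.

End Cones.

(** * Polynomial approximation of the sign of the real part *)

Section UniformApproximation.
Variable R : realType.
Local Notation C := R[i].
Local Notation nc := (@Normc.normc R).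

Lemma expr_small (x e : R) : 0 <= x < 1 -> 0 < e -> exists n, x ^+ n <= e.
Proof.
move=> /andP[x0 x1] e0; have [->|xn0] := eqVneq x 0.
  by exists 1%N; rewrite expr1 ltW.
have xp : 0 < x by rewrite lt_def xn0.
pose h := x^-1 - 1.
have h0 : 0 < h by rewrite subr_gt0 invf_gt1.
have bern n : 1 + n%:R * h <= (x^-1) ^+ n.
  elim: n => [|n IH]; first by rewrite mul0r addr0 expr0.
  rewrite exprS (_ : x^-1 = 1 + h); last by rewrite /h addrC subrK.
  have := mulr_ge0 (ler0n R n) (sqr_ge0 h).
  have := ler_wpM2l (addr_ge0 ler01 (ltW h0)) IH.
  rewrite (_ : x^-1 = 1 + h); last by rewrite /h addrC subrK.
  rewrite -natr1 => a b; nra.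
pose n := Num.bound ((e * h)^-1).
have hn : (e * h)^-1 < n%:R.
  by apply: archi_boundP; rewrite invr_ge0 ltW // mulr_gt0.
exists n; rewrite -[x ^+ n]invrK -[e]invrK lef_pV2 ?posrE ?invr_gt0 ?exprn_gt0 //.
rewrite -exprVn; apply: le_trans (bern n).
apply: (@le_trans _ _ (n%:R * h)); last by rewrite lerDr.
by rewrite -ler_pdivrMr // -invfM ltW.
Qed.

Variable X : C -> Prop.
Implicit Types g v : C -> C.

Definition apx g := forall e : R, 0 < e ->
  exists h : {poly C}, forall w, X w -> nc (h.[w] - g w) <= e.

Lemma apx_cst (c : C) : apx (fun _ => c).
Proof. by move=> e e0; exists c%:P => w _; rewrite hornerC subrr nc0 ltW. Qed.

Lemma apx_id : apx id.
Proof. by move=> e e0; exists 'X => w _; rewrite hornerX subrr nc0 ltW. Qed.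

Lemma eq_apx g g' : (forall w, X w -> g w = g' w) -> apx g -> apx g'.
Proof. by move=> gg hg e /hg[h hh]; exists h => w Xw; rewrite -gg // hh. Qed.

Lemma apx_lim g : (forall e : R, 0 < e -> exists2 g', apx g' &
  forall w, X w -> nc (g' w - g w) <= e) -> apx g.
Proof.
move=> hg e e0; have e2 : 0 < e / 2 by rewrite divr_gt0.
have [g' /(_ _ e2) [h hh] hg'] := hg _ e2; exists h => w Xw.
have -> : h.[w] - g w = (h.[w] - g' w) + (g' w - g w) by ring.
apply: le_trans (ncD _ _) _; have := hh w Xw; have := hg' w Xw; lra.
Qed.

Lemma apxD g g' : apx g -> apx g' -> apx (fun w => g w + g' w).
Proof.
move=> hg hg' e e0; have e2 : 0 < e / 2 by rewrite divr_gt0.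
have [h hh] := hg _ e2; have [h' hh'] := hg' _ e2; exists (h + h') => w Xw.
rewrite hornerD opprD addrACA.
apply: le_trans (ncD _ _) _; have := hh w Xw; have := hh' w Xw; lra.
Qed.

Lemma apxM B g g' : (forall w, X w -> nc (g w) <= B) ->
  (forall w, X w -> nc (g' w) <= B) ->
  apx g -> apx g' -> apx (fun w => g w * g' w).
Proof.
move=> gB gB' hg hg' e e0.
pose K := `|B| + 1; have K1 : 1 <= K by rewrite lerDr.
have K0 : 0 < K by apply: lt_le_trans K1.
have BK : B <= K by rewrite (le_trans (ler_norm _)) // lerDl.
pose d := Num.min 1 (e / (3 * K)).
have d0 : 0 < d by rewrite lt_min ltr01 divr_gt0 // mulr_gt0.
have d1 : d <= 1 by rewrite ge_min lexx.
have de : d * (3 * K) <= e.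
  by rewrite -ler_pdivlMr ?mulr_gt0 // ge_min lexx orbT.
have [h hh] := hg _ d0; have [h' hh'] := hg' _ d0; exists (h * h') => w Xw.
rewrite hornerM.
have -> : h.[w] * h'.[w] - g w * g' w = (h.[w] - g w) * (h'.[w] - g' w) +
  (h.[w] - g w) * g' w + g w * (h'.[w] - g' w) by ring.
apply: le_trans (ncD _ _) _; apply: le_trans (lerD (ncD _ _) (lexx _)) _.
rewrite !ncM.
have a := hh w Xw; have b := hh' w Xw; have c := gB w Xw; have c' := gB' w Xw.
have a0 := nc_ge0 (h.[w] - g w); have b0 := nc_ge0 (h'.[w] - g' w).
have c0 := nc_ge0 (g w); have c0' := nc_ge0 (g' w).
have t1 : nc (h.[w] - g w) * nc (h'.[w] - g' w) <= d * K.
  by apply: ler_pM => //; lra.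
have t2 : nc (h.[w] - g w) * nc (g' w) <= d * K by apply: ler_pM => //; lra.
have t3 : nc (g w) * nc (h'.[w] - g' w) <= K * d by apply: ler_pM => //; lra.
lra.
Qed.

Lemma apxX B g n : (forall w, X w -> nc (g w) <= B) -> apx g -> apx (fun w => g w ^+ n).
Proof.
move=> gB hg; elim: n => [|n IH].
  by apply: eq_apx (apx_cst 1) => w _; rewrite expr0.
pose K := Num.max B (B ^+ n).
apply: (@eq_apx (fun w => g w * g w ^+ n)); first by move=> w _; rewrite exprS.
apply: (@apxM K) => // w Xw; rewrite le_max ?gB // ncX.
by rewrite lerXn2r ?gB ?orbT // nnegrE ?nc_ge0 // (le_trans (nc_ge0 (g w))) // gB.
Qed.

(** The partial sums of the geometric series in [u = 1 - g] miss [g^-1] by [u^n / g], and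
    [|g| >= 1 - rho]. *)
Lemma apx_neumann g rho : rho < 1 -> (forall w, X w -> nc (1 - g w) <= rho) ->
  apx g -> apx (fun w => (g w)^-1).
Proof.
move=> rho1 hrho hg; apply: apx_lim => e e0.
have [r0|r0] := ltrP rho 0.
  exists (fun _ => 0); first exact: apx_cst.
  by move=> w /hrho; rewrite leNgt (lt_le_trans r0) // nc_ge0.
have s0 : 0 < 1 - rho by rewrite subr_gt0.
have [n hn] : exists n, rho ^+ n <= e * (1 - rho).
  by apply: expr_small; rewrite ?r0 // mulr_gt0.
pose u w := 1 - g w.
have hu : apx u.
  apply: apxD; first exact: apx_cst.
  apply: (@eq_apx (fun w => (-1) * g w)); first by move=> w _; rewrite mulN1r.
  apply: (@apxM (1 + rho)) => //; last exact: apx_cst.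
    by move=> w _; rewrite ncN nc1 lerDl.
  move=> w /hrho h; have -> : g w = 1 - (1 - g w) by ring.
  by apply: le_trans (ncB _ _) _; rewrite nc1 lerD2l.
exists (fun w => \sum_(k < n) u w ^+ k).
  elim: (n) => [|m IH].
    by apply: eq_apx (apx_cst 0) => w _; rewrite big_ord0.
  apply: (@eq_apx (fun w => \sum_(k < m) u w ^+ k + u w ^+ m)).
    by move=> w _; rewrite big_ord_recr.
  by apply: apxD => //; apply: (@apxX rho).
move=> w Xw; have gw0 : g w != 0.
  apply/eqP => g0; have := hrho w Xw; rewrite g0 subr0 nc1 => h; lra.
have -> : \sum_(k < n) u w ^+ k - (g w)^-1 = - (u w ^+ n / g w).
  have := subrX1 (u w) n; rewrite (_ : u w - 1 = - g w); last by rewrite /u; ring.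
  move=> h; rewrite (_ : u w ^+ n = 1 - g w * \sum_(i < n) u w ^+ i); last first.
    by move: h => /eqP; rewrite subr_eq => /eqP ->; ring.
  by field.
rewrite ncN ncM ncX ncV.
have gl : 1 - rho <= nc (g w).
  have : nc (1 : C) <= nc (1 - g w) + nc (g w).
    by apply: le_trans (ncD _ _); rewrite subrK.
  rewrite nc1; have := hrho w Xw; rewrite /u; lra.
have gp : 0 < nc (g w) by apply: lt_le_trans gl.
rewrite ler_pdivrMr //; apply: le_trans (_ : rho ^+ n <= _).
  by rewrite lerXn2r ?nnegrE ?nc_ge0 // hrho.
by apply: le_trans hn _; rewrite ler_wpM2l // ltW.
Qed.

(** Runge's pole pushing. The pole first lies far away, where a geometric series converges. It is
    then moved closer by the factor [q = 1 - c / 2] at a time: the quotient of [v + s q] by [v + s]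
    is [1 - (s c / 2) / (v + s)], within [1 / 2] of [1] because [|v + s| >= c s]. *)
Lemma apx_inv_shift v B (c t : R) : 0 < c <= 1 -> (forall w, X w -> nc (v w) <= B) ->
  (forall w (s : R), X w -> 0 < s -> c * s <= nc (v w + s%:C)) ->
  apx v -> 0 < t -> apx (fun w => (v w + t%:C)^-1).
Proof.
move=> /andP[c0 c1] vB vc hv t0.
pose q := 1 - c / 2.
have q0 : 0 < q by rewrite /q; lra.
have q1 : q < 1 by rewrite /q; lra.
pose B' := `|B| + 1.
have B'0 : 0 < B' by rewrite ltr_wpDl.
have vB' w : X w -> nc (v w) <= B'.
  by move=> Xw; rewrite (le_trans (vB _ Xw)) // (le_trans (ler_norm _)) // lerDl.
have bnd s w : 0 < s -> X w -> nc (v w + s%:C)^-1 <= (c * s)^-1.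
  move=> s0 Xw; rewrite ncV lef_pV2 ?posrE ?mulr_gt0 ?vc //.
  by apply: lt_le_trans (vc w s Xw s0); rewrite mulr_gt0.
have nz s w : 0 < s -> X w -> v w + s%:C != 0.
  by move=> s0 Xw; rewrite -nc_gt0; apply: lt_le_trans (vc w s Xw s0); rewrite mulr_gt0.
have base T : 2 * B' <= T -> apx (fun w => (v w + T%:C)^-1).
  move=> hT; have T0 : 0 < T by lra.
  have TC0 : T%:C != 0 :> C by rewrite -nc_gt0 nc_real normr_gt0 gt_eqF.
  have hvT : apx (fun w => (T^-1)%:C * v w).
    apply: (@apxM (Num.max B' (T^-1))) => //; last exact: apx_cst.
      by move=> w _; rewrite nc_real gtr0_norm ?invr_gt0 // le_max lexx orbT.
    by move=> w Xw; rewrite le_max vB'.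
  have hg : apx (fun w => 1 + (T^-1)%:C * v w) by apply: apxD => //; exact: apx_cst.
  have small w : X w -> nc (1 - (1 + (T^-1)%:C * v w)) <= 1 / 2.
    move=> Xw; rewrite opprD addNKr ncN ncM nc_real gtr0_norm ?invr_gt0 //.
    rewrite mulrC ler_pdivrMr //; have := vB' w Xw; lra.
  have hi := apx_neumann (_ : 1 / 2 < 1) small hg.
  have {}hi := hi ltac:(lra).
  apply: (@eq_apx (fun w => (T^-1)%:C * (1 + (T^-1)%:C * v w)^-1)).
    move=> w Xw; rewrite rmorphV ?unitfE ?gt_eqF //= -invfM mulrDr mulr1.
    by rewrite mulrA divff // mul1r addrC.
  apply: (@apxM (Num.max 2 (T^-1))) => //; last exact: apx_cst.
    by move=> w _; rewrite nc_real gtr0_norm ?invr_gt0 // le_max lexx orbT.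
  move=> w Xw; rewrite le_max ncV; apply/orP; left.
  have : nc (1 : C) <= nc (1 - (1 + (T^-1)%:C * v w)) + nc (1 + (T^-1)%:C * v w).
    by apply: le_trans (ncD _ _); rewrite subrK.
  rewrite nc1 => h; have := small w Xw => h2.
  rewrite -[2]invrK lef_pV2 ?posrE ?invr_gt0 //; lra.
have step s : 0 < s -> apx (fun w => (v w + s%:C)^-1) ->
    apx (fun w => (v w + (s * q)%:C)^-1).
  move=> s0 hs; have sq0 : 0 < s * q by rewrite mulr_gt0.
  pose r := s * (c / 2).
  have r0 : 0 < r by rewrite mulr_gt0 // divr_gt0.
  have hr : apx (fun w => (- r)%:C * (v w + s%:C)^-1).
    apply: (@apxM (Num.max r (c * s)^-1)) => //; last exact: apx_cst.
      by move=> w _; rewrite nc_real normrN gtr0_norm // le_max lexx.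
    by move=> w Xw; rewrite le_max bnd ?orbT.
  have hg : apx (fun w => 1 + (- r)%:C * (v w + s%:C)^-1) by apply: apxD => //; exact: apx_cst.
  have small w : X w -> nc (1 - (1 + (- r)%:C * (v w + s%:C)^-1)) <= 1 / 2.
    move=> Xw; rewrite opprD addNKr ncN ncM nc_real normrN gtr0_norm //.
    apply: le_trans (ler_wpM2l (ltW r0) (bnd s w s0 Xw)) _.
    rewrite /r ler_pdivrMr ?mulr_gt0 //; lra.
  have hi := apx_neumann (_ : 1 / 2 < 1) small hg.
  have {}hi := hi ltac:(lra).
  apply: (@eq_apx (fun w => (v w + s%:C)^-1 * (1 + (- r)%:C * (v w + s%:C)^-1)^-1)).
    move=> w Xw; have n1 := nz s w s0 Xw; have n2 := nz _ w sq0 Xw.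
    have e : v w + (s * q)%:C = v w + s%:C + (- r)%:C.
      rewrite -addrA -rmorphD; congr (_ + _%:C); rewrite /r /q; ring.
    rewrite -invfM mulrDr mulr1 mulrCA divff // mulr1 e //.
  apply: (@apxM (Num.max 2 (c * s)^-1)) => //.
    by move=> w Xw; rewrite le_max bnd ?orbT.
  move=> w Xw; rewrite le_max ncV; apply/orP; left.
  have : nc (1 : C) <= nc (1 - (1 + (- r)%:C * (v w + s%:C)^-1)) +
      nc (1 + (- r)%:C * (v w + s%:C)^-1).
    by apply: le_trans (ncD _ _); rewrite subrK.
  rewrite nc1 => h; have := small w Xw => h2.
  rewrite -[2]invrK lef_pV2 ?posrE ?invr_gt0 //; lra.
have [n hn] : exists n, q ^+ n <= t / (2 * B').
  by apply: expr_small; rewrite ?(ltW q0) // divr_gt0 // mulr_gt0.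
have qn0 : 0 < q ^+ n by rewrite exprn_gt0.
(* Start from [T = t / q^n], which is at least [2 B'], and return to [t] in [n] moves. *)
have -> : t = t / q ^+ n * q ^+ n by rewrite divfK ?gt_eqF.
have : 2 * B' <= t / q ^+ n.
  by rewrite ler_pdivlMr // mulrC -ler_pdivlMr ?mulr_gt0.
move: (t / q ^+ n) => T hT; have T0 : 0 < T by lra.
elim: n {hn qn0} => [|n IH]; first by rewrite expr0 mulr1; exact: base.
by rewrite exprSr mulrA; apply: step => //; rewrite mulr_gt0 // exprn_gt0.
Qed.

End UniformApproximation.

(** * Iterates of a rational map that converge to the sign of the real part *)

Section SignApproximation.
Variable R : realType.
Local Notation C := R[i].
Local Notation nc := (@Normc.normc R).

(* The sector is mapped into itself because [tau w = 2 / (w + w^-1)], and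
   [(1 - tau w) / (1 + tau w)] is the square of [(1 - w) / (1 + w)]. *)
Definition tau (w : C) : C := 2 * w / (1 + w ^+ 2).

Definition sector (e : R) (w : C) := e * nc w <= `|Re w|.

(** In the double sector [Re (w^2) >= (2 e^2 - 1) |w|^2], so [w^2] keeps away from the negative half
    line. The first bound is the one that [apx_inv_shift] asks for, the second one controls
    [tau]. *)
Lemma sector_sqD e (w : C) (s : R) : 0 < e <= 1 / 2 -> sector e w -> 0 <= s ->
  e ^+ 2 * s ^+ 2 <= nc (w ^+ 2 + s%:C) ^+ 2 /\
  4 * e ^+ 2 * s * nc w ^+ 2 <= nc (w ^+ 2 + s%:C) ^+ 2.
Proof.
move=> /andP[e0 e1] hw s0.
have : e ^+ 2 * nc w ^+ 2 <= Re w ^+ 2.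
  rewrite -exprMn -[Re w ^+ 2]real_normK ?num_real //.
  by rewrite lerXn2r ?nnegrE ?mulr_ge0 ?nc_ge0 ?normr_ge0 // ltW.
rewrite !nc_sq; case: w {hw} => x y /=; rewrite expr2 /=.
set m := x ^+ 2 + y ^+ 2 => hm.
have m0 : 0 <= m by rewrite addr_ge0 ?sqr_ge0.
have -> : (x * x - y * y + s) ^+ 2 + (x * y + y * x + 0) ^+ 2 =
  m ^+ 2 + 2 * s * (2 * x ^+ 2 - m) + s ^+ 2 by rewrite /m; ring.
have h1 := ler_wpM2l s0 hm.
have e2 : e ^+ 2 <= 1 / 4 by nra.
split; last by have := sqr_ge0 (m - s); nra.
have := sqr_ge0 (m + (2 * e ^+ 2 - 1) * s).
have : 0 <= e ^+ 2 * s ^+ 2 * (3 - 4 * e ^+ 2).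
  by rewrite !mulr_ge0 ?sqr_ge0 //; lra.
nra.
Qed.

Lemma tau_den_neq0 e (w : C) : 0 < e <= 1 / 2 -> sector e w -> 1 + w ^+ 2 != 0.
Proof.
move=> he hw; have [h _] := sector_sqD he hw ler01.
rewrite -nc_gt0 -(@ltr_pXn2r _ 2) ?nnegrE ?nc_ge0 // expr0n /= addrC.
by apply: lt_le_trans h; move/andP: he => [e0 _]; rewrite expr1n mulr1 exprn_gt0.
Qed.

Lemma tau_bound e (w : C) : 0 < e <= 1 / 2 -> sector e w -> nc (tau w) <= e^-1.
Proof.
move=> he hw; have [_ h] := sector_sqD he hw ler01.
have d0 := tau_den_neq0 he hw; rewrite -nc_gt0 in d0.
have /andP[e0 _] := he.
rewrite /tau !ncM ncV ler_pdivrMr // ler_pdivlMl //.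
rewrite (_ : nc 2 = 2); last by rewrite -[2](rmorph_nat (real_complex R)) nc_real normr_nat.
rewrite -(@ler_pXn2r _ 2) ?nnegrE ?mulr_ge0 ?nc_ge0 ?(ltW e0) //.
move: h; rewrite addrC; nra.
Qed.

Lemma tauN (w : C) : tau (- w) = - tau w.
Proof. by rewrite /tau sqrrN mulrN mulNr. Qed.

Lemma Re_tau (w : C) : Re (tau w) = 2 * Re w * (1 + nc w ^+ 2) / nc (1 + w ^+ 2) ^+ 2.
Proof.
rewrite /tau !nc_sq; case: w => x y; rewrite expr2 /=.
by move: (_ ^-1) => d; ring.
Qed.

Lemma sector_tau e (w : C) : 0 < e <= 1 / 2 -> sector e w -> sector e (tau w).
Proof.
move=> he hw; have d0 := tau_den_neq0 he hw; have d1 := d0; rewrite -nc_gt0 in d1.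
rewrite /sector Re_tau !normrM normfV.
have p1 : 0 < 1 + nc w ^+ 2 by rewrite ltr_pwDl // sqr_ge0.
rewrite (gtr0_norm p1) (@ger0_norm _ 2) // (@ger0_norm _ (_ ^+ 2)) ?sqr_ge0 //.
rewrite /tau !ncM ncV.
rewrite (_ : nc 2 = 2); last by rewrite -[2](rmorph_nat (real_complex R)) nc_real normr_nat.
have h : nc (1 + w ^+ 2) <= 1 + nc w ^+ 2.
  by apply: le_trans (ncD _ _) _; rewrite nc1 ncX.
rewrite ler_pdivlMr ?exprn_gt0 //.
have -> : e * (2 * nc w / nc (1 + w ^+ 2)) * nc (1 + w ^+ 2) ^+ 2 =
  2 * (e * nc w * nc (1 + w ^+ 2)) by field; rewrite gt_eqF.
have := ler_pM (mulr_ge0 (ltW (proj1 (andP he))) (nc_ge0 w)) (nc_ge0 _) hw h.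
lra.
Qed.

Definition tau_iter k (w : C) := iter k tau w.

Lemma tau_iterN k w : tau_iter k (- w) = - tau_iter k w.
Proof. by elim: k => //= k ->; rewrite tauN. Qed.

Lemma tau_iter0 k : tau_iter k 0 = 0.
Proof. by elim: k => //= k ->; rewrite /tau mulr0 mul0r. Qed.

Lemma sector_tau_iter e k w : 0 < e <= 1 / 2 -> sector e w -> sector e (tau_iter k w).
Proof. by move=> he hw; elim: k => //= k; exact: sector_tau. Qed.

Lemma tau_iter_cvg e rho k w : 0 < e <= 1 / 2 -> sector e w -> 0 <= rho ->
  nc (1 - w) <= rho * nc (1 + w) ->
  nc (1 - tau_iter k w) <= rho ^+ (2 ^ k) * nc (1 + tau_iter k w).
Proof.
move=> he hw r0 h; elim: k => [|k IH] /=; first by rewrite expr1.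
set u := tau_iter k w in IH *.
have d0 := tau_den_neq0 he (sector_tau_iter k he hw); rewrite -/u in d0.
have -> : 1 - tau u = (1 - u) ^+ 2 / (1 + u ^+ 2) by rewrite /tau; field.
have -> : 1 + tau u = (1 + u) ^+ 2 / (1 + u ^+ 2) by rewrite /tau; field.
rewrite !(ncM (_ ^+ 2)) !(ncX _ 2) mulrA; apply: ler_wpM2r; first exact: nc_ge0.
rewrite expnSr exprM -exprMn lerXn2r ?nnegrE ?nc_ge0 ?mulr_ge0 ?exprn_ge0 ?nc_ge0 //.
Qed.

(** The polynomial approximates an iterate of [tau], which is odd and close to [1] on the right half
    of the sector away from [0]. The exact value [0] at [0] matters because [1 - h^2] has to be [1]
    on the zero fibre in [kallin_zero]. *)
Lemma sign_approx (e B d eta : R) : 0 < e <= 1 / 2 -> 0 <= B -> 0 < d -> 0 < eta ->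
  exists h : {poly C}, h.[0] = 0 /\
  forall w, sector e w -> nc w <= B ->
    [/\ nc h.[w] <= e^-1 + 1,
        d <= nc w -> 0 < Re w -> nc (h.[w] - 1) <= eta &
        d <= nc w -> Re w < 0 -> nc (h.[w] + 1) <= eta].
Proof.
move=> he B0 d0 eta0; have /andP[e0 e1] := he.
pose X w := sector e w /\ nc w <= B.
have ei0 : 0 < e^-1 by rewrite invr_gt0.
pose M := Num.max B e^-1.
have bnd k w : X w -> nc (tau_iter k w) <= M.
  move=> [hw wB]; rewrite le_max; case: k => [|k] /=; first by rewrite wB.
  by rewrite (tau_bound he) ?orbT //; exact: sector_tau_iter.
have M0 : 0 <= M by rewrite le_max B0.
have apxt k : apx X (tau_iter k).
  elim: k => [|k IH]; first exact: apx_id.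
  have sqb w : X w -> nc (tau_iter k w ^+ 2) <= M ^+ 2.
    by move=> Xw; rewrite ncX lerXn2r ?nnegrE ?nc_ge0 ?bnd.
  have lowb w (s : R) : X w -> 0 < s -> e * s <= nc (tau_iter k w ^+ 2 + s%:C).
    move=> [hw _] s0; have [h _] := sector_sqD he (sector_tau_iter k he hw) (ltW s0).
    by rewrite -(@ler_pXn2r _ 2) ?nnegrE ?nc_ge0 ?mulr_ge0 ?(ltW e0) ?(ltW s0) // exprMn.
  have e1' : 0 < e <= 1 by lra.
  (* The denominator of the next iterate is [v + 1], with [v] the square of the current one. *)
  have hi := apx_inv_shift e1' sqb lowb (apxX 2 (bnd k) IH) ltr01.
  apply: (@eq_apx _ _ (fun w => (2 * tau_iter k w) * (tau_iter k w ^+ 2 + 1%:C)^-1)).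
    by move=> w _; rewrite /= /tau addrC.
  have nc2 : nc 2 = 2 :> R by rewrite -[2](rmorph_nat (real_complex R)) nc_real normr_nat.
  apply: (@apxM _ _ (2 * M + e^-1)) => //.
  - by move=> w Xw; rewrite ncM nc2; have := bnd k w Xw; lra.
  - move=> w Xw; rewrite ncV; apply: (@le_trans _ _ e^-1); last by lra.
    have h := lowb w 1 Xw ltr01; rewrite mulr1 in h.
    by rewrite lef_pV2 ?posrE // (lt_le_trans e0).
  - apply: (@apxM _ _ (2 + M)); [| |exact: apx_cst|exact: IH].
      by move=> w _; rewrite nc2; lra.
    by move=> w Xw; have := bnd k w Xw; lra.
pose D := (1 + B) ^+ 2.
have D0 : 0 < D by rewrite exprn_gt0 // ltr_pwDl.
(* From [|1 - w|^2 = |1 + w|^2 - 4 Re w], with [Re w >= e d] and [|1 + w|^2 <= D]. The minimum with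
   [1 / 2] keeps [r2] nonnegative. *)
pose r2 := 1 - Num.min (4 * e * d / D) (1 / 2).
have r20 : 0 <= r2 < 1.
  have : 0 < 4 * e * d / D by rewrite divr_gt0 // !mulr_gt0.
  have : Num.min (4 * e * d / D) (1 / 2) <= 1 / 2 by rewrite ge_min lexx orbT.
  by rewrite /r2 => a b; have : 0 < Num.min (4 * e * d / D) (1 / 2); [rewrite lt_min b; lra|lra].
pose rho := Num.sqrt r2.
have rho0 : 0 <= rho < 1.
  rewrite sqrtr_ge0 /= -(@ltr_pXn2r _ 2) ?nnegrE ?sqrtr_ge0 //.
  by rewrite sqr_sqrtr ?expr1n; case/andP: r20.
have start w : sector e w -> nc w <= B -> d <= nc w -> 0 < Re w ->
    nc (1 - w) <= rho * nc (1 + w).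
  move=> hw wB wd wp.
  rewrite -(@ler_pXn2r _ 2) ?nnegrE ?nc_ge0 ?mulr_ge0 ?nc_ge0 ?sqrtr_ge0 //.
  rewrite exprMn sqr_sqrtr; last by case/andP: r20.
  have hD : nc (1 + w) ^+ 2 <= D.
    rewrite lerXn2r ?nnegrE ?nc_ge0 ?addr_ge0 //.
    by apply: le_trans (ncD _ _) _; rewrite nc1 lerD2l.
  have h1 : nc (1 - w) ^+ 2 = nc (1 + w) ^+ 2 - 4 * Re w.
    by rewrite !nc_sq; case: (w) => x y /=; ring.
  have hRe : e * d <= Re w.
    move: hw; rewrite /sector gtr0_norm // => hw; apply: le_trans hw.
    by rewrite ler_wpM2l // ltW.
  rewrite h1 /r2.
  suff : Num.min (4 * e * d / D) (1 / 2) * nc (1 + w) ^+ 2 <= 4 * Re w by lra.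
  apply: (@le_trans _ _ (4 * e * d / D * D)).
    apply: ler_pM; rewrite ?sqr_ge0 //; last by rewrite ge_min lexx.
    rewrite le_min !mulr_ge0 ?invr_ge0 ?(ltW e0) ?(ltW d0) ?(ltW D0) //.
  by rewrite divfK ?gt_eqF //; lra.
(* Three errors add up: the approximation at [w], the approximation at [0], and the distance from
   the iterate to [1]. The bound [1 / 3] keeps the first two together below [1]. *)
pose eta' := Num.min (eta / 3) (1 / 3).
have eta'0 : 0 < eta' by rewrite lt_min !divr_gt0.
have eta'1 : eta' <= eta / 3 by rewrite ge_min lexx.
have eta'2 : eta' <= 1 / 3 by rewrite ge_min lexx orbT.
have [n hn] : exists n, rho ^+ n <= eta' / (1 + e^-1).
  by apply: expr_small => //; rewrite divr_gt0 // ltr_wpDl // ltW.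
pose t := tau_iter n.+1.
have tb w : sector e w -> nc (t w) <= e^-1.
  by move=> hw; exact: (tau_bound he (sector_tau_iter n he hw)).
have tp w : sector e w -> nc w <= B -> d <= nc w -> 0 < Re w -> nc (1 - t w) <= eta'.
  move=> hw wB wd wp; have /andP[rh0 rh1] := rho0.
  apply: le_trans (tau_iter_cvg n.+1 he hw rh0 (start w hw wB wd wp)) _.
  apply: (@le_trans _ _ (eta' / (1 + e^-1) * (1 + e^-1))); last first.
    by rewrite divfK // gt_eqF // ltr_wpDl // ltW.
  apply: ler_pM; rewrite ?exprn_ge0 ?nc_ge0 //.
    apply: le_trans hn; rewrite ler_wiXn2l ?(ltW rh1) //.
    by rewrite (leq_trans (leqnSn n)) // ltnW // ltn_expl.
  by apply: le_trans (ncD _ _) _; rewrite nc1 lerD2l tb.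
have [h hh] := apxt n.+1 _ eta'0.
have h0 : nc h.[0] <= eta'.
  have := hh 0; rewrite tau_iter0 subr0; apply.
  by split; rewrite ?nc0 // /sector nc0 mulr0 normr_ge0.
exists (h - h.[0]%:P); split; first by rewrite hornerD hornerN hornerC subrr.
move=> w hw wB; have Xw : X w by [].
have close : nc ((h - h.[0]%:P).[w] - t w) <= eta' + eta'.
  rewrite hornerD hornerN hornerC addrAC.
  by apply: le_trans (ncB _ _) _; rewrite lerD // hh.
set v := (h - h.[0]%:P).[w] in close *.
split.
- have -> : v = (v - t w) + t w by ring.
  apply: le_trans (ncD _ _) _; have := tb w hw; lra.
- move=> wd wp; have -> : v - 1 = (v - t w) - (1 - t w) by ring.
  apply: le_trans (ncB _ _) _; have := tp w hw wB wd wp; lra.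
- move=> wd wn; have -> : v + 1 = (v - t w) + (1 - t (- w)) by rewrite /t tau_iterN; ring.
  apply: le_trans (ncD _ _) _.
  have : nc (1 - t (- w)) <= eta'.
    apply: tp; rewrite ?ncN // ?cReN ?oppr_gt0 //.
    by rewrite /sector cReN ncN normrN.
  lra.
Qed.

End SignApproximation.

(** * Kallin's lemma *)

Section Kallin.
Variable R : realType.
Local Notation C := R[i].
Local Notation C2 := 'cV[C]_2.
Local Notation nc := (@Normc.normc R).
Implicit Types (E : cset R) (z w : C2).

Lemma nc2 : nc 2 = 2.
Proof. by rewrite -[2](rmorph_nat (real_complex R)) nc_real normr_nat. Qed.

(** If [|q z| > M], the function [p (1 + h (p)) (q / q z)^N] is small on both cones: on [E1] because
    of the power, on [E2] because [h] is close to [-1] or, near the zeros of [p], because of the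
    factor [p]. At [z] its modulus is about [2 |p z|]. *)
Lemma kallin_pos E1 E2 (p : C2 -> C) (e r : R) z :
  polyfun p -> 0 < e <= 1 / 2 -> 0 <= r -> E1 0 ->
  (forall w, E1 w -> e * nc (p w) <= Re (p w)) ->
  (forall w, E2 w -> e * nc (p w) <= - Re (p w)) ->
  poly_hull (fun w => setU2 E1 E2 w /\ disk r w) z -> 0 < Re (p z) ->
  poly_hull (fun w => E1 w /\ disk r w) z.
Proof.
move=> pp /andP[e0 e1] r0 E10 hE1 hE2 hz pz; apply/poly_hullP => q M pq hq.
have dz := hull_disk r0 hz; move/poly_hullP: hz => hz.
have M0 : 0 <= M.
  apply: le_trans (nc_ge0 _) (hq 0 _); split => //.
  by rewrite /disk /sqn !mxE nc0 expr0n /= addr0 sqr_ge0.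
rewrite leNgt; apply/negP => Mq.
have q0 : 0 < nc (q z) by apply: le_lt_trans Mq.
have zt0 : 0 < nc (p z).
  by apply: lt_le_trans (Re_le_nc _); rewrite normr_gt0 gt_eqF.
(* The sector is widened so that it also contains [p z]. *)
pose e' := Num.min e (Re (p z) / nc (p z)).
have e'0 : 0 < e' by rewrite lt_min e0 divr_gt0.
have he' : 0 < e' <= 1 / 2 by rewrite e'0 ge_min e1.
have e'e : e' <= e by rewrite ge_min lexx.
have e'z : e' * nc (p z) <= Re (p z).
  by rewrite -ler_pdivlMr // ge_min lexx orbT.
have [B B0 hB] := polyfun_bounded r0 pp.
have [B2 B20 hB2] := polyfun_bounded r0 pq.
pose c := 1 + (e'^-1 + 1); have c0 : 0 < c by rewrite /c; have := invr_gt0 e'; lra.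
pose K := Num.max 1 (B2 / nc (q z)).
have K0 : 0 < K by rewrite lt_max ltr01.
pose rho := M / nc (q z).
have rho0 : 0 <= rho < 1 by rewrite /rho divr_ge0 ?(ltW q0) //= ltr_pdivrMr // mul1r.
(* The exponent is fixed first; [d] and [eta] then compensate the growth [K^N] of the power on
   [E2]. *)
have [N hN] : exists N, rho ^+ N <= nc (p z) / (2 * (B + 1) * c).
  by apply: expr_small => //; rewrite divr_gt0 // !mulr_gt0 // ltr_wpDl.
have KN : 0 < K ^+ N by rewrite exprn_gt0.
pose d := nc (p z) / (2 * c * K ^+ N).
have d0 : 0 < d by rewrite divr_gt0 // !mulr_gt0.
pose eta := Num.min 1 (nc (p z) / (2 * (B + 1) * K ^+ N)).
have eta0 : 0 < eta by rewrite lt_min ltr01 divr_gt0 // !mulr_gt0 // ltr_wpDl.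
have eta1 : eta <= 1 by rewrite ge_min lexx.
have eta2 : eta * (2 * (B + 1) * K ^+ N) <= nc (p z).
  by rewrite -ler_pdivlMr ?ge_min ?lexx ?orbT // !mulr_gt0 // ltr_wpDl.
pose d' := Num.min d (nc (p z)).
have d'0 : 0 < d' by rewrite lt_min d0.
have [h [h0 hh]] := sign_approx he' B0 d'0 eta0.
pose f w := p w * (1 + h.[p w]) * (q w / q z) ^+ N.
have pf : polyfun f.
  apply: polyfunM; last first.
    by apply: polyfunX; apply: polyfunM => //; exact: polyfun_cst.
  apply: polyfunM => //; apply: polyfunD; first exact: polyfun_cst.
  exact: polyfun_horner.
have sec w : E1 w \/ E2 w -> sector e' (p w).
  rewrite /sector => -[/hE1|/hE2] h1; apply: le_trans (_ : e * nc (p w) <= _).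
  - by rewrite ler_wpM2r ?nc_ge0.
  - by apply: le_trans h1 _; exact: ler_norm.
  - by rewrite ler_wpM2r ?nc_ge0.
  - by apply: le_trans h1 _; rewrite -normrN; exact: ler_norm.
have nf w : nc (f w) = nc (p w) * nc (1 + h.[p w]) * (nc (q w) / nc (q z)) ^+ N.
  by rewrite /f !ncM ncX ncM ncV.
have fz : nc (f z) <= nc (p z) / 2.
  apply: hz => // w [Ew dw]; rewrite nf.
  have [b1 b2 b3] := hh _ (sec w Ew) (hB w dw).
  have bc : nc (1 + h.[p w]) <= c.
    by apply: le_trans (ncD _ _) _; rewrite nc1 lerD2l.
  have qK : (nc (q w) / nc (q z)) ^+ N <= K ^+ N.
    rewrite lerXn2r ?nnegrE ?divr_ge0 ?nc_ge0 ?(ltW K0) //.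
    by rewrite le_max ler_pM2r ?invr_gt0 // hB2 // orbT.
  case: Ew => Ew.
    apply: (@le_trans _ _ ((B + 1) * c * (nc (p z) / (2 * (B + 1) * c)))).
      apply: ler_pM; rewrite ?mulr_ge0 ?exprn_ge0 ?divr_ge0 ?nc_ge0 //.
        apply: ler_pM; rewrite ?nc_ge0 //.
        by apply: le_trans (hB w dw) _; rewrite lerDl.
      apply: le_trans hN; rewrite lerXn2r ?nnegrE ?divr_ge0 ?nc_ge0 //.
      by rewrite /rho ler_pM2r ?invr_gt0 // hq.
    have -> : (B + 1) * c * (nc (p z) / (2 * (B + 1) * c)) = nc (p z) / 2.
      by field; rewrite !gt_eqF // ltr_wpDl.
    by [].
  have [pd|pd] := ltrP (nc (p w)) d'.
    apply: (@le_trans _ _ (d * c * K ^+ N)).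
      apply: ler_pM; rewrite ?mulr_ge0 ?exprn_ge0 ?divr_ge0 ?nc_ge0 //.
      apply: ler_pM; rewrite ?nc_ge0 //.
      by apply: le_trans (ltW pd) _; rewrite ge_min lexx.
    have -> : d * c * K ^+ N = nc (p z) / 2.
      by rewrite /d; field; rewrite !gt_eqF.
    by [].
  have pw0 : 0 < nc (p w) by apply: lt_le_trans pd.
  have Rn : Re (p w) < 0.
    by have := hE2 w Ew; have := mulr_gt0 e0 pw0; lra.
  have := b3 pd Rn; rewrite addrC => b4.
  apply: (@le_trans _ _ ((B + 1) * eta * K ^+ N)).
    apply: ler_pM; rewrite ?mulr_ge0 ?exprn_ge0 ?divr_ge0 ?nc_ge0 //.
    apply: ler_pM; rewrite ?nc_ge0 //.
    by apply: le_trans (hB w dw) _; rewrite lerDl.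
  by lra.
have [_ b2 _] : [/\ nc h.[p z] <= e'^-1 + 1,
    d' <= nc (p z) -> 0 < Re (p z) -> nc (h.[p z] - 1) <= eta &
    d' <= nc (p z) -> Re (p z) < 0 -> nc (h.[p z] + 1) <= eta].
  apply: hh; last exact: hB.
  by rewrite /sector gtr0_norm.
have {}b2 := b2 _ pz; rewrite ge_min lexx orbT in b2; have {}b2 := b2 isT.
move: fz; rewrite nf divff ?gt_eqF // expr1n mulr1 -[nc (p z) / 2]mulr1 -mulrA.
rewrite ler_pM2l // => b5.
have := ncB (1 + h.[p z]) (h.[p z] - 1).
have -> : 1 + h.[p z] - (h.[p z] - 1) = 2 by ring.
by rewrite nc2; lra.
Qed.

(** The test function is now [(1 - h (p)^2) (q / q z)^N]. Its first factor is [1] on the fibre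
    [p = 0] and small in both sectors away from it, so only the part of [E] near the fibre
    counts. *)
Lemma kallin_zero E (p q : C2 -> C) (e r d M : R) z :
  polyfun p -> polyfun q -> 0 < e <= 1 / 2 -> 0 <= r -> 0 < d -> E 0 -> p 0 = 0 ->
  (forall w, E w -> e * nc (p w) <= `|Re (p w)|) ->
  (forall w, E w -> disk r w -> nc (p w) <= d -> nc (q w) <= M) ->
  poly_hull (fun w => E w /\ disk r w) z -> p z = 0 -> nc (q z) <= M.
Proof.
move=> pp pq he r0 d0 E0 p0 hE hq hz pz; have /andP[e0 e1] := he.
have dz := hull_disk r0 hz; move/poly_hullP: hz => hz.
have M0 : 0 <= M.
  apply: le_trans (nc_ge0 _) (hq 0 _ _ _) => //; last by rewrite p0 nc0 ltW.
  by rewrite /disk /sqn !mxE nc0 expr0n /= addr0 sqr_ge0.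
rewrite leNgt; apply/negP => Mq.
have q0 : 0 < nc (q z) by apply: le_lt_trans Mq.
have [B B0 hB] := polyfun_bounded r0 pp.
have [B2 B20 hB2] := polyfun_bounded r0 pq.
pose c := 1 + (e^-1 + 1); have c0 : 0 < c by rewrite /c; have := invr_gt0 e; lra.
pose K := Num.max 1 (B2 / nc (q z)).
have K0 : 0 < K by rewrite lt_max ltr01.
pose rho := M / nc (q z).
have rho0 : 0 <= rho < 1 by rewrite /rho divr_ge0 ?(ltW q0) //= ltr_pdivrMr // mul1r.
have [N hN] : exists N, rho ^+ N <= (2 * (c * c))^-1.
  by apply: expr_small => //; rewrite invr_gt0 !mulr_gt0.
have KN : 0 < K ^+ N by rewrite exprn_gt0.
pose eta := (2 * c * K ^+ N)^-1.
have eta0 : 0 < eta by rewrite invr_gt0 !mulr_gt0.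
have [h [h0 hh]] := sign_approx he B0 d0 eta0.
pose f w := (1 - h.[p w]) * (1 + h.[p w]) * (q w / q z) ^+ N.
have pf : polyfun f.
  apply: polyfunM; last first.
    by apply: polyfunX; apply: polyfunM => //; exact: polyfun_cst.
  have ph := polyfun_horner h pp.
  apply: polyfunM; apply: polyfunD => //; do ?exact: polyfun_cst.
  by apply: eq_polyfun (polyfunM (polyfun_cst (-1)) ph) => w; rewrite mulN1r.
have nf w : nc (f w) = nc (1 - h.[p w]) * nc (1 + h.[p w]) * (nc (q w) / nc (q z)) ^+ N.
  by rewrite /f !ncM ncX ncM ncV.
have : nc (f z) <= 1 / 2.
  apply: hz => // w [Ew dw]; rewrite nf.
  have [b1 b2 b3] := hh _ (hE w Ew) (hB w dw).
  have bc : nc (1 + h.[p w]) <= c.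
    by apply: le_trans (ncD _ _) _; rewrite nc1 lerD2l.
  have bc' : nc (1 - h.[p w]) <= c.
    by apply: le_trans (ncB _ _) _; rewrite nc1 lerD2l.
  have qK : (nc (q w) / nc (q z)) ^+ N <= K ^+ N.
    rewrite lerXn2r ?nnegrE ?divr_ge0 ?nc_ge0 ?(ltW K0) //.
    by rewrite le_max ler_pM2r ?invr_gt0 // hB2 // orbT.
  have [pd|pd] := lerP (nc (p w)) d.
    apply: (@le_trans _ _ (c * c * (2 * (c * c))^-1)).
      apply: ler_pM; rewrite ?mulr_ge0 ?exprn_ge0 ?divr_ge0 ?nc_ge0 //.
        by apply: ler_pM; rewrite ?nc_ge0.
      apply: le_trans hN; rewrite lerXn2r ?nnegrE ?divr_ge0 ?nc_ge0 //.
      by rewrite /rho ler_pM2r ?invr_gt0 // hq.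
    have -> : c * c * (2 * (c * c))^-1 = 1 / 2 by field; rewrite gt_eqF.
    by [].
  have pw0 : 0 < nc (p w) by apply: lt_trans pd.
  have fin : c * eta * K ^+ N = 1 / 2 by rewrite /eta; field; rewrite !gt_eqF.
  rewrite -fin; apply: ler_pM; rewrite ?mulr_ge0 ?exprn_ge0 ?divr_ge0 ?nc_ge0 //.
  have := hE w Ew; have := mulr_gt0 e0 pw0.
  have [Rp|Rn|->] := ltrgtP (Re (p w)) 0; last by rewrite normr0; lra.
    move=> _ _; have := b3 (ltW pd) Rp; rewrite addrC => b4.
    by apply: ler_pM; rewrite ?nc_ge0.
  move=> _ _; have := b2 (ltW pd) Rn; rewrite ncBC => b4.
  by rewrite mulrC; apply: ler_pM; rewrite ?nc_ge0.
rewrite nf pz h0 subr0 addr0 nc1 mulr1 mul1r divff ?gt_eqF // expr1n; lra.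
Qed.

(** When [p z] is purely imaginary, a slight rotation of [p] gives it a nonzero real part and still
    separates the cones. *)
Lemma kallin_neq0 E1 E2 (p : C2 -> C) (e r : R) z :
  polyfun p -> 0 < e -> 0 <= r -> E1 0 -> E2 0 -> cone_cvx E1 -> cone_cvx E2 ->
  (forall w, E1 w -> e * nc (p w) <= Re (p w)) ->
  (forall w, E2 w -> e * nc (p w) <= - Re (p w)) ->
  poly_hull (fun w => setU2 E1 E2 w /\ disk r w) z -> p z != 0 -> E1 z \/ E2 z.
Proof.
move=> pp e0 r0 E10 E20 c1 c2 hE1 hE2 hz pz0.
pose e' := Num.min e (1 / 2).
have e'0 : 0 < e' by rewrite lt_min e0 divr_gt0.
have e'1 : e' <= 1 / 2 by rewrite ge_min lexx orbT.
have e'e : e' <= e by rewrite ge_min lexx.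
have {}hE1 w : E1 w -> e' * nc (p w) <= Re (p w).
  by move=> /hE1; apply: le_trans; rewrite ler_wpM2r ?nc_ge0.
have {}hE2 w : E2 w -> e' * nc (p w) <= - Re (p w).
  by move=> /hE2; apply: le_trans; rewrite ler_wpM2r ?nc_ge0.
have main (p' : C2 -> C) (e2 : R) : polyfun p' -> 0 < e2 <= 1 / 2 ->
    (forall w, E1 w -> e2 * nc (p' w) <= Re (p' w)) ->
    (forall w, E2 w -> e2 * nc (p' w) <= - Re (p' w)) ->
    Re (p' z) != 0 -> E1 z \/ E2 z.
  move=> pp' he2 h1 h2; rewrite neq_lt => /orP[Rn|Rp]; last first.
    by left; apply: (c1 _ r0); apply: (kallin_pos pp' he2 r0 E10 h1 h2 hz Rp).
  right; apply: (c2 _ r0).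
  have pN : polyfun (fun w => - p' w).
    by apply: eq_polyfun (polyfunM (polyfun_cst (-1)) pp') => w; rewrite mulN1r.
  apply: (@kallin_pos E2 E1 _ e2 r z pN he2 r0 E20).
  - by move=> w /h2; rewrite cReN ncN.
  - by move=> w /h1; rewrite cReN ncN opprK.
  - apply/poly_hullP => f M pf hf; move/poly_hullP: hz; apply => // w [Ew dw].
    by apply: hf; split => //; case: Ew; [right|left].
  - by rewrite cReN oppr_gt0.
have [Rz|] := eqVneq (Re (p z)) 0; last by apply: (main p e'); rewrite ?e'0.
have Iz : Im (p z) != 0.
  by apply: contra pz0 => /eqP Iz; apply/eqP/complex_ext.
(* [Re (g p) = Re p - (e' / 2) Im p] loses at most half of [e' |p|], and [|g| <= 2] explains the
   remaining constant [e' / 4]. *)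
pose g : C := (1 +i* (e' / 2))%C.
have g0 : nc g <= 2.
  apply: le_trans (nc_le_ReIm _) _; rewrite /= normr1 ger0_norm; lra.
have low w : nc (g * p w) <= 2 * nc (p w).
  by rewrite ncM ler_wpM2r ?nc_ge0.
have e40 : 0 < e' / 4 by lra.
apply: (main (fun w => g * p w) (e' / 4)).
- by apply: polyfunM => //; exact: polyfun_cst.
- lra.
- move=> w Ew; have := hE1 w Ew; have := Im_le_nc (p w); have := low w.
  move=> h1 h2 h3; have h4 := ler_norm (Im (p w)).
  have h5 := ler_wpM2l (ltW e40) h1.
  have h6 := ler_wpM2l (ltW e'0) (le_trans h4 h2).
  by rewrite cReM /=; lra.
- move=> w Ew; have := hE2 w Ew; have := Im_le_nc (p w); have := low w.
  move=> h1 h2 h3; have h4 := ler_norm (- Im (p w)); rewrite normrN in h4.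
  have h5 := ler_wpM2l (ltW e40) h1.
  have h6 := ler_wpM2l (ltW e'0) (le_trans h4 h2).
  by rewrite cReM /=; lra.
- by rewrite cReM Rz mulr0 sub0r oppr_eq0 mulf_neq0 //= gt_eqF //; lra.
Qed.

(* A quadratic form separating two cones strictly: there is no zero fibre. *)
Lemma kallin_definite E1 E2 (p : C2 -> C) (e : R) :
  polyfun p -> p 0 = 0 -> 0 < e -> E1 0 -> E2 0 -> cone_cvx E1 -> cone_cvx E2 ->
  (forall w, nc (p w) <= sqn w) ->
  (forall w, E1 w -> e * sqn w <= Re (p w)) ->
  (forall w, E2 w -> e * sqn w <= - Re (p w)) ->
  cone_cvx (setU2 E1 E2).
Proof.
move=> pp p0 e0 E10 E20 c1 c2 ps hE1 hE2 r r0 z hz.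
have h1 w : E1 w -> e * nc (p w) <= Re (p w).
  by move=> /hE1; apply: le_trans; rewrite ler_wpM2l ?(ltW e0).
have h2 w : E2 w -> e * nc (p w) <= - Re (p w).
  by move=> /hE2; apply: le_trans; rewrite ler_wpM2l ?(ltW e0).
have [pz|pz] := eqVneq (p z) 0; last exact: kallin_neq0 h1 h2 hz pz.
suff -> : z = 0 by left.
pose e' := Num.min e (1 / 2).
have he' : 0 < e' <= 1 / 2 by rewrite lt_min e0 divr_gt0 //= ge_min lexx orbT.
have sec w : setU2 E1 E2 w -> e' * nc (p w) <= `|Re (p w)|.
  have ee : e' * nc (p w) <= e * nc (p w) by rewrite ler_wpM2r ?nc_ge0 // ge_min lexx.
  move=> [/h1 a|/h2 a]; apply: le_trans ee (le_trans a _); first exact: ler_norm.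
  by rewrite -normrN ler_norm.
(* On the cones [|p w| >= e |w|^2], so the condition [|p w| <= e eta^2] leaves only points of norm
   at most [eta]. *)
have zero (q : C2 -> C) : polyfun q -> (forall w, nc (q w) ^+ 2 <= sqn w) -> nc (q z) <= 0.
  move=> pq hq; apply/ler_addgt0Pl => eta eta0; rewrite addr0.
  have d0 : 0 < e * eta ^+ 2 by rewrite mulr_gt0 // exprn_gt0.
  apply: (kallin_zero pp pq he' r0 d0 _ p0 sec _ hz pz); first by left.
  move=> w Ew _ pw; rewrite nc_le_sq ?(ltW eta0) //.
  apply: le_trans (hq w) _; rewrite -(ler_pM2l e0).
  apply: le_trans pw; apply: le_trans (Re_le_nc _).
  case: Ew => [/hE1|/hE2] a; apply: le_trans a _; first exact: ler_norm.
  by rewrite -normrN ler_norm.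
have vanish (c : C) : nc c <= 0 -> c = 0.
  by move=> h; apply/eqP; rewrite -nc_eq0 eq_le nc_ge0 andbT.
apply: eq2; rewrite mxE; apply: vanish.
  apply: (zero (fun w => w 0 0)); first exact: polyfun_coord0.
  by move=> w; rewrite /sqn lerDl sqr_ge0.
apply: (zero (fun w => w 1 0)); first exact: polyfun_coord1.
by move=> w; rewrite /sqn lerDr sqr_ge0.
Qed.

End Kallin.

(** * Totally real planes as graphs *)

Section Planes.
Variable R : realType.
Local Notation C := R[i].
Local Notation C2 := 'cV[C]_2.
Local Notation nc := (@Normc.normc R).
Implicit Types (E : cset R) (z w : C2) (A : 'M[R]_2).

Lemma R2P z : R2 z <-> Im (z 0 0) = 0 /\ Im (z 1 0) = 0.
Proof.
split=> [[x ->]|[h0 h1]]; first by rewrite !mxE.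
exists (\col_i Re (z i 0)); apply: eq2; rewrite !mxE; exact: complex_ext.
Qed.

Lemma mxC_mulE A (x : 'cV[R]_2) i :
  ((mxC A + 'i%:M) *m vC x) i 0 =
  (A i 0 * x 0 0 + A i 1 * x 1 0)%:C + 'i * (x i 0)%:C.
Proof.
rewrite mulmxDl mxE mul_scalar_mx mulmx2E !mxE rmorphD !rmorphM //.
Qed.

Lemma graph_planeP A z : graph_plane A z <->
  Re (z 0 0) = A 0 0 * Im (z 0 0) + A 0 1 * Im (z 1 0) /\
  Re (z 1 0) = A 1 0 * Im (z 0 0) + A 1 1 * Im (z 1 0).
Proof.
have reE (a b : R) : Re (a%:C + 'i * b%:C) = a by rewrite /= ; ring.
have imE (a b : R) : Im (a%:C + 'i * b%:C) = b by rewrite /= ; ring.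
split=> [[x ->]|[h0 h1]]; first by rewrite !mxC_mulE !reE !imE.
exists (\col_i Im (z i 0)); apply: eq2; rewrite mxC_mulE !mxE.
  by apply: complex_ext; rewrite ?reE ?imE.
by apply: complex_ext; rewrite ?reE ?imE.
Qed.

Lemma R2_0 : @R2 R 0. Proof. by apply/R2P; rewrite !mxE. Qed.

Lemma graph_plane0 A : graph_plane A 0.
Proof. by apply/graph_planeP; rewrite !mxE /= !mulr0 addr0. Qed.

Lemma cone_cvx_R2 : cone_cvx (@R2 R).
Proof.
apply: cone_cvx_linear => z h; apply/R2P; split.
  have := h (- 'i) 0; rewrite mul0r addr0 cReM /= => <-; first ring.
  by move=> w /R2P [h0 _]; rewrite mul0r addr0 cReM /= h0; ring.
have := h 0 (- 'i); rewrite mul0r add0r cReM /= => <-; first ring.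
by move=> w /R2P [_ h0]; rewrite mul0r add0r cReM /= h0; ring.
Qed.

Lemma cone_cvx_graph A : cone_cvx (graph_plane A).
Proof.
have E (a b : R) (u v : C) : Re ((1 +i* a)%C * u + (0 +i* b)%C * v) =
    Re u - a * Im u - b * Im v by rewrite cReD !cReM /=; ring.
have E' (a b : R) (u v : C) : Re ((0 +i* a)%C * u + (1 +i* b)%C * v) =
    Re v - a * Im u - b * Im v by rewrite cReD !cReM /=; ring.
apply: cone_cvx_linear => z h; apply/graph_planeP; split.
  have := h (1 +i* A 0 0)%C (0 +i* A 0 1)%C; rewrite E => h1.
  by have /h1 : forall w, graph_plane A w ->
    Re ((1 +i* A 0 0)%C * w 0 0 + (0 +i* A 0 1)%C * w 1 0) = 0;
   [move=> w /graph_planeP [e _]; rewrite E e; ring|lra].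
have := h (0 +i* A 1 0)%C (1 +i* A 1 1)%C; rewrite E' => h1.
by have /h1 : forall w, graph_plane A w ->
  Re ((0 +i* A 1 0)%C * w 0 0 + (1 +i* A 1 1)%C * w 1 0) = 0;
 [move=> w /graph_planeP [_ e]; rewrite E' e; ring|lra].
Qed.

Lemma mxC_unit (T : 'M[R]_2) : T \in unitmx -> mxC T \in unitmx.
Proof. by rewrite /mxC map_unitmx. Qed.

Lemma mulmx_vC (T : 'M[R]_2) x : mxC T *m vC x = vC (T *m x).
Proof. by rewrite /mxC /vC map_mxM. Qed.

Lemma R2_mulmx (T : 'M[R]_2) z : T \in unitmx -> R2 (mxC T *m z) <-> R2 z.
Proof.
move=> uT; split=> [[x hx]|[x ->]]; last by exists (T *m x); rewrite mulmx_vC.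
exists (invmx T *m x).
by rewrite -mulmx_vC -hx mulmxA /mxC -map_mxM mulVmx // map_mx1 mul1mx.
Qed.

Lemma graph_mulmx (T A : 'M[R]_2) z : T \in unitmx ->
  graph_plane (Defs.conj T A) (mxC T *m z) <-> graph_plane A z.
Proof.
move=> uT; have key x : (mxC (Defs.conj T A) + 'i%:M) *m vC (T *m x) =
    mxC T *m ((mxC A + 'i%:M) *m vC x).
  rewrite -mulmx_vC !mulmxA; congr (_ *m _).
  rewrite mulmxDl mulmxDr scalar_mxC; congr (_ + _).
  by rewrite /mxC -!map_mxM /Defs.conj mulmxKV.
split=> [[x hx]|[x ->]]; last by exists (T *m x); rewrite key.
exists (invmx T *m x).
apply: (can_inj (mulKmx (mxC_unit uT))).
by rewrite -key mulKVmx.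
Qed.

Lemma cone_cvx_R2_graph_conj (T A1 A2 : 'M[R]_2) : T \in unitmx ->
  cone_cvx (setU3 (@R2 R) (graph_plane (Defs.conj T A1)) (graph_plane (Defs.conj T A2))) ->
  cone_cvx (setU3 (@R2 R) (graph_plane A1) (graph_plane A2)).
Proof.
move=> uT /(@cone_cvx_mulmx _ _ (mxC T)); apply: eq_cone_cvx => z.
by rewrite /setU3 R2_mulmx // !graph_mulmx.
Qed.

End Planes.

(** * Two graphs with definite symmetric parts *)

Section Definite.
Variable R : realType.
Local Notation C := R[i].
Local Notation C2 := 'cV[C]_2.
Local Notation nc := (@Normc.normc R).
Implicit Types (E : cset R) (z w : C2) (A : 'M[R]_2).

Definition sumsq z : C := z 0 0 ^+ 2 + z 1 0 ^+ 2.

Lemma sumsq_le z : nc (sumsq z) <= sqn z.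
Proof. by apply: le_trans (ncD _ _) _; rewrite !ncX. Qed.

Lemma polyfun_sumsq : polyfun sumsq.
Proof.
by apply: polyfunD; apply: polyfunX; [exact: polyfun_coord0|exact: polyfun_coord1].
Qed.

Lemma det2 (A : 'M[R]_2) : \det A = A 0 0 * A 1 1 - A 0 1 * A 1 0.
Proof.
rewrite (expand_det_row _ 0) big_ord_recl big_ord1 /cofactor !det_mx11 !mxE /=.
rewrite !expr0 mul1r (_ : lift 0 _ = 1); last exact/val_inj.
rewrite (_ : lift (1 : 'I_2) 0 = 0) /=; last exact/val_inj.
by rewrite expr1 mulN1r mulrN.
Qed.

(** For [z = (A + i) x] the imaginary part of [z0^2 + z1^2] is the quadratic form of [A + A^T] at
    [x]. A positive determinant makes this form definite, and [s] is its sign. *)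
Lemma graph_definite A : 0 < \det (A + A^T) -> exists s k : R,
  [/\ s ^+ 2 = 1, 0 < k & forall z, graph_plane A z -> k * sqn z <= s * Im (sumsq z)].
Proof.
rewrite det2 !mxE; set a := A 0 0; set b := A 0 1; set c := A 1 0; set d := A 1 1.
move=> hdet; pose h := (b + c) / 2.
have {}hdet : h ^+ 2 < a * d by rewrite /h; nra.
(* Cauchy-Schwarz on the rows of [A] gives [|A x|^2 + |x|^2 <= L |x|^2]. *)
pose L := 1 + a ^+ 2 + b ^+ 2 + c ^+ 2 + d ^+ 2.
have L0 : 0 < L by have := sqr_ge0 a; have := sqr_ge0 b; have := sqr_ge0 c;
  have := sqr_ge0 d; rewrite /L; lra.
have pos (a' d' h' : R) : h' ^+ 2 < a' * d' -> 0 < a' -> exists2 k, 0 < k &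
    forall x y : R, k * (x ^+ 2 + y ^+ 2) <= a' * x ^+ 2 + 2 * h' * x * y + d' * y ^+ 2.
  move=> hd a0; have d0 : 0 < d'.
    by rewrite -(pmulr_rgt0 _ a0); apply: le_lt_trans hd; exact: sqr_ge0.
  have s0 : 0 < a' + d' by rewrite addr_gt0.
  (* By Cayley-Hamilton [tr M * M - det M] equals [M^2], which is nonnegative for symmetric [M]; so
     the determinant over the trace bounds the form from below. *)
  pose k := (a' * d' - h' ^+ 2) / (a' + d').
  have ks : k * (a' + d') = a' * d' - h' ^+ 2 by rewrite divfK // gt_eqF.
  exists k; first by rewrite divr_gt0 // subr_gt0.
  move=> x y; rewrite -subr_ge0 -(pmulr_rge0 _ s0).
  have -> : (a' + d') * (a' * x ^+ 2 + 2 * h' * x * y + d' * y ^+ 2 -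
     k * (x ^+ 2 + y ^+ 2)) = (a' * x + h' * y) ^+ 2 + (h' * x + d' * y) ^+ 2.
    have -> : (a' + d') * (a' * x ^+ 2 + 2 * h' * x * y + d' * y ^+ 2 -
     k * (x ^+ 2 + y ^+ 2)) = (a' + d') * (a' * x ^+ 2 + 2 * h' * x * y + d' * y ^+ 2) -
     k * (a' + d') * (x ^+ 2 + y ^+ 2) by ring.
    by rewrite ks; ring.
  by rewrite addr_ge0 ?sqr_ge0.
have sq z : graph_plane A z -> sqn z <= L * (Im (z 0 0) ^+ 2 + Im (z 1 0) ^+ 2) /\
   Im (sumsq z) = 2 * (a * Im (z 0 0) ^+ 2 + 2 * h * Im (z 0 0) * Im (z 1 0) +
      d * Im (z 1 0) ^+ 2).
  move=> /graph_planeP [e0 e1]; rewrite /sqn /sumsq !nc_sq cImD !expr2 !cImM e0 e1.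
  rewrite -/a -/b -/c -/d; set x := Im (z 0 0); set y := Im (z 1 0).
  split; last by rewrite /h; field.
  rewrite -subr_ge0.
  suff -> : L * (x ^+ 2 + y ^+ 2) - ((a * x + b * y) ^+ 2 + x ^+ 2 +
    ((c * x + d * y) ^+ 2 + y ^+ 2)) = (a * y - b * x) ^+ 2 + (c * y - d * x) ^+ 2.
    by rewrite addr_ge0 ?sqr_ge0.
  by rewrite /L; ring.
have [s [s1 sa]] : exists s : R, s ^+ 2 = 1 /\ 0 < s * a.
  have [ap|an|a0] := ltrgtP a 0.
  - by exists (-1); rewrite sqrrN expr1n; split => //; lra.
  - by exists 1; rewrite expr1n; split => //; lra.
  - by move: hdet; rewrite a0 mul0r ltNge sqr_ge0.
have e : (s * h) ^+ 2 < s * a * (s * d).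
  have -> : s * a * (s * d) = s ^+ 2 * (a * d) by ring.
  by rewrite exprMn s1 !mul1r.
have [k k0 hk] := pos _ _ _ e sa.
exists s, (2 * k / L); split => //; first by rewrite divr_gt0 // mulr_gt0.
move=> z /sq [l1 ->].
have {hk} := hk (Im (z 0 0)) (Im (z 1 0)); move: l1.
set N := _ + _ ^+ 2 => l1 l2.
apply: (@le_trans _ _ (2 * k / L * (L * N))).
  by rewrite ler_wpM2l // divr_ge0 ?mulr_ge0 ?(ltW k0) ?(ltW L0).
have -> : 2 * k / L * (L * N) = 2 * (k * N) by field; rewrite gt_eqF.
lra.
Qed.

(** If the two forms have the same sign, the graphs are separated together from [R^2]; otherwise
    [R^2] goes with the first graph. The weight [k / 2] of [Re (sumsq z)] gives the values on [R^2]
    a real part of the right sign and costs at most half of the bound [k] on the graphs. *)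
Lemma cone_cvx_definite A1 A2 :
  0 < \det (A1 + A1^T) -> 0 < \det (A2 + A2^T) ->
  cone_cvx (setU2 (@R2 R) (graph_plane A1)) ->
  cone_cvx (setU2 (graph_plane A1) (graph_plane A2)) ->
  cone_cvx (setU3 (@R2 R) (graph_plane A1) (graph_plane A2)).
Proof.
move=> /graph_definite [s1 [k1 [s1E k10 h1]]] /graph_definite [s2 [k2 [s2E k20 h2]]].
move=> c01 c12.
pose k := Num.min 1 (Num.min k1 k2).
have k0 : 0 < k by rewrite !lt_min ltr01 k10.
have kle : [/\ k <= 1, k <= k1 & k <= k2].
  by rewrite /k; split; rewrite !ge_min lexx ?orbT.
have [kl1 kk1 kk2] := kle.
have {}h1 z : graph_plane A1 z -> k * sqn z <= s1 * Im (sumsq z).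
  by move=> /h1; apply: le_trans; rewrite ler_wpM2r ?sqn_ge0.
have {}h2 z : graph_plane A2 z -> k * sqn z <= s2 * Im (sumsq z).
  by move=> /h2; apply: le_trans; rewrite ler_wpM2r ?sqn_ge0.
have ab (s : R) : s ^+ 2 = 1 -> `|s| = 1.
  by move=> /eqP; rewrite sqrf_eq1 => /orP[] /eqP ->; rewrite ?normrN normr1.
have R2S z : R2 z -> sumsq z = (sqn z)%:C.
  move=> /R2P [i0 i1]; apply: complex_ext; rewrite /sumsq /sqn !nc_sq i0 i1.
    by rewrite cReD !expr2 !cReM i0 i1 /=; ring.
  by rewrite cImD !expr2 !cImM i0 i1 /=; ring.
pose p (x s : R) z : C := (x / 2 -i* (s / 2))%C * sumsq z.
have pp x s : polyfun (p x s) by apply: polyfunM; [exact: polyfun_cst|exact: polyfun_sumsq].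
have p0 x s : p x s 0 = 0 by rewrite /p /sumsq !mxE expr0n /= addr0 mulr0.
have pn x s z : `|x| <= 1 -> `|s| <= 1 -> nc (p x s z) <= sqn z.
  move=> x1 s_1; rewrite /p ncM -[X in _ <= X]mul1r; apply: ler_pM; rewrite ?nc_ge0 ?sumsq_le //.
  apply: le_trans (nc_le_ReIm _) _; rewrite /= normrN !normrM normfV.
  by rewrite (@ger0_norm _ 2) //; lra.
have pRe x s z : Re (p x s z) = (x * Re (sumsq z) + s * Im (sumsq z)) / 2.
  by rewrite /p cReM /=; field.
have bR z : - sqn z <= Re (sumsq z) /\ Re (sumsq z) <= sqn z.
  by have := le_trans (Re_le_nc _) (sumsq_le z); rewrite ler_norml => /andP.
have k2h : `|k / 2| <= 1 by rewrite ger0_norm //; lra.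
have k2h' : `|- (k / 2)| <= 1 by rewrite normrN.
have k4 : 0 < k / 4 by lra.
have [es|ns] := eqVneq s2 s1.
  apply: (@eq_cone_cvx _ (setU2 (setU2 (graph_plane A1) (graph_plane A2)) (@R2 R))).
    by move=> z; rewrite /setU2 /setU3; tauto.
  apply: (@kallin_definite _ _ _ (p (- (k / 2)) s1) (k / 4)) => //.
  - by left; exact: graph_plane0.
  - exact: R2_0.
  - exact: cone_cvx_R2.
  - by move=> z; apply: pn => //; rewrite ab.
  - move=> z [/h1|/h2]; rewrite ?es pRe; have [b1 b2] := bR z.
      by have := ler_wpM2l (ltW k0) b2; lra.
    by have := ler_wpM2l (ltW k0) b2; lra.
  - by move=> z /R2S e; rewrite pRe e /= mulr0; have := mulr_ge0 (ltW k0) (sqn_ge0 z); lra.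
have es : s2 = - s1.
  move: s1E s2E => /eqP; rewrite sqrf_eq1 => /orP[] /eqP e1 /eqP;
  by rewrite sqrf_eq1 => /orP[] /eqP e2; move: ns; rewrite e1 e2 ?opprK ?eqxx.
apply: (@eq_cone_cvx _ (setU2 (setU2 (@R2 R) (graph_plane A1)) (graph_plane A2))).
  by move=> z; rewrite /setU2 /setU3; tauto.
apply: (@kallin_definite _ _ _ (p (k / 2) s1) (k / 4)) => //.
- by left; exact: R2_0.
- exact: graph_plane0.
- exact: cone_cvx_graph.
- by move=> z; apply: pn => //; rewrite ab.
- move=> z [/R2S e|/h1]; rewrite pRe.
    by rewrite e /= mulr0; have := mulr_ge0 (ltW k0) (sqn_ge0 z); lra.
  by have [b1 b2] := bR z; have := ler_wpM2l (ltW k0) b1; lra.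
- move=> z /h2; rewrite es pRe; have [b1 b2] := bR z.
  by have := ler_wpM2l (ltW k0) b2; lra.
Qed.

End Definite.

(** * Triangular triples *)

Section Triangular.
Variable R : realType.
Local Notation C := R[i].
Local Notation C2 := 'cV[C]_2.
Local Notation nc := (@Normc.normc R).
Implicit Types (E F : cset R) (z w : C2) (A : 'M[R]_2).

(** In the applications [u] is a complex linear form that sends each plane into a real line of [C].
    Squaring turns the line into a ray, and [g] chooses a half plane containing it. *)
Definition sep_by (u : C2 -> C) (g : C) (e : R) E :=
  forall w, E w -> e * nc (u w) ^+ 2 <= Re (g * u w ^+ 2).

Lemma sep_byU u g e E F : sep_by u g e E -> sep_by u g e F -> sep_by u g e (setU2 E F).
Proof. by move=> hE hF w [/hE|/hF]. Qed.

Lemma sep_by_le u g e e' E : e' <= e -> sep_by u g e E -> sep_by u g e' E.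
Proof.
by move=> ee hE w /hE; apply: le_trans; rewrite ler_wpM2r ?sqr_ge0.
Qed.

Lemma Re_gsq (g u : C) : Re (g * u ^+ 2) =
  Re g * (Re u ^+ 2 - Im u ^+ 2) - 2 * Im g * (Re u * Im u).
Proof. by case: g => a b; case: u => x y; rewrite expr2 /=; ring. Qed.

Lemma sep_real u E (a b : R) : 0 < a -> (forall w, E w -> Im (u w) = 0) ->
  sep_by u (a +i* b)%C a E.
Proof.
move=> a0 h w /h e; rewrite Re_gsq nc_sq e /=; lra.
Qed.

Lemma sep_line u E (a b l : R) : 0 < a * (l ^+ 2 - 1) - 2 * b * l ->
  (forall w, E w -> Re (u w) = l * Im (u w)) ->
  sep_by u (a +i* b)%C ((a * (l ^+ 2 - 1) - 2 * b * l) / (l ^+ 2 + 1)) E.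
Proof.
move=> a0 h w /h e; rewrite Re_gsq nc_sq e /=.
have l1 : 0 < l ^+ 2 + 1 by rewrite ltr_wpDl ?sqr_ge0.
suff -> : (a * (l ^+ 2 - 1) - 2 * b * l) / (l ^+ 2 + 1) *
  ((l * Im (u w)) ^+ 2 + Im (u w) ^+ 2) =
  a * ((l * Im (u w)) ^+ 2 - Im (u w) ^+ 2) - 2 * b * (l * Im (u w) * Im (u w)) by [].
by field; rewrite gt_eqF.
Qed.

(** Isolates the question of what happens over [u = 0], so that the choice of [g] for two or three
    lines is made independently of it. *)
Definition glues (u : C2 -> C) E := forall F1 F2 (g : C) (e : R),
  F1 0 -> F2 0 -> cone_cvx F1 -> cone_cvx F2 -> 0 < e ->
  sep_by u g e F1 -> sep_by u (- g) e F2 -> set_eq (setU2 F1 F2) E -> cone_cvx E.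

Lemma glues_exists u E F1 F2 (g : C) (e1 e2 : R) : glues u E ->
  F1 0 -> F2 0 -> cone_cvx F1 -> cone_cvx F2 -> 0 < e1 -> 0 < e2 ->
  sep_by u g e1 F1 -> sep_by u (- g) e2 F2 -> set_eq (setU2 F1 F2) E -> cone_cvx E.
Proof.
move=> hE z1 z2 c1 c2 e10 e20 s1 s2; apply: (hE F1 F2 g (Num.min e1 e2)) => //.
- by rewrite lt_min e10.
- by apply: sep_by_le s1; rewrite ge_min lexx.
- by apply: sep_by_le s2; rewrite ge_min lexx orbT.
Qed.

(* Squares of three real lines of C are three rays; some line through the origin
   strictly separates one of these rays from the other two. *)
Lemma three_lines u E0 E1 E2 (l d : R) :
  E0 0 -> E1 0 -> E2 0 ->
  (forall w, E0 w -> Im (u w) = 0) ->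
  (forall w, E1 w -> Re (u w) = l * Im (u w)) ->
  (forall w, E2 w -> Re (u w) = d * Im (u w)) ->
  cone_cvx E0 -> cone_cvx E1 -> cone_cvx E2 ->
  cone_cvx (setU2 E0 E1) -> cone_cvx (setU2 E1 E2) ->
  glues u (setU3 E0 E1 E2) -> cone_cvx (setU3 E0 E1 E2).
Proof.
move=> z0 z1 z2 h0 h1 h2 c0 c1 c2 c01 c12 gl.
have sq1 (x : R) : 0 < x ^+ 2 + 1 by rewrite ltr_wpDl ?sqr_ge0.
(* If [l d >= 0], the real axis is separated from the two other lines: [g = 1 + i (l + d)] gives
   [Re (g (l + i)^2) = - (1 + l^2 + 2 l d)], and the same with [l] and [d] exchanged. *)
have [ld|ld] := lerP 0 (l * d).
  pose g : C := (1 +i* (l + d))%C.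
  have gN : - g = ((- 1) +i* (- (l + d)))%C by [].
  have p1 : 0 < -1 * (l ^+ 2 - 1) - 2 * - (l + d) * l by have := sqr_ge0 l; nra.
  have p2 : 0 < -1 * (d ^+ 2 - 1) - 2 * - (l + d) * d by have := sqr_ge0 d; nra.
  have s0 := @sep_real u E0 1 (l + d) ltr01 h0.
  have s1 := sep_line p1 h1; have s2 := sep_line p2 h2.
  pose e := Num.min ((-1 * (l ^+ 2 - 1) - 2 * - (l + d) * l) / (l ^+ 2 + 1))
    ((-1 * (d ^+ 2 - 1) - 2 * - (l + d) * d) / (d ^+ 2 + 1)).
  apply: (@glues_exists u _ E0 (setU2 E1 E2) g 1 e) => //.
  - by left.
  - by rewrite lt_min !divr_gt0.
  - rewrite gN; apply: sep_byU.
      by apply: sep_by_le s1; rewrite ge_min lexx.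
    by apply: sep_by_le s2; rewrite ge_min lexx orbT.
have l0 : l != 0 by apply/eqP => l0; move: ld; rewrite l0 mul0r ltxx.
(* Now the line of [d] is separated from the two others; this [b] is chosen so that
   [Re (g (l + i)^2) = l^2 - l d > 0]. *)
pose b := - (1 - l * d) / (2 * l).
pose g : C := (1 +i* b)%C.
have gN : - g = ((- 1) +i* (- b))%C by [].
have bl : 2 * b * l = - (1 - l * d) by rewrite /b; field.
have bd : 2 * b * d * l ^+ 2 = - (1 - l * d) * (l * d) by rewrite /b; field.
have p1 : 0 < 1 * (l ^+ 2 - 1) - 2 * b * l by rewrite bl; have := sqr_ge0 l; lra.
have p2 : 0 < -1 * (d ^+ 2 - 1) - 2 * - b * d.
  have ll : 0 < l ^+ 2 by rewrite exprn_even_gt0.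
  rewrite -(pmulr_rgt0 _ ll).
  have -> : l ^+ 2 * (-1 * (d ^+ 2 - 1) - 2 * - b * d) =
    l ^+ 2 - (l * d) ^+ 2 + 2 * b * d * l ^+ 2 by ring.
  by rewrite bd; lra.
have s0 := @sep_real u E0 1 b ltr01 h0.
have s1 := sep_line p1 h1; have s2 := sep_line p2 h2.
pose e := Num.min 1 ((1 * (l ^+ 2 - 1) - 2 * b * l) / (l ^+ 2 + 1)).
apply: (@glues_exists u _ (setU2 E0 E1) E2 g e
   ((-1 * (d ^+ 2 - 1) - 2 * - b * d) / (d ^+ 2 + 1))) => //.
- by left.
- by rewrite lt_min ltr01 divr_gt0.
- by rewrite divr_gt0.
- apply: sep_byU; first by apply: sep_by_le s0; rewrite ge_min lexx.
  by apply: sep_by_le s1; rewrite ge_min lexx orbT.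
- by move=> w; rewrite /setU2 /setU3; tauto.
Qed.

Lemma two_lines0 u E0 E1 (l : R) : E0 0 -> E1 0 ->
  (forall w, E0 w -> Im (u w) = 0) ->
  (forall w, E1 w -> Re (u w) = l * Im (u w)) ->
  cone_cvx E0 -> cone_cvx E1 -> glues u (setU2 E0 E1) -> cone_cvx (setU2 E0 E1).
Proof.
move=> z0 z1 h0 h1 c0 c1 gl; apply: (@eq_cone_cvx _ (setU3 E0 E1 E1)).
  by move=> w; rewrite /setU2 /setU3; tauto.
pose g : C := (1 +i* (l + l))%C.
have gN : - g = ((- 1) +i* (- (l + l)))%C by [].
have p1 : 0 < -1 * (l ^+ 2 - 1) - 2 * - (l + l) * l by have := sqr_ge0 l; nra.
have s0 := @sep_real u E0 1 (l + l) ltr01 h0.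
have s1 := sep_line p1 h1.
apply: (@eq_cone_cvx _ (setU2 E0 E1)).
  by move=> w; rewrite /setU2 /setU3; tauto.
have l1 : 0 < l ^+ 2 + 1 by rewrite ltr_wpDl ?sqr_ge0.
by apply: (glues_exists gl z0 z1 c0 c1 _ _ s0 s1) => //; rewrite divr_gt0.
Qed.

Lemma two_lines u E1 E2 (l d : R) : l != d -> E1 0 -> E2 0 ->
  (forall w, E1 w -> Re (u w) = l * Im (u w)) ->
  (forall w, E2 w -> Re (u w) = d * Im (u w)) ->
  cone_cvx E1 -> cone_cvx E2 -> glues u (setU2 E1 E2) -> cone_cvx (setU2 E1 E2).
Proof.
move=> ld z1 z2 h1 h2 c1 c2 gl.
have l1 : 0 < l ^+ 2 + 1 by rewrite ltr_wpDl ?sqr_ge0.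
have d1 : 0 < d ^+ 2 + 1 by rewrite ltr_wpDl ?sqr_ge0.
(* [a + i b] is the conjugate of the difference of the unit vectors along [(l + i)^2] and
   [(d + i)^2]. *)
pose a := (l ^+ 2 - 1) / (l ^+ 2 + 1) - (d ^+ 2 - 1) / (d ^+ 2 + 1).
pose b := - (2 * l / (l ^+ 2 + 1) - 2 * d / (d ^+ 2 + 1)).
have q0 : 0 < (l - d) ^+ 2 by rewrite exprn_even_gt0 //= subr_eq0.
have p1 : 0 < a * (l ^+ 2 - 1) - 2 * b * l.
  have -> : a * (l ^+ 2 - 1) - 2 * b * l = 2 * (l - d) ^+ 2 / (d ^+ 2 + 1).
    by rewrite /a /b; field; rewrite !gt_eqF.
  by rewrite divr_gt0 // mulr_gt0.
have p2 : 0 < - a * (d ^+ 2 - 1) - 2 * - b * d.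
  have -> : - a * (d ^+ 2 - 1) - 2 * - b * d = 2 * (l - d) ^+ 2 / (l ^+ 2 + 1).
    by rewrite /a /b; field; rewrite !gt_eqF.
  by rewrite divr_gt0 // mulr_gt0.
have s1 := sep_line p1 h1; have s2 := sep_line p2 h2.
by apply: (glues_exists gl z1 z2 c1 c2 _ _ s1 s2) => //; rewrite divr_gt0.
Qed.

Lemma polyfun_gsq u g : polyfun u -> polyfun (fun w => g * u w ^+ 2).
Proof. by move=> pu; apply: polyfunM; [exact: polyfun_cst|exact: polyfunX]. Qed.

Lemma sep_gsq u g e E : 0 < e -> sep_by u g e E -> forall w, E w ->
  e / (nc g + 1) * nc (g * u w ^+ 2) <= Re (g * u w ^+ 2).
Proof.
move=> e0 hE w /hE; apply: le_trans; rewrite ncM ncX.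
have g1 : 0 < nc g + 1 by rewrite ltr_wpDl ?nc_ge0.
have -> : e / (nc g + 1) * (nc g * nc (u w) ^+ 2) =
  nc g / (nc g + 1) * (e * nc (u w) ^+ 2) by field; rewrite gt_eqF.
apply: ler_piMl; first by rewrite mulr_ge0 ?sqr_ge0 // ltW.
by rewrite ler_pdivrMr // mul1r lerDl.
Qed.

(** Combines [kallin_neq0] and [kallin_zero] for [p = g u^2]. In the second alternative the fibre
    [u = 0] remains to be examined, and all that is known there is a bound by the values on [E] near
    it. *)
Lemma kallin_square u E F1 F2 (g : C) (e r : R) z : polyfun u -> u 0 = 0 ->
  F1 0 -> F2 0 -> cone_cvx F1 -> cone_cvx F2 -> 0 < e ->
  sep_by u g e F1 -> sep_by u (- g) e F2 -> set_eq (setU2 F1 F2) E -> 0 <= r ->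
  poly_hull (fun w => E w /\ disk r w) z ->
  E z \/ u z = 0 /\ forall q M d, polyfun q -> 0 < d ->
    (forall w, E w -> disk r w -> nc (u w) <= d -> nc (q w) <= M) -> nc (q z) <= M.
Proof.
move=> pu u0 z1 z2 c1 c2 e0 s1 s2 hE r0 hz.
have g1 : 0 < nc g + 1 by rewrite ltr_wpDl ?nc_ge0.
pose e' := e / (nc g + 1); have e'0 : 0 < e' by rewrite divr_gt0.
have h1 := sep_gsq e0 s1.
have h2 w : F2 w -> e' * nc (g * u w ^+ 2) <= - Re (g * u w ^+ 2).
  by move/(sep_gsq e0 s2); rewrite ncN mulNr ncN cReN.
have pp := polyfun_gsq g pu.
have hz' : poly_hull (fun w => setU2 F1 F2 w /\ disk r w) z.
  apply/poly_hullP => f M pf hf; move/poly_hullP: hz; apply => // w [Ew dw].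
  by apply: hf; split => //; apply/hE.
have [gz|gz] := eqVneq (g * u z ^+ 2) 0; last first.
  by left; apply/hE; exact: (kallin_neq0 pp e'0 r0 z1 z2 c1 c2 h1 h2 hz' gz).
(* With [g = 0] the separation says that [u] vanishes on [E], hence on the hull. *)
have [g0|g0] := eqVneq g 0.
  have uz w : E w -> u w = 0.
    move=> /hE [/s1|/s2]; rewrite g0 ?oppr0 mul0r /= => h.
      apply/eqP; rewrite -nc_eq0 -sqrf_eq0 eq_le sqr_ge0 andbT.
      by rewrite -(pmulr_rle0 _ e0).
    apply/eqP; rewrite -nc_eq0 -sqrf_eq0 eq_le sqr_ge0 andbT.
    by rewrite -(pmulr_rle0 _ e0).
  right; split.
    apply/eqP; rewrite -nc_eq0 eq_le nc_ge0 andbT.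
    by move/poly_hullP: hz; apply => // w [/uz -> _]; rewrite nc0.
  move=> q M d pq d0 hq; move/poly_hullP: hz; apply => // w [Ew dw].
  by apply: hq => //; rewrite uz // nc0 ltW.
right; split.
  by move: gz => /eqP; rewrite mulf_eq0 (negbTE g0) /= sqrf_eq0 => /eqP.
move=> q M d pq d0 hq.
pose e2 := Num.min e' (1 / 2).
have he2 : 0 < e2 <= 1 / 2 by rewrite lt_min e'0 divr_gt0 //= ge_min lexx orbT.
have sec w : setU2 F1 F2 w -> e2 * nc (g * u w ^+ 2) <= `|Re (g * u w ^+ 2)|.
  have ee : e2 * nc (g * u w ^+ 2) <= e' * nc (g * u w ^+ 2).
    by rewrite ler_wpM2r ?nc_ge0 // ge_min lexx.
  move=> [/h1 a|/h2 a]; apply: le_trans ee (le_trans a _); first exact: ler_norm.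
  by rewrite -normrN ler_norm.
have d'0 : 0 < nc g * d ^+ 2 by rewrite mulr_gt0 ?nc_gt0 // exprn_gt0.
have p0 : g * u 0 ^+ 2 = 0 by rewrite u0 expr0n mulr0.
have E0 : setU2 F1 F2 0 by left.
apply: (kallin_zero pp pq he2 r0 d'0 E0 p0 sec _ hz' gz) => w Ew dw.
rewrite ncM ncX ler_pM2l ?nc_gt0 // => ud; apply: hq => //; first exact/hE.
by rewrite nc_le_sq ?(ltW d0).
Qed.

(** The hull stays in the complex line [w1 = 0], which meets the fibre [w0 = 0] only at the
    origin. *)
Lemma glues_on_line E : (forall w, E w -> w 1 0 = 0) -> glues (fun w => w 0 0) E.
Proof.
move=> hE F1 F2 g e z1 z2 c1 c2 e0 s1 s2 hF r r0 z hz.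
have E0 : E 0 by apply/hF; left.
have pu := polyfun_coord0 R.
have u0 : (0 : C2) 0 0 = 0 :> C by rewrite mxE.
have [//|[uz hq]] := kallin_square pu u0 z1 z2 c1 c2 e0 s1 s2 hF r0 hz.
suff -> : z = 0 by [].
apply: eq2; rewrite ?mxE //.
apply/eqP; rewrite -nc_eq0 eq_le nc_ge0 andbT.
move/poly_hullP: hz => /(_ _ 0 (polyfun_coord1 R)); apply.
by move=> w [/hE -> _]; rewrite nc0.
Qed.

(** Points of [E] with small [w1] are close to points of the slice of [E] by [w1 = 0]; the Lipschitz
    bound on polynomials then puts [z] in the hull of the slice. *)
Lemma lip_glues E (K : R) :
  cone_cvx (fun w => E w /\ w 1 0 = 0) ->
  (forall w, E w -> exists2 c : C, E (mk2 c 0) & nc (w 0 0 - c) <= K * nc (w 1 0)) ->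
  glues (fun w => w 1 0) E.
Proof.
move=> cE hE F1 F2 g e z1 z2 c1 c2 e0 s1 s2 hF r r0 z hz.
have pu := polyfun_coord1 R.
have u0 : (0 : C2) 1 0 = 0 :> C by rewrite mxE.
have [//|[uz hq]] := kallin_square pu u0 z1 z2 c1 c2 e0 s1 s2 hF r0 hz.
pose K' := `|K|; have K'0 : 0 <= K' by exact: normr_ge0.
pose r' := (r + K') + (r + K').
have r'0 : 0 <= r' by rewrite !addr_ge0.
suff [] : E z /\ z 1 0 = 0 by [].
apply: (cE r') => //; apply/poly_hullP => f M pf hf.
apply/ler_addgt0Pl => eta eta0.
have [L L0 hL] := polyfun_lip pf r'0.
have LK : 0 < L * (K' + 1) + 1 by rewrite ltr_wpDl // mulr_ge0 // addr_ge0.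
pose d := Num.min 1 (eta / (L * (K' + 1) + 1)).
have d0 : 0 < d by rewrite lt_min ltr01 divr_gt0.
have d1 : d <= 1 by rewrite ge_min lexx.
have d2 : d * (L * (K' + 1) + 1) <= eta.
  by rewrite -ler_pdivlMr // ge_min lexx orbT.
apply: (hq _ _ d) => // w Ew dw wd.
have [c Ec hc] := hE w Ew.
have w0r := coord0_le_sqn r0 dw; have w1r := coord1_le_sqn r0 dw.
have cd : nc (w 0 0 - c) <= K' * d.
  apply: le_trans hc _; apply: le_trans (_ : K' * nc (w 1 0) <= _).
    by rewrite ler_wpM2r ?nc_ge0 // ler_norm.
  by rewrite ler_wpM2l.
have cK : nc (w 0 0 - c) <= K' by apply: le_trans cd _; rewrite ler_piMr.
have dw' : disk r' w.
  by apply: sqn_bound; [apply: le_trans w0r _|apply: le_trans w1r _]; rewrite lerDl.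
have dc : disk r' (mk2 c 0).
  apply: sqn_bound; rewrite ?mk2_0 ?mk2_1 ?nc0 ?addr_ge0 //.
  have -> : c = w 0 0 - (w 0 0 - c) by ring.
  by apply: le_trans (ncB _ _) _; rewrite lerD.
have -> : f w = f (mk2 c 0) + (f w - f (mk2 c 0)) by ring.
apply: le_trans (ncD _ _) _; rewrite addrC; apply: lerD; last first.
  by apply: hf; rewrite mk2_1.
apply: le_trans (hL _ _ dw' dc) _; rewrite mk2_0 mk2_1 subr0.
apply: (@le_trans _ _ (L * (K' * d + d))).
  by rewrite ler_wpM2l // lerD.
apply: le_trans d2; rewrite -subr_ge0.
have -> : d * (L * (K' + 1) + 1) - L * (K' * d + d) = d by ring.
exact: ltW.
Qed.

Definition axis_real : cset R := fun w => Im (w 0 0) = 0 /\ w 1 0 = 0.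
Definition axis_line (l : R) : cset R := fun w => Re (w 0 0) = l * Im (w 0 0) /\ w 1 0 = 0.

Lemma axis_real0 : axis_real 0. Proof. by rewrite /axis_real !mxE. Qed.
Lemma axis_line0 l : axis_line l 0.
Proof. by rewrite /axis_line !mxE /= mulr0. Qed.

Lemma cone_cvx_axis (E : cset R) (a : C) : 
  (forall w, E w <-> Re (a * w 0 0) = 0 /\ w 1 0 = 0) -> cone_cvx E.
Proof.
move=> hE; apply: cone_cvx_linear => z h; apply/hE; split.
  have := h a 0; rewrite mul0r addr0; apply.
  by move=> w /hE[e _]; rewrite mul0r addr0.
apply: complex_ext.
  have := h 0 1; rewrite mul0r add0r mul1r; apply.
  by move=> w /hE[_ ->]; rewrite mul0r add0r mulr0.
have : Re (- 'i * z 1 0) = 0.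
  have := h 0 (- 'i); rewrite mul0r add0r; apply.
  by move=> w /hE[_ ->]; rewrite mul0r add0r mulr0.
rewrite cReM /= => e; lra.
Qed.

Lemma cone_cvx_axis_real : cone_cvx axis_real.
Proof.
apply: (@cone_cvx_axis _ (- 'i)) => w; rewrite /axis_real cReM /=.
have -> : - 0 * Re (w 0 0) - - (1) * Im (w 0 0) = Im (w 0 0) by ring.
by [].
Qed.

Lemma cone_cvx_axis_line l : cone_cvx (axis_line l).
Proof.
apply: (@cone_cvx_axis _ (1 +i* l)%C) => w; rewrite /axis_line cReM /= mul1r.
by split=> -[e ->]; split=> //; lra.
Qed.

(** This is the zero fibre of a triangular triple; within the complex line [w1 = 0] the squares of
    [w0] glue the three real lines. *)
Lemma cone_cvx_axis3 l d : cone_cvx (setU3 axis_real (axis_line l) (axis_line d)).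
Proof.
have c0 := cone_cvx_axis_real; have cl := cone_cvx_axis_line.
have g2 E F : (forall w, E w -> w 1 0 = 0) -> (forall w, F w -> w 1 0 = 0) ->
    glues (fun w => w 0 0) (setU2 E F).
  by move=> hE hF; apply: glues_on_line => w [/hE|/hF].
have v0 w : axis_real w -> w 1 0 = 0 by case.
have vl k w : axis_line k w -> w 1 0 = 0 by case.
apply: (@three_lines (fun w => w 0 0) _ _ _ l d) => //.
- exact: axis_real0.
- exact: axis_line0.
- exact: axis_line0.
- by move=> w [].
- by move=> w [].
- by move=> w [].
- apply: (@two_lines0 (fun w => w 0 0) _ _ l) => //.
  + exact: axis_real0.
  + exact: axis_line0.
  + by move=> w [].
  + by move=> w [].
  + by apply: g2 => // w; exact: vl.
- have [->|ld] := eqVneq l d.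
    by apply: eq_cone_cvx (cl d) => w; rewrite /setU2; tauto.
  apply: (@two_lines (fun w => w 0 0) _ _ l d) => //.
  + exact: axis_line0.
  + exact: axis_line0.
  + by move=> w [].
  + by move=> w [].
  + by apply: g2 => w; exact: vl.
- by apply: glues_on_line => w [/v0|[/vl|/vl]].
Qed.

Lemma cone_cvx_axis2 l : cone_cvx (setU2 axis_real (axis_line l)).
Proof.
apply: eq_cone_cvx (cone_cvx_axis3 (l := l) (d := l)) => w.
by rewrite /setU2 /setU3; tauto.
Qed.

Lemma R2_axis w : R2 w /\ w 1 0 = 0 <-> axis_real w.
Proof. by rewrite R2P /axis_real; split=> [[[a b] c]|[a b]]; rewrite ?b. Qed.

Lemma graph_axis A w : A 1 0 = 0 -> graph_plane A w /\ w 1 0 = 0 <-> axis_line (A 0 0) w.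
Proof.
move=> A0; rewrite graph_planeP /axis_line A0; split=> [[[a b] c]|[a b]].
  by rewrite a c /= mulr0 addr0.
by rewrite a b /= !mulr0 mul0r !addr0.
Qed.

Lemma R2_proj w : R2 w -> exists2 c : C, R2 (mk2 c 0) & nc (w 0 0 - c) <= 0 * nc (w 1 0).
Proof.
move=> /R2P [a b]; exists (w 0 0); last by rewrite subrr nc0 mul0r.
by apply/R2P; rewrite mk2_0 mk2_1.
Qed.

Lemma graph_proj A w : A 1 0 = 0 -> graph_plane A w -> exists2 c : C,
  graph_plane A (mk2 c 0) & nc (w 0 0 - c) <= `|A 0 1| * nc (w 1 0).
Proof.
move=> A0 /graph_planeP [a b]; exists (w 0 0 - (A 0 1 * Im (w 1 0))%:C).
  apply/graph_planeP; rewrite mk2_0 mk2_1 A0 cReD cImD cReN cImN /= a; split; ring.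
rewrite opprB addrC subrK nc_real normrM ler_wpM2l //; exact: Im_le_nc.
Qed.

(** With lower left entries [0] the coordinate [w1] sends the three planes into real lines given by
    the entries [1 1], while the entries [0 0] describe the fibre over [w1 = 0]. *)
Lemma cone_cvx_tri3 A1 A2 : A1 1 0 = 0 -> A2 1 0 = 0 ->
  cone_cvx (setU2 (@R2 R) (graph_plane A1)) ->
  cone_cvx (setU2 (graph_plane A1) (graph_plane A2)) ->
  cone_cvx (setU3 (@R2 R) (graph_plane A1) (graph_plane A2)).
Proof.
move=> t1 t2 c01 c12.
have gE A w : A 1 0 = 0 -> graph_plane A w -> Re (w 1 0) = A 1 1 * Im (w 1 0).
  by move=> t /graph_planeP [_ ->]; rewrite t mul0r add0r.
apply: (@three_lines (fun w => w 1 0) _ _ _ (A1 1 1) (A2 1 1)) => //.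
- exact: R2_0.
- exact: graph_plane0.
- exact: graph_plane0.
- by move=> w /R2P [].
- by move=> w; exact: gE.
- by move=> w; exact: gE.
- exact: cone_cvx_R2.
- exact: cone_cvx_graph.
- exact: cone_cvx_graph.
- apply: (@lip_glues _ (`|A1 0 1| + `|A2 0 1|)).
    apply: eq_cone_cvx (cone_cvx_axis3 (l := A1 0 0) (d := A2 0 0)) => w.
    by rewrite /setU3 -R2_axis -!graph_axis //; tauto.
  move=> w [/R2_proj|[/(graph_proj t1)|/(graph_proj t2)]] [c hc nl];
    exists c; rewrite /setU3; try tauto; apply: le_trans nl _; rewrite ler_wpM2r ?nc_ge0 //.
  + by rewrite addr_ge0.
  + by rewrite lerDl.
  + by rewrite lerDr.
Qed.

Lemma cone_cvx_tri2 A : A 1 0 = 0 -> cone_cvx (setU2 (@R2 R) (graph_plane A)).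
Proof.
move=> t; apply: (@two_lines0 (fun w => w 1 0) _ _ (A 1 1)) => //.
- exact: R2_0.
- exact: graph_plane0.
- by move=> w /R2P [].
- by move=> w /graph_planeP [_ ->]; rewrite t mul0r add0r.
- exact: cone_cvx_R2.
- exact: cone_cvx_graph.
- apply: (@lip_glues _ `|A 0 1|).
    apply: eq_cone_cvx (cone_cvx_axis2 (l := A 0 0)) => w.
    by rewrite /setU2 -R2_axis -graph_axis //; tauto.
  move=> w [/R2_proj|/(graph_proj t)] [c hc nl];
    exists c; rewrite /setU2; try tauto; apply: le_trans nl _.
    by rewrite mul0r mulr_ge0 ?nc_ge0.
Qed.

End Triangular.

(** * Normal forms of pairs of matrices *)

Section NormalForms.
Variable R : realType.
Local Notation C := R[i].
Local Notation nc := (@Normc.normc R).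
Implicit Types (A B T : 'M[R]_2).

Lemma mx2P A B : A 0 0 = B 0 0 -> A 0 1 = B 0 1 -> A 1 0 = B 1 0 -> A 1 1 = B 1 1 -> A = B.
Proof.
have ord2 (i : 'I_2) : i = 0 \/ i = 1.
  by case: i => [[|[|//]] hi]; [left|right]; apply/val_inj.
by move=> h00 h01 h10 h11; apply/matrixP => i j; case: (ord2 i) => ->; case: (ord2 j) => ->.
Qed.

Lemma mulmx22E (F : pzRingType) (A B : 'M[F]_2) i j :
  (A *m B) i j = A i 0 * B 0 j + A i 1 * B 1 j.
Proof.
rewrite mxE big_ord_recl big_ord1; congr (_ + A i _ * B _ _); exact/val_inj.
Qed.

Lemma mx2E (a b c d : R) : (mx2 a b c d 0 0 = a) * (mx2 a b c d 0 1 = b) *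
  (mx2 a b c d 1 0 = c) * (mx2 a b c d 1 1 = d).
Proof. by rewrite !mxE. Qed.

Lemma diag2_mx2 (a b : R) : diag2 a b = mx2 a 0 0 b.
Proof. by apply: mx2P; rewrite !mxE. Qed.

Lemma mx2_eta A : A = mx2 (A 0 0) (A 0 1) (A 1 0) (A 1 1).
Proof. by apply: mx2P; rewrite !mxE. Qed.

Lemma det_mx2 (a b c d : R) : \det (mx2 a b c d) = a * d - b * c.
Proof. by rewrite det2 !mx2E. Qed.

Lemma mx2_unit (a b c d : R) : a * d - b * c != 0 -> mx2 a b c d \in unitmx.
Proof. by rewrite unitmxE det_mx2 unitfE. Qed.

Lemma conjP T A B : T \in unitmx -> T *m A = B *m T -> Defs.conj T A = B.
Proof. by move=> uT e; rewrite /Defs.conj e mulmxK. Qed.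

Lemma conjM T T' A : T \in unitmx -> T' \in unitmx ->
  Defs.conj (T' *m T) A = Defs.conj T' (Defs.conj T A).
Proof.
move=> uT uT'; apply: conjP; first by rewrite unitmx_mul uT'.
by rewrite /Defs.conj !mulmxA !mulmxKV.
Qed.

Lemma conj_comm T A B : T \in unitmx ->
  comm (Defs.conj T A) (Defs.conj T B) = Defs.conj T (comm A B).
Proof.
move=> uT; rewrite /comm /Defs.conj mulmxBr mulmxBl !mulmxA.
by rewrite !mulmxKV.
Qed.

Lemma det_conj T A : T \in unitmx -> \det (Defs.conj T A) = \det A.
Proof.
move=> uT; rewrite /Defs.conj !det_mulmx mulrAC -det_mulmx mulmxV // det1 mul1r //.
Qed.

Lemma spectrumP A z : spectrum A z <->
  (z - (A 0 0)%:C) * (z - (A 1 1)%:C) = (A 0 1 * A 1 0)%:C.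
Proof.
rewrite /spectrum /eigenvalue /= /eigenspace kermx_eq0 row_free_unit unitmxE unitfE negbK.
rewrite (expand_det_row _ 0) big_ord_recl big_ord1 /cofactor !det_mx11 !mxE /=.
rewrite !expr0 mul1r (_ : lift 0 _ = 1); last exact/val_inj.
rewrite (_ : lift (1 : 'I_2) 0 = 0) /=; last exact/val_inj.
rewrite expr1 !mulr0n !subr0 !mulr1n rmorphM.
set a := (A 0 0)%:C; set b := (A 0 1)%:C; set c := (A 1 0)%:C; set d := (A 1 1)%:C.
split=> [/eqP|] h.
  by apply/eqP; rewrite -subr_eq0 -h; apply/eqP; ring.
by apply/eqP; rewrite -[RHS](subrr (b * c)) -{1}h; ring.
Qed.

(** The discriminant [tr^2 - 4 det] of the characteristic polynomial. *)
Definition discr A := (A 0 0 - A 1 1) ^+ 2 + 4 * (A 0 1 * A 1 0).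

Lemma spectrum_discr A (x y : R) : spectrum A (x +i* y)%C <->
  [/\ (2 * x - (A 0 0 + A 1 1)) ^+ 2 - 4 * y ^+ 2 = discr A &
      (2 * x - (A 0 0 + A 1 1)) * y = 0].
Proof.
rewrite spectrumP /discr; set a := A 0 0; set b := A 0 1; set c := A 1 0; set d := A 1 1.
split=> [/eqP|[h1 h2]].
  rewrite eq_complex /= => /andP[/eqP h1 /eqP h2]; split; nra.
by apply/eqP; rewrite eq_complex /=; apply/andP; split; apply/eqP; nra.
Qed.

Lemma spec_real_two_discr A : spec_real_two A -> 0 < discr A.
Proof.
move=> [hr [z1 [z2 [z12 hz]]]].
(* The imaginary part in [spec_real_two] is complex valued; it is replaced by the real
   coordinate. *)
have real z : spectrum A z -> Im z = 0.
  move=> /hr /eqP; rewrite -complexIm => /eqP h.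
  by apply: (@complexI R); rewrite h.
rewrite lt_def; apply/andP; split.
  apply/eqP => D0.
  have one z : spectrum A z -> 2 * Re z = A 0 0 + A 1 1 /\ Im z = 0.
    move=> sz; have i0 := real z sz; split=> //.
    move: sz; case: z i0 => x y /= ->; rewrite spectrum_discr D0 => -[h _].
    move: h; rewrite expr0n /= mulr0 subr0 => /eqP; rewrite sqrf_eq0 subr_eq0.
    by move/eqP.
  have s1 : spectrum A z1 by apply/hz; left.
  have s2 : spectrum A z2 by apply/hz; right.
  have [r1 i1] := one _ s1; have [r2 i2] := one _ s2.
  move/eqP: z12; apply; apply: complex_ext; last by rewrite i1 i2.
  by lra.
rewrite leNgt; apply/negP => D0.
pose y := Num.sqrt (- discr A) / 2.
have y2 : 4 * y ^+ 2 = - discr A.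
  by rewrite /y expr_div_n sqr_sqrtr ?oppr_ge0 ?(ltW D0) //; field.
have s : spectrum A (((A 0 0 + A 1 1) / 2) +i* y)%C.
  have e : 2 * ((A 0 0 + A 1 1) / 2) - (A 0 0 + A 1 1) = 0 by field.
  apply/spectrum_discr; rewrite y2 e; split; last by rewrite mul0r.
  by rewrite expr0n /= sub0r opprK.
have := real _ s => /= y0; move: y2; rewrite y0 expr0n /= mulr0; lra.
Qed.

Lemma spec_nonreal_discr A : spec_nonreal A -> discr A < 0.
Proof.
move=> h; rewrite ltNge; apply/negP => D0.
pose x := (A 0 0 + A 1 1 + Num.sqrt (discr A)) / 2.
have /h : spectrum A (x +i* 0)%C.
  apply/spectrum_discr; split; last by rewrite mulr0.
  rewrite expr0n /= mulr0 subr0 -[RHS](sqr_sqrtr D0); congr (_ ^+ 2).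
  by rewrite /x; field.
by rewrite -complexIm /= eqxx.
Qed.

(** The rows of [T] are left eigenvectors, [(c, l - a)] if [c] is nonzero and [(l - d, b)] if [b]
    is; for [b = c = 0] the matrix is already diagonal. *)
Lemma diagonalize A : 0 < discr A ->
  exists T (l1 l2 : R), [/\ T \in unitmx, l1 != l2 & Defs.conj T A = diag2 l1 l2].
Proof.
move=> D0; rewrite [A]mx2_eta; move: D0; rewrite /discr.
set a := A 0 0; set b := A 0 1; set c := A 1 0; set d := A 1 1 => D0.
pose s := Num.sqrt ((a - d) ^+ 2 + 4 * (b * c)).
have s2 : s ^+ 2 = (a - d) ^+ 2 + 4 * (b * c) by rewrite sqr_sqrtr // ltW.
have s0 : s != 0 by rewrite gt_eqF // sqrtr_gt0.
pose l1 := (a + d + s) / 2; pose l2 := (a + d - s) / 2.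
have l12 : l1 - l2 = s by rewrite /l1 /l2; field.
have e1 : (l1 - a) * (l1 - d) = b * c.
  have -> : (l1 - a) * (l1 - d) = (s ^+ 2 - (a - d) ^+ 2) / 4 by rewrite /l1; field.
  by rewrite s2; field.
have e2 : (l2 - a) * (l2 - d) = b * c.
  have -> : (l2 - a) * (l2 - d) = (s ^+ 2 - (a - d) ^+ 2) / 4 by rewrite /l2; field.
  by rewrite s2; field.
have l1l2 : l1 != l2 by rewrite -subr_eq0 l12.
have [c0|c0] := eqVneq c 0; last first.
  have u : mx2 c (l1 - a) c (l2 - a) \in unitmx.
    apply: mx2_unit; have -> : c * (l2 - a) - (l1 - a) * c = - (c * (l1 - l2)) by ring.
    by rewrite l12 oppr_eq0 mulf_neq0.
  exists (mx2 c (l1 - a) c (l2 - a)), l1, l2; split => //; apply: conjP => //.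
  rewrite diag2_mx2; apply: mx2P; rewrite !mulmx22E !mx2E; nra.
have [b0|b0] := eqVneq b 0; last first.
  have u : mx2 (l1 - d) b (l2 - d) b \in unitmx.
    apply: mx2_unit; have -> : (l1 - d) * b - b * (l2 - d) = b * (l1 - l2) by ring.
    by rewrite l12 mulf_neq0.
  exists (mx2 (l1 - d) b (l2 - d) b), l1, l2; split => //; apply: conjP => //.
  rewrite diag2_mx2; apply: mx2P; rewrite !mulmx22E !mx2E; nra.
exists 1%:M, a, d; split; first exact: unitmx1.
  apply/eqP => ad; move: s0; rewrite -sqrf_eq0 s2 ad b0 subrr expr0n /= mul0r mulr0 addr0.
  by rewrite eqxx.
by apply: conjP; rewrite ?unitmx1 // mul1mx mulmx1 diag2_mx2 b0 c0.
Qed.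

(** The rows of [T] are the real and imaginary parts of the left eigenvector [(c, s + i t - a)]. *)
Lemma rotation_form A : discr A < 0 ->
  exists T (s t : R), [/\ T \in unitmx, t != 0 & Defs.conj T A = mx2 s (- t) t s].
Proof.
move=> D0; rewrite [A]mx2_eta; move: D0; rewrite /discr.
set a := A 0 0; set b := A 0 1; set c := A 1 0; set d := A 1 1 => D0.
have c0 : c != 0.
  by apply/eqP => c0; move: D0; rewrite c0 mulr0 mulr0 addr0 ltNge sqr_ge0.
pose t := Num.sqrt (- ((a - d) ^+ 2 + 4 * (b * c))) / 2.
have t2 : 4 * t ^+ 2 = - ((a - d) ^+ 2 + 4 * (b * c)).
  by rewrite /t expr_div_n sqr_sqrtr ?oppr_ge0 ?(ltW D0) //; field.
have t0 : t != 0.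
  by apply/eqP => t0; move: t2 D0; rewrite t0 expr0n /= mulr0 => t2; lra.
pose s := (a + d) / 2.
have u : mx2 c (s - a) 0 t \in unitmx by apply: mx2_unit; rewrite mulr0 subr0 mulf_neq0.
exists (mx2 c (s - a) 0 t), s, t; split => //; apply: conjP => //.
apply: mx2P; rewrite !mulmx22E !mx2E /s; nra.
Qed.

Lemma star_exists A1 A2 : Omega A1 A2 -> exists T, star T A1.
Proof.
case=> [/spec_nonreal_discr/rotation_form [T [s [t [uT t0 h]]]]|
        /spec_real_two_discr/diagonalize [T [l1 [l2 [uT l12 h]]]]].
  by exists T; split => //; right; exists s, t.
by exists T; split => //; left; exists l1, l2.
Qed.

Lemma det_comm_diag (l1 l2 : R) B : \det (comm (diag2 l1 l2) B) =
  (l1 - l2) ^+ 2 * (B 0 1 * B 1 0).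
Proof.
rewrite /comm det2 diag2_mx2 [B]mx2_eta; do 4! rewrite mxE.
rewrite !mxE !big_ord_recl !big_ord0 !mxE /=; ring.
Qed.

(** A nonzero determinant means that in a basis diagonalizing [A1] both off-diagonal entries of the
    second matrix are nonzero. Conjugation by [diag (x, 1)] with [x^2 = |c / b|] keeps the first
    matrix and equalizes their moduli; their signs decide between the two forms. *)
Lemma form_i_exists A1 A2 : spec_real_two A1 ->
  \det (comm A1 A2) = 0 \/ exists T, star T A1 /\ form_i T A2.
Proof.
move=> /spec_real_two_discr/diagonalize [T [l1 [l2 [uT l12 h]]]].
have [|dn0] := eqVneq (\det (comm A1 A2)) 0; [by left|right].
have : (l1 - l2) ^+ 2 * (Defs.conj T A2 0 1 * Defs.conj T A2 1 0) != 0.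
  by rewrite -det_comm_diag -h conj_comm // det_conj.
rewrite mulf_eq0 negb_or => /andP[_]; rewrite mulf_eq0 negb_or => /andP[].
set B := Defs.conj T A2; set b := B 0 1; set c := B 1 0 => b0 c0.
pose x := Num.sqrt (`|c| / `|b|).
have cb0 : 0 < `|c| / `|b| by rewrite divr_gt0 ?normr_gt0.
have x0 : 0 < x by rewrite sqrtr_gt0.
have xn0 : x != 0 by rewrite gt_eqF.
have x2 : x ^+ 2 * `|b| = `|c|.
  by rewrite sqr_sqrtr ?(ltW cb0) // divfK // normr_eq0.
have uD : mx2 x 0 0 1 \in unitmx by apply: mx2_unit; rewrite mulr1 mulr0 subr0.
have uDT : mx2 x 0 0 1 *m T \in unitmx by rewrite unitmx_mul uD.
have cD (p q r s : R) : Defs.conj (mx2 x 0 0 1) (mx2 p q r s) = mx2 p (x * q) (r / x) s.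
  apply: conjP => //; apply: mx2P; rewrite !mulmx22E !mx2E; by field.
exists (mx2 x 0 0 1 *m T); split.
  split => //; left; exists l1, l2; split => //.
  by rewrite conjM // h diag2_mx2 cD mulr0 mul0r.
exists (B 0 0), (B 1 1), (c / x); rewrite conjM // -/B [B in Defs.conj _ B]mx2_eta cD -/b -/c.
have [bp|bn] := lerP 0 b; have [cp|cn] := lerP 0 c.
- left; congr mx2; move: x2; rewrite !ger0_norm // => <-; by field.
- right; congr mx2; move: x2; rewrite ger0_norm // ltr0_norm // => e.
  have -> : c = - (x ^+ 2 * b) by rewrite e opprK.
  by field.
- right; congr mx2; move: x2; rewrite ltr0_norm // ger0_norm // => <-; by field.
- left; congr mx2; move: x2; rewrite !ltr0_norm // => e.
  have -> : c = x ^+ 2 * b by lra.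
  by field.
Qed.

(** The matrices [mx2 x (- 1) 1 x] commute with the rotation form of [A1]. The quadratic equation
    for [x] says that conjugation by such a matrix makes the off-diagonal part of the second matrix
    antisymmetric. *)
Lemma form_ii_exists A1 A2 : spec_nonreal A1 -> exists T, star T A1 /\ form_ii T A2.
Proof.
move=> /spec_nonreal_discr/rotation_form [T [s [t [uT t0 h]]]].
set B := Defs.conj T A2; pose hh := (B 0 1 + B 1 0) / 2.
have [x hx] : exists x : R, (B 0 0 - B 1 1) * x + hh * (x ^+ 2 - 1) = 0 \/ hh = 0.
  have [->|h0] := eqVneq hh 0; first by exists 0; right.
  pose q := (B 0 0 - B 1 1) ^+ 2 + 4 * hh ^+ 2.
  have q0 : 0 <= q by rewrite /q; have := sqr_ge0 (B 0 0 - B 1 1); have := sqr_ge0 hh; lra.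
  exists ((- (B 0 0 - B 1 1) + Num.sqrt q) / (2 * hh)); left.
  have := sqr_sqrtr q0; rewrite {2}/q; set r := Num.sqrt q; set a := B 0 0 - B 1 1 => e.
  have -> : a * ((- a + r) / (2 * hh)) + hh * (((- a + r) / (2 * hh)) ^+ 2 - 1) =
    (r ^+ 2 - a ^+ 2 - 4 * hh ^+ 2) / (4 * hh) by field.
  by rewrite e; apply/eqP; rewrite mulf_eq0; apply/orP; left; apply/eqP; ring.
case: hx => [hx|hx]; last first.
  exists T; split; first by split => //; right; exists s, t.
  exists (B 0 0), (B 1 1), (B 1 0); rewrite -/B [LHS]mx2_eta; congr mx2.
  by move: hx; rewrite /hh; lra.
have x1 : 0 < x ^+ 2 + 1 by rewrite ltr_wpDl ?sqr_ge0.
have x1' : x ^+ 2 + 1 != 0 by rewrite gt_eqF.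
have uQ : mx2 x (- 1) 1 x \in unitmx.
  by apply: mx2_unit; rewrite mulN1r opprK -expr2.
have uQT : mx2 x (- 1) 1 x *m T \in unitmx by rewrite unitmx_mul uQ.
exists (mx2 x (- 1) 1 x *m T); split.
  split => //; right; exists s, t; split => //.
  rewrite conjM // h; apply: conjP => //; apply: mx2P; rewrite !mulmx22E !mx2E; ring.
pose n := x ^+ 2 + 1.
pose p := (x ^+ 2 * B 0 0 - x * (B 0 1 + B 1 0) + B 1 1) / n.
pose r := (x * B 0 0 + x ^+ 2 * B 1 0 - B 0 1 - x * B 1 1) / n.
pose q := (B 0 0 + x * (B 0 1 + B 1 0) + x ^+ 2 * B 1 1) / n.
have hx' : B 0 1 * x ^+ 2 + x * B 0 0 - x * B 1 1 - B 1 0 =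
   - (x * B 0 0 + x ^+ 2 * B 1 0 - B 0 1 - x * B 1 1) by move: hx; rewrite /hh; lra.
exists p, q, r; rewrite conjM // -/B; apply: conjP => //.
clearbody B.
have -> : - r = (B 0 1 * x ^+ 2 + x * B 0 0 - x * B 1 1 - B 1 0) / n.
  by rewrite hx' mulNr.
apply: mx2P; rewrite !mulmx22E !mx2E /p /q /r /n; by field.
Qed.

End NormalForms.

(** * Sufficiency *)

Section Sufficient.
Variable R : realType.
Local Notation C := R[i].
Local Notation nc := (@Normc.normc R).
Implicit Types (A B T : 'M[R]_2) (E : cset R).

Lemma cone_cvx_unit (G : 'M[C]_2) E : G \in unitmx ->
  cone_cvx (fun z => E (G *m z)) -> cone_cvx E.
Proof.
move=> uG /(@cone_cvx_mulmx _ _ (invmx G)); apply: eq_cone_cvx => z.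
by rewrite mulKVmx.
Qed.

Lemma graph_graph_conj T A B : T \in unitmx ->
  cone_cvx (setU2 (graph_plane A) (graph_plane B)) ->
  cone_cvx (setU2 (graph_plane (Defs.conj T A)) (graph_plane (Defs.conj T B))).
Proof.
move=> uT h; apply: (@cone_cvx_unit (mxC T)); first exact: mxC_unit.
by apply: eq_cone_cvx h => z; rewrite /setU2 !graph_mulmx.
Qed.

Lemma R2_graph_conj T A : T \in unitmx ->
  cone_cvx (setU2 (@R2 R) (graph_plane A)) ->
  cone_cvx (setU2 (@R2 R) (graph_plane (Defs.conj T A))).
Proof.
move=> uT h; apply: (@cone_cvx_unit (mxC T)); first exact: mxC_unit.
by apply: eq_cone_cvx h => z; rewrite /setU2 R2_mulmx // graph_mulmx.
Qed.

Lemma real_cone_R2 : real_cone (@R2 R).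
Proof.
move=> t z /R2P [a b]; apply/R2P; rewrite !mxE !cImM a b /=; split; ring.
Qed.

Lemma real_cone_graph A : real_cone (graph_plane A).
Proof.
move=> t z /graph_planeP [a b]; apply/graph_planeP.
by rewrite !mxE !cReM !cImM a b /=; split; ring.
Qed.

Lemma real_coneU E F : real_cone E -> real_cone F -> real_cone (setU2 E F).
Proof. by move=> hE hF t z [/hE h|/hF h]; [left|right]. Qed.

Lemma real_cone_preim (G : 'M[C]_2) E : real_cone E -> real_cone (fun z => E (G *m z)).
Proof. by move=> h t z Ez; rewrite -scalemxAr; exact: h. Qed.

Lemma mx_image_preim (G : 'M[C]_2) P E : G \in unitmx -> set_eq (mx_image G P) E ->
  set_eq P (fun z => E (G *m z)).
Proof.
move=> uG h z; split=> [Pz|/h [w [Pw e]]]; first by apply/h; exists z.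
by rewrite (can_inj (mulKmx uG) e).
Qed.

Lemma eq_loc_poly_convex E E' : set_eq E E' ->
  loc_poly_convex E 0 -> loc_poly_convex E' 0.
Proof.
move=> h [E0 [r [r0 hr]]]; split; first exact/h.
exists r; split=> // z hz; have [|Ez bz] := hr z; last by split => //; exact/h.
apply/poly_hullP => f M pf hf; move/poly_hullP: hz; apply => // w [Ew bw].
by apply: hf; split => //; apply/h.
Qed.

(** In a basis diagonalizing [A1] the singular commutator makes [A2] upper or lower triangular;
    exchanging the coordinates turns lower into upper. *)
Lemma cone_cvx_comm A1 A2 : spec_real_two A1 -> \det (comm A1 A2) = 0 ->
  cone_cvx (setU2 (@R2 R) (graph_plane A1)) ->
  cone_cvx (setU2 (graph_plane A1) (graph_plane A2)) ->
  cone_cvx (setU3 (@R2 R) (graph_plane A1) (graph_plane A2)).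
Proof.
move=> /spec_real_two_discr/diagonalize [T [l1 [l2 [uT l12 h]]]] d0 c01 c12.
apply: (cone_cvx_R2_graph_conj uT).
have := R2_graph_conj uT c01; have := graph_graph_conj uT c12.
have : (l1 - l2) ^+ 2 * (Defs.conj T A2 0 1 * Defs.conj T A2 1 0) = 0.
  by rewrite -det_comm_diag -h conj_comm // det_conj.
rewrite h; move: (Defs.conj T A2) => B.
move=> /eqP; rewrite mulf_eq0 sqrf_eq0 subr_eq0 (negbTE l12) /= mulf_eq0.
move=> /orP[] /eqP B0 {}c12 {}c01; last first.
  by apply: cone_cvx_tri3 => //; rewrite diag2_mx2 mx2E.
have uW : mx2 (0 : R) 1 1 0 \in unitmx by apply: mx2_unit; rewrite mul0r mul1r sub0r oppr_eq0 oner_neq0.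
have W (a b c d : R) : Defs.conj (mx2 0 1 1 0) (mx2 a b c d) = mx2 d c b a.
  by apply: conjP => //; apply: mx2P; rewrite !mulmx22E !mx2E; ring.
apply: (cone_cvx_R2_graph_conj uW).
have := R2_graph_conj uW c01; have := graph_graph_conj uW c12.
rewrite [B]mx2_eta diag2_mx2 !W B0 => e1 e2.
by apply: cone_cvx_tri3 => //; rewrite mx2E.
Qed.

Lemma cone_cvx_det_cond T A1 A2 : T \in unitmx -> det_cond T A1 A2 ->
  cone_cvx (setU2 (@R2 R) (graph_plane A1)) ->
  cone_cvx (setU2 (graph_plane A1) (graph_plane A2)) ->
  cone_cvx (setU3 (@R2 R) (graph_plane A1) (graph_plane A2)).
Proof.
move=> uT [d1 d2] c01 c12; apply: (cone_cvx_R2_graph_conj uT).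
apply: cone_cvx_definite => //; first exact: R2_graph_conj.
exact: graph_graph_conj.
Qed.

Lemma sufficient_conditions (P0 P1 P2 : cset R) (G : 'M[C]_2) (A1 A2 : 'M[R]_2) :
  G \in unitmx ->
  set_eq (mx_image G P0) (@R2 R) ->
  set_eq (mx_image G P1) (graph_plane A1) ->
  set_eq (mx_image G P2) (graph_plane A2) ->
  loc_poly_convex (setU2 P0 P1) 0 ->
  loc_poly_convex (setU2 P1 P2) 0 ->
  (spec_real_two A1 /\ \det (comm A1 A2) = 0) \/
    (exists T, T \in unitmx /\ det_cond T A1 A2) ->
  loc_poly_convex (setU3 P0 P1 P2) 0.
Proof.
move=> uG h0 h1 h2; have e0 := mx_image_preim uG h0.
have e1 := mx_image_preim uG h1; have e2 := mx_image_preim uG h2.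
have e01 : set_eq (setU2 P0 P1) (fun z => setU2 (@R2 R) (graph_plane A1) (G *m z)).
  by move=> z; rewrite /setU2 e0 e1.
have e12 : set_eq (setU2 P1 P2) (fun z => setU2 (graph_plane A1) (graph_plane A2) (G *m z)).
  by move=> z; rewrite /setU2 e2 e1.
have e012 : set_eq (fun z => setU3 (@R2 R) (graph_plane A1) (graph_plane A2) (G *m z))
    (setU3 P0 P1 P2).
  by move=> z; rewrite /setU3 e0 e2 e1.
move=> l01 l12 hyp.
have c01 := cone_cvx_unit uG (loc_cone_cvx (real_cone_preim
  (real_coneU real_cone_R2 (@real_cone_graph A1))) (eq_loc_poly_convex e01 l01)).
have c12 := cone_cvx_unit uG (loc_cone_cvx (real_cone_preim
  (real_coneU (@real_cone_graph A1) (@real_cone_graph A2))) (eq_loc_poly_convex e12 l12)).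
apply: (eq_loc_poly_convex e012).
apply: cone_cvx_loc; first by rewrite mulmx0; left; exact: R2_0.
apply: cone_cvx_mulmx; case: hyp => [[s d]|[T [uT dc]]].
  exact: cone_cvx_comm.
exact: cone_cvx_det_cond dc c01 c12.
Qed.

End Sufficient.

(** * Derivatives of real functions *)

Section Derivatives.
Variable R : realType.
Implicit Types (f g : R -> R) (x : R).

Definition has_deriv f x (d : R) := is_derive x (1 : R) f d.

Lemma eq_has_deriv f g x d : f =1 g -> has_deriv f x d -> has_deriv g x d.
Proof. by move=> /funext ->. Qed.

Lemma has_deriv_eq f x d d' : d = d' -> has_deriv f x d -> has_deriv f x d'.
Proof. by move=> ->. Qed.

Lemma has_deriv_cst (c x : R) : has_deriv (fun _ => c) x 0.
Proof. exact: is_derive_cst. Qed.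

Lemma has_deriv_id x : has_deriv id x 1.
Proof. exact: is_derive_id. Qed.

Lemma has_derivD f g x d e : has_deriv f x d -> has_deriv g x e ->
  has_deriv (fun y => f y + g y) x (d + e).
Proof. by move=> hf hg; exact: (@is_deriveD _ _ _ f g x 1 d e). Qed.

Lemma has_derivM f g x d e : has_deriv f x d -> has_deriv g x e ->
  has_deriv (fun y => f y * g y) x (f x * e + g x * d).
Proof. by move=> hf hg; exact: (@is_deriveM _ _ f g x 1 d e). Qed.

Lemma has_derivZ (c : R) f x d : has_deriv f x d -> has_deriv (fun y => c * f y) x (c * d).
Proof.
move=> hf; apply: has_deriv_eq (has_derivM (has_deriv_cst c x) hf).
by rewrite mulr0 addr0.
Qed.

Lemma has_deriv_comp f g x d e : has_deriv g x e -> has_deriv f (g x) d ->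
  has_deriv (fun y => f (g y)) x (d * e).
Proof. by move=> hg hf; exact: (@is_derive1_comp _ f g x d e hf hg). Qed.

Lemma has_deriv_affine (a b x : R) : has_deriv (fun y => a * y + b) x a.
Proof.
apply: has_deriv_eq (has_derivD (has_derivZ a (has_deriv_id x)) (has_deriv_cst b x)).
by rewrite mulr1 addr0.
Qed.

Lemma has_deriv_sin_affine (a b x : R) :
  has_deriv (fun y => sin (a * y + b)) x (a * cos (a * x + b)).
Proof.
have h := has_deriv_comp (has_deriv_affine a b x) (is_derive_sin (a * x + b)).
by apply: has_deriv_eq h; rewrite mulrC.
Qed.

Lemma has_deriv_cos_affine (a b x : R) :
  has_deriv (fun y => cos (a * y + b)) x (- (a * sin (a * x + b))).
Proof.
have h := has_deriv_comp (has_deriv_affine a b x) (is_derive_cos (a * x + b)).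
by apply: has_deriv_eq h; rewrite mulrC mulrN.
Qed.

Lemma has_deriv_expR f x d : has_deriv f x d ->
  has_deriv (fun y => expR (f y)) x (expR (f x) * d).
Proof. by move=> hf; exact: has_deriv_comp hf (is_derive_expR (f x)). Qed.

Lemma has_deriv_ln f x d : 0 < f x -> has_deriv f x d ->
  has_deriv (fun y => ln (f y)) x (d / f x).
Proof.
move=> f0 hf; apply: has_deriv_eq (has_deriv_comp hf (is_derive1_ln f0)).
by rewrite mulrC.
Qed.

Lemma has_deriv_sum n (F : nat -> R -> R) (dF : nat -> R) x :
  (forall i, has_deriv (F i) x (dF i)) ->
  has_deriv (fun y => \sum_(i < n) F i y) x (\sum_(i < n) dF i).
Proof.
move=> h; elim: n => [|n IH].
  rewrite big_ord0; apply: eq_has_deriv (has_deriv_cst 0 x).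
  by move=> y; rewrite big_ord0.
rewrite big_ord_recr /=; apply: eq_has_deriv (has_derivD IH (h n)) => y.
by rewrite big_ord_recr.
Qed.

Lemma has_deriv_continuous f x d : has_deriv f x d -> {for x, continuous f}.
Proof.
by move=> hf; apply: differentiable_continuous; apply/derivable1_diffP; case: hf.
Qed.

Lemma mean_value f (df : R -> R) (a b : R) : a < b ->
  (forall x, a <= x <= b -> has_deriv f x (df x)) ->
  exists2 c, a < c < b & f b - f a = df c * (b - a).
Proof.
move=> ab h; have [||c] := @MVT R f df a b ab.
- move=> x; rewrite in_itv /= => /andP[ax xb]; apply: h; lra.
- apply: continuous_in_subspaceT => x; rewrite inE /= in_itv /= => hx.
  exact: has_deriv_continuous (h x hx).
- by rewrite in_itv /= => hc e; exists c.
Qed.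

Lemma mean_value_bound f (df : R -> R) (a b K : R) : a <= b ->
  (forall x, a <= x <= b -> has_deriv f x (df x)) ->
  (forall x, a <= x <= b -> `|df x| <= K) -> `|f b - f a| <= K * (b - a).
Proof.
move=> ab h hK; move: ab; rewrite le_eqVlt => /orP[/eqP <-|ab].
  by rewrite !subrr normr0 mulr0.
have [c /andP[ac cb] ->] := mean_value ab h.
rewrite normrM (ger0_norm (_ : 0 <= b - a)) ?subr_ge0 ?(ltW ab) //.
by rewrite ler_wpM2r ?subr_ge0 ?(ltW ab) // hK // !ltW.
Qed.

(* Fermat's criterion together with the sign of [f'] to the right of [x]. *)
Lemma second_deriv_at_max f (df : R -> R) (x e d2 : R) : 0 < e ->
  (forall y, x - e <= y <= x + e -> has_deriv f y (df y)) ->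
  has_deriv df x d2 ->
  (forall y, x - e <= y <= x + e -> f y <= f x) -> d2 <= 0.
Proof.
move=> e0 hf hdf hmax; rewrite leNgt; apply/negP => d20.
have xin : x \in `](x - e), (x + e)[%R by rewrite in_itv /=; lra.
have df0 : df x = 0.
  have h0 : is_derive x (1 : R) f 0.
    apply: (@derive1_at_max _ f (x - e) (x + e)) => //; first lra.
      move=> t; rewrite in_itv /= => ht.
      have ht' : x - e <= t <= x + e by lra.
      by case: (hf t ht').
    by move=> t; rewrite in_itv /= => ht; apply: hmax; lra.
  have hx : x - e <= x <= x + e by lra.
  have h1 := hf x hx; rewrite /has_deriv in h1.
  by rewrite -(@derive_val _ _ _ _ _ _ _ h1) (@derive_val _ _ _ _ _ _ _ h0).
have [r r0 hr] : exists2 r, 0 < r & forall h, 0 < h -> h <= r -> 0 < df (x + h).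
  have : (h^-1 *: ((df \o shift x) (h *: (1 : R)) - df x) @[h --> 0^'] --> d2)%classic.
    by case: hdf => hder <-; exact: hder.
  move=> /cvgrPdist_lt /(_ _ d20) [r /= r0 hr].
  exists (r / 2); first by rewrite divr_gt0.
  move=> h h0 hr2; have := hr h; rewrite /= sub0r normrN gtr0_norm //.
  have hlt : h < r by lra.
  move=> /(_ hlt); rewrite gt_eqF // => /(_ isT).
  rewrite /shift /= df0 subr0 [h *: 1]mulr1 /GRing.scale /= => hh.
  have : 0 < h^-1 * df (h + x).
    have := ler_norm (d2 - h^-1 * df (h + x)); lra.
  by rewrite pmulr_rgt0 ?invr_gt0 // addrC.
pose h := Num.min r e.
have h0 : 0 < h by rewrite lt_min r0.
have hr' : h <= r by rewrite ge_min lexx.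
have he : h <= e by rewrite ge_min lexx orbT.
have xh : x < x + h by lra.
have [y hy|c /andP[c1 c2]] := @mean_value f df _ _ xh; first by apply: hf; lra.
have xhe : x - e <= x + h <= x + e by lra.
have := hmax _ xhe.
have cx : 0 < df c.
  have -> : c = x + (c - x) by ring.
  apply: hr; lra.
move=> a b; have : 0 < df c * (x + h - x) by apply: mulr_gt0 => //; lra.
lra.
Qed.

End Derivatives.

(** * Partial sums of the binomial series *)

Section BinomialSeries.
Variable R : realType.
Implicit Types (l x : R) (n : nat).

(* Coefficients of the binomial series [(1 - z) ^ l]. *)
Fixpoint bet l n : R := if n is m.+1 then bet l m * ((m%:R - l) / m.+1%:R) else 1.

Lemma betS l n : n.+1%:R * bet l n.+1 = (n%:R - l) * bet l n.
Proof.
have n0 : n.+1%:R != 0 :> R by rewrite pnatr_eq0.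
by rewrite /= mulrCA [n.+1%:R * _]mulrC divfK // mulrC.
Qed.

Lemma bet_pred l n : n.+1%:R * bet l n.+1 = - l * bet (l - 1) n.
Proof.
elim: n => [|n IH]; first by rewrite betS /= !mulr1 sub0r.
have n0 : n.+1%:R != 0 :> R by rewrite pnatr_eq0.
rewrite betS; apply: (mulfI n0); rewrite mulrCA IH.
have := betS (l - 1) n => e.
rewrite mulrCA [RHS]mulrCA e -natr1; ring.
Qed.

Lemma bet_sum l n : \sum_(j < n.+1) bet l j = bet (l - 1) n.
Proof.
elim: n => [|n IH]; first by rewrite big_ord_recl big_ord0 /= addr0.
rewrite big_ord_recr /= -/(bet l n.+1) IH.
have n0 : n.+1%:R != 0 :> R by rewrite pnatr_eq0.
apply: (mulfI n0); rewrite mulrDr bet_pred.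
rewrite -[bet (l - 1) n * _]/(bet (l - 1) n.+1) betS -natr1; ring.
Qed.

Section Negative.
Variable l : R.
Hypothesis hl : -1 < l < 0.

Lemma bet_gt0 n : 0 < bet l n.
Proof.
have /andP[l1 l0] := hl; elim: n => //= n IH; rewrite mulr_gt0 // divr_gt0 //.
by rewrite subr_gt0 (lt_le_trans l0).
Qed.

Lemma betS_le n : bet l n.+1 <= bet l n.
Proof.
have /andP[l1 l0] := hl; rewrite /= ler_piMr ?(ltW (bet_gt0 n)) //.
by rewrite ler_pdivrMr // mul1r -natr1; lra.
Qed.

Lemma bet_le m n : (m <= n)%N -> bet l n <= bet l m.
Proof.
move=> /subnK <-; elim: (n - m)%N => //= k IH.
by apply: le_trans IH; exact: betS_le.
Qed.

Lemma bet_le1 n : bet l n <= 1. Proof. exact: (bet_le (leq0n n)). Qed.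

(** Consecutive coefficients have ratio [1 - (1 + l) / j]; over a doubling of the index these ratios
    gain a fixed factor. Iterated doublings give the limit [0] without asymptotics of the
    coefficients. *)
Lemma bet_double n : bet l (n.+1 + n.+1) <= (1 + (1 + l) / 2)^-1 * bet l n.+1.
Proof.
have /andP[l1 l0] := hl; have l10 : 0 < 1 + l by lra.
pose x := (1 + l) / (2 * n.+1%:R).
have nn0 : 0 < n.+1%:R :> R by rewrite ltr0n.
have x0 : 0 < x by rewrite divr_gt0 // mulr_gt0.
have key m : (m <= n.+1)%N -> bet l (m + n.+1) * (1 + m%:R * x) <= bet l n.+1.
  elim: m => [|m IH] hm; first by rewrite mul0r addr0 mulr1.
  apply: le_trans (IH (ltnW hm)); rewrite addSn /= -mulrA ler_wpM2l ?(ltW (bet_gt0 _)) //.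
  set j := (m + n.+1).+1%:R; have j0 : 0 < j by rewrite ltr0n.
  have jn : j <= 2 * n.+1%:R.
    by rewrite -natrM ler_nat mul2n -addnn -addSn leq_add2r.
  rewrite [_ / j * _]mulrAC ler_pdivrMr //.
  have -> : (m + n.+1)%:R - l = j - (1 + l) by rewrite /j -natr1; ring.
  have xj : x * j <= 1 + l.
    apply: le_trans (_ : x * (2 * n.+1%:R) <= _); first by rewrite ler_wpM2l // ltW.
    by rewrite /x divfK // gt_eqF // mulr_gt0.
  rewrite -natr1; have mx : 0 <= m%:R * x by rewrite mulr_ge0 // ltW.
  have := mulr_ge0 (ltW l10) mx; have := mulr_ge0 (ltW l10) (ltW x0); nra.
have := key n.+1 (leqnn _).
have e (N : R) : N != 0 -> N * ((1 + l) / (2 * N)) = (1 + l) / 2 by move=> N0; field.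
rewrite /x e ?gt_eqF //.
have q0 : 0 < 1 + (1 + l) / 2 by lra.
by rewrite -ler_pdivlMr // mulrC.
Qed.

Lemma bet_cvg0 e : 0 < e -> exists N, forall n, (N <= n)%N -> bet l n <= e.
Proof.
have /andP[l1 l0] := hl; move=> e0; pose q := (1 + (1 + l) / 2)^-1.
have q0 : 0 < 1 + (1 + l) / 2 by lra.
have hq : 0 <= q < 1 by rewrite /q invr_ge0 (ltW q0) /= invf_lt1 //; lra.
have [k hk] := expr_small hq e0.
exists (2 ^ k)%N => n hn; apply: le_trans (bet_le hn) _.
apply: le_trans hk; elim: k {n hn} => [|k IH]; first by rewrite expr0; exact: bet_le1.
rewrite expnS mul2n -addnn exprS.
have [m hm] : exists m, (2 ^ k = m.+1)%N by exists (2 ^ k).-1; rewrite prednK // expn_gt0.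
rewrite hm in IH *; apply: le_trans (bet_double m) _.
by rewrite ler_wpM2l //; case/andP: hq.
Qed.

End Negative.

Section Positive.
Variable l : R.
Hypothesis hl : 0 < l < 1.

Lemma hlm1 : -1 < l - 1 < 0. Proof. by move/andP: hl => [a b]; apply/andP; split; lra. Qed.

Lemma betS_le0 n : bet l n.+1 <= 0.
Proof.
have /andP[l0 l1] := hl; have n0 : 0 < n.+1%:R :> R by rewrite ltr0n.
rewrite -(pmulr_rle0 _ n0) bet_pred mulNr oppr_le0 mulr_ge0 ?(ltW l0) //.
exact/ltW/bet_gt0/hlm1.
Qed.

Lemma bet_diff n : bet l n.+1 = bet (l - 1) n.+1 - bet (l - 1) n.
Proof. by rewrite -!bet_sum [in RHS]big_ord_recr /= addrAC subrr add0r. Qed.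

(** All coefficients but the first are nonpositive, so the sum of the moduli is [2] minus the plain
    sum, which [bet_sum] evaluates. *)
Lemma norm_bet_sum n : \sum_(j < n.+1) `|bet l j| = 2 - bet (l - 1) n.
Proof.
elim: n => [|n IH]; first by rewrite big_ord_recl big_ord0 /= normr1 addr0; ring.
rewrite big_ord_recr /= -/(bet l n.+1) IH ler0_norm ?betS_le0 // bet_diff.
by rewrite -[bet (l - 1) n * _]/(bet (l - 1) n.+1); ring.
Qed.

Lemma norm_bet_sum_le n : \sum_(j < n) `|bet l j| <= 2.
Proof.
case: n => [|n]; first by rewrite big_ord0.
by rewrite norm_bet_sum; have := bet_gt0 hlm1 n; lra.
Qed.

(** The phase [l (pi - x) / 2] cancels the argument of [(1 - e^(i x))^l]: the product is the real
    number [(2 sin (x / 2))^l]. Hence the sine sums [sinser] tend to [0]. *)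
Definition ang l n x := (n%:R - l / 2) * x + l * pi / 2.
Definition sinser n x := \sum_(j < n.+1) bet l j * sin (ang l j x).
Definition cosser n x := \sum_(j < n.+1) bet l j * cos (ang l j x).
Definition dsinser n x := \sum_(j < n.+1) bet l j * ((j%:R - l / 2) * cos (ang l j x)).

Lemma sinser_deriv n x : has_deriv (sinser n) x (dsinser n x).
Proof.
apply: (@has_deriv_sum _ n.+1 (fun j x => bet l j * sin (ang l j x))
  (fun j => bet l j * ((j%:R - l / 2) * cos (ang l j x)))) => j.
by apply: has_derivZ; exact: has_deriv_sin_affine.
Qed.

(* Telescoping form of [(1 - z) f' = - l f] for the partial sums of the series. *)
Lemma sinser_id n x : 2 * sin (x / 2) * dsinser n x =
  l * cos (x / 2) * sinser n x + (n%:R - l) * bet l n * sin (ang l n x + x / 2).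
Proof.
elim: n => [|n IH].
  by rewrite /dsinser /sinser !big_ord_recl !big_ord0 /=; move: (ang l 0 x) => a; rewrite sinD; field.
rewrite /dsinser /sinser big_ord_recr [in RHS]big_ord_recr.
rewrite -/(dsinser n x) -/(sinser n x) !mulrDr IH.
have -> : ang l n x + x / 2 = ang l n.+1 x - x / 2 by rewrite /ang -natr1; field.
by rewrite -betS; move: (ang l n.+1 x) (bet l n.+1) => a b; rewrite sinB sinD /=; field.
Qed.

Lemma sin_natpi n : sin (n%:R * pi) = 0 :> R.
Proof.
elim: n => [|n IH]; first by rewrite mul0r sin0.
by rewrite -natr1 mulrDl mul1r sinDpi IH oppr0.
Qed.

Lemma sinser_pi n : sinser n pi = 0.
Proof.
rewrite /sinser big1 // => j _.
have -> : ang l j pi = (j : nat)%:R * pi by rewrite /ang; field.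
by rewrite sin_natpi mulr0.
Qed.

Lemma sin_nat2pi n x : sin (n%:R * (pi *+ 2) - x) = - sin x.
Proof.
elim: n => [|n IH]; first by rewrite mul0r sub0r sinN.
by rewrite -natr1 mulrDl mul1r addrAC sinD2pi.
Qed.

Lemma sinser_refl n x : sinser n (pi *+ 2 - x) = - sinser n x.
Proof.
rewrite /sinser -sumrN; apply: eq_bigr => j _.
have -> : ang l j (pi *+ 2 - x) = (j : nat)%:R * (pi *+ 2) - ang l j x.
  by rewrite /ang; field.
by rewrite sin_nat2pi mulrN.
Qed.

Lemma err_le n : `|(n%:R - l) * bet l n| <= bet (l - 1) n.
Proof.
have /andP[l0 l1] := hl; rewrite -betS bet_pred mulNr normrN.
have b0 := bet_gt0 hlm1 n.
by rewrite ger0_norm ?mulr_ge0 ?(ltW l0) ?(ltW b0) // ler_piMl ?(ltW b0) ?(ltW l1).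
Qed.

(** The weight [w = sin (y / 2)^-l] is an integrating factor for [sinser_id]: the derivative of
    [sinser * w] contains only the remainder term, and the product vanishes at [pi]. *)
Lemma sinser_bound_half n x (s : R) : 0 < x <= pi -> 0 < s -> s <= sin (x / 2) ->
  `|sinser n x| <= pi * bet (l - 1) n / s ^+ 2.
Proof.
have /andP[l0 l1] := hl; move=> /andP[x0 xpi] s0 hs.
have b0 := bet_gt0 hlm1 n.
have pi0 := pi_gt0 R.
have sy y : x <= y <= pi -> s <= sin (y / 2).
  move=> /andP[xy yp]; apply: le_trans hs _.
  by rewrite leNgt ltr_sin ?in_itv /= -?leNgt; lra.
pose w y := expR (- l * ln (sin (1 / 2 * y + 0))).
have half (y : R) : 1 / 2 * y + 0 = y / 2 by field.
pose Q y := sinser n y * w y.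
pose dQ y := (n%:R - l) * bet l n * sin (ang l n y + y / 2) / (2 * sin (y / 2)) * w y.
have hQ y : x <= y <= pi -> has_deriv Q y (dQ y).
  move=> hy; have sp : 0 < sin (y / 2) by apply: lt_le_trans (sy y hy).
  have sp' : 0 < sin (1 / 2 * y + 0) by rewrite half.
  have h1 := has_derivM (sinser_deriv n y) (has_deriv_expR
    (has_derivZ (- l) (has_deriv_ln sp' (has_deriv_sin_affine (1 / 2) 0 y)))).
  apply: has_deriv_eq h1; rewrite /dQ /w half.
  have -> : (n%:R - l) * bet l n * sin (ang l n y + y / 2) =
    2 * sin (y / 2) * dsinser n y - l * cos (y / 2) * sinser n y.
    by rewrite sinser_id; ring.
  by field; rewrite gt_eqF.
have wb y : x <= y <= pi -> w y <= s^-1.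
  move=> hy; have h := sy y hy; have sp : 0 < sin (y / 2) by apply: lt_le_trans h.
  rewrite -[s^-1]lnK ?posrE ?invr_gt0 // ler_expR half lnV ?posrE //.
  have : ln s <= ln (sin (y / 2)) by rewrite ler_ln ?posrE.
  have : ln (sin (y / 2)) <= 0 by apply: ln_le0; exact: sin_le1.
  nra.
pose K := bet (l - 1) n / (2 * s ^+ 2).
have dQb y : x <= y <= pi -> `|dQ y| <= K.
  move=> hy; have h := sy y hy; have sp : 0 < sin (y / 2) by apply: lt_le_trans h.
  rewrite /dQ !normrM normfV [`|w y|]ger0_norm ?expR_ge0 //.
  rewrite (@gtr0_norm _ (2 * sin (y / 2))); last by rewrite mulr_gt0.
  rewrite -normrM.
  apply: (@le_trans _ _ (bet (l - 1) n * 1 * (2 * s)^-1 * s^-1)).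
    apply: ler_pM; rewrite ?mulr_ge0 ?normr_ge0 ?invr_ge0 ?mulr_ge0 ?expR_ge0 ?(ltW sp) ?wb //.
    apply: ler_pM; rewrite ?mulr_ge0 ?normr_ge0 ?invr_ge0 ?mulr_ge0 ?(ltW sp) //.
      by apply: ler_pM; rewrite ?normr_ge0 ?err_le ?sin_max.
    by rewrite lef_pV2 ?posrE ?mulr_gt0 // ler_pM2l.
  by rewrite /K mulr1 -mulrA -invfM -mulrA expr2.
have := mean_value_bound xpi hQ dQb.
rewrite {1}/Q sinser_pi mul0r sub0r normrN => hQx.
have xin : x <= x <= pi by rewrite lexx.
have sp : 0 < sin (x / 2) by apply: lt_le_trans hs.
have w1 : 1 <= w x.
  rewrite -(@expR0 R) ler_expR half mulNr oppr_ge0 mulr_ge0_le0 ?(ltW l0) //.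
  by apply: ln_le0; exact: sin_le1.
have hY : `|sinser n x| <= `|Q x|.
  rewrite /Q normrM [`|w x|]ger0_norm ?expR_ge0 //.
  by rewrite ler_peMr.
apply: le_trans hY (le_trans hQx _).
have K0 : 0 <= K by rewrite divr_ge0 ?(ltW b0) // mulr_ge0 ?sqr_ge0.
apply: (@le_trans _ _ (K * pi)); first by rewrite ler_wpM2l //; lra.
have -> : pi * bet (l - 1) n / s ^+ 2 = 2 * (K * pi).
  by rewrite /K; field; rewrite gt_eqF.
by have := mulr_ge0 K0 (ltW pi0); lra.
Qed.

Lemma sinser_bound n x (s : R) : 0 < x < pi *+ 2 -> 0 < s -> s <= sin (x / 2) ->
  `|sinser n x| <= pi * bet (l - 1) n / s ^+ 2.
Proof.
move=> /andP[x0 x2] s0 hs; have [xp|xp] := lerP x pi.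
  by apply: sinser_bound_half; rewrite ?x0.
rewrite -normrN -sinser_refl; apply: sinser_bound_half => //.
  by rewrite mulr2n in x2 *; apply/andP; split; lra.
have -> : (pi *+ 2 - x) / 2 = pi - x / 2 by rewrite mulr2n; field.
by rewrite sinB sinpi cospi mul0r mulN1r sub0r opprK.
Qed.

Lemma sinser_tail m n x : (m <= n)%N ->
  `|sinser n x - sinser m x| <= bet (l - 1) m.
Proof.
move=> /subnK <-; move: (n - m)%N => k.
suff h : `|sinser (k + m) x - sinser m x| <= bet (l - 1) m - bet (l - 1) (k + m).
  by apply: le_trans h _; rewrite lerBlDr lerDl; exact/ltW/bet_gt0/hlm1.
elim: k => [|k IH]; first by rewrite !subrr normr0.
have -> : sinser (k.+1 + m) x - sinser m x =
    (sinser (k + m) x - sinser m x) + bet l (k + m).+1 * sin (ang l (k + m).+1 x).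
  rewrite addSn /sinser [in LHS]big_ord_recr /= -[bet l _ * (_ / _)]/(bet l (k + m).+1); ring.
apply: le_trans (ler_normD _ _) _.
have : `|bet l (k + m).+1 * sin (ang l (k + m).+1 x)| <=
    bet (l - 1) (k + m) - bet (l - 1) (k + m).+1.
  rewrite normrM; apply: le_trans (_ : `|bet l (k + m).+1| <= _).
    by rewrite ler_piMr // sin_max.
  by rewrite ler0_norm ?betS_le0 // bet_diff; lra.
rewrite addSn; lra.
Qed.

End Positive.
End BinomialSeries.

(** * Equality of two boundary values *)

Section SquareSums.
Variable R : realType.
Implicit Types (f g u : nat -> nat -> R).

Definition sqsum N f := \sum_(n < N) \sum_(k < N) f n k.

Lemma eq_sqsum N f g : (forall n k, f n k = g n k) -> sqsum N f = sqsum N g.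
Proof. by move=> h; apply: eq_bigr => n _; apply: eq_bigr => k _; exact: h. Qed.

Lemma sqsumD N f g : sqsum N (fun n k => f n k + g n k) = sqsum N f + sqsum N g.
Proof. by rewrite /sqsum -big_split; apply: eq_bigr => n _; rewrite -big_split. Qed.

Lemma sqsumZ N (x : R) f : sqsum N (fun n k => x * f n k) = x * sqsum N f.
Proof. by rewrite /sqsum mulr_sumr; apply: eq_bigr => n _; rewrite mulr_sumr. Qed.

Lemma sqsumB N f g : sqsum N (fun n k => f n k - g n k) = sqsum N f - sqsum N g.
Proof.
rewrite -[- sqsum N g]mulN1r -sqsumZ -sqsumD.
by apply: eq_sqsum => n k; rewrite mulN1r.
Qed.

Lemma sqsum_swap N f : sqsum N (fun n k => f k n) = sqsum N f.
Proof. by rewrite /sqsum exchange_big. Qed.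

Lemma sqsum_prod N (f g : nat -> R) :
  sqsum N (fun n k => f n * g k) = (\sum_(n < N) f n) * (\sum_(k < N) g k).
Proof. by rewrite /sqsum mulr_suml; apply: eq_bigr => n _; rewrite mulr_sumr. Qed.

Lemma ler_sqsum N f g : (forall n k, f n k <= g n k) -> sqsum N f <= sqsum N g.
Proof. by move=> h; apply: ler_sum => n _; apply: ler_sum => k _. Qed.

Lemma sqsum_ge0 N f : (forall n k, 0 <= f n k) -> 0 <= sqsum N f.
Proof. by move=> h; apply: sumr_ge0 => n _; apply: sumr_ge0 => k _. Qed.

Lemma ler_norm_sqsum N f : `|sqsum N f| <= sqsum N (fun n k => `|f n k|).
Proof.
apply: le_trans (ler_norm_sum _ _ _) _; apply: ler_sum => n _.
exact: ler_norm_sum.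
Qed.

Lemma sqsum_mono u M N : (forall n k, 0 <= u n k) -> (M <= N)%N -> sqsum M u <= sqsum N u.
Proof.
move=> u0 /subnK <-; elim: (N - M)%N => //= k IH; apply: le_trans IH _.
rewrite addSn /sqsum big_ord_recr /= -[X in X <= _]addr0; apply: lerD; last first.
  by apply: sumr_ge0 => i _.
by apply: ler_sum => n _; rewrite big_ord_recr /= lerDl.
Qed.

Lemma sqsum_mono_diff f g M N : (forall n k, f n k <= g n k) -> (M <= N)%N ->
  sqsum N f - sqsum M f <= sqsum N g - sqsum M g.
Proof.
move=> fg MN; have := @sqsum_mono (fun n k => g n k - f n k) M N.
by rewrite !sqsumB => /(_ (fun n k => ltac:(by rewrite subr_ge0)) MN); lra.
Qed.

Lemma sqsum_split f g a M N : (M <= N)%N -> (forall n k, `|f n k| <= g n k) ->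
  (forall n k, `|f n k| <= a n k) ->
  `|sqsum N f| <= sqsum M g + (sqsum N a - sqsum M a).
Proof.
move=> MN fg fa; apply: le_trans (ler_norm_sqsum _ _) _.
have h1 := sqsum_mono_diff fa MN; have h2 := ler_sqsum M fg; lra.
Qed.

Lemma sqsum_tail f a M N : (M <= N)%N -> (forall n k, `|f n k| <= a n k) ->
  `|sqsum N f - sqsum M f| <= sqsum N a - sqsum M a.
Proof.
move=> MN fa; rewrite ler_norml; apply/andP; split.
  have fN n k : - f n k <= a n k.
    by apply: le_trans (ler_norm _) _; rewrite normrN.
  have := sqsum_mono_diff fN MN.
  have e K : sqsum K (fun n k => - f n k) = - sqsum K f.
    by rewrite -[RHS]mulN1r -sqsumZ; apply: eq_sqsum => n k; rewrite mulN1r.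
  by rewrite !e; lra.
by apply: sqsum_mono_diff => // n k; apply: le_trans (ler_norm _) _.
Qed.

Lemma has_deriv_sqsum N (F : nat -> nat -> R -> R) (dF : nat -> nat -> R) x :
  (forall n k, has_deriv (F n k) x (dF n k)) ->
  has_deriv (fun y => sqsum N (fun n k => F n k y)) x (sqsum N dF).
Proof.
move=> h; apply: (@has_deriv_sum _ N (fun n y => \sum_(k < N) F n k y)
  (fun n => \sum_(k < N) dF n k)) => n.
exact: (@has_deriv_sum _ N (F n) (dF n)).
Qed.

Lemma mono_sup (u : nat -> R) (K : R) : (forall m n, (m <= n)%N -> u m <= u n) ->
  (forall n, u n <= K) ->
  exists2 L, (forall n, u n <= L) &
    forall e, 0 < e -> exists N, forall n, (N <= n)%N -> L - u n <= e.
Proof.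
move=> um uK; pose E := [set x | exists n, x = u n]%classic.
have hE : has_sup E.
  split; first by exists (u 0%N); exists 0%N.
  by exists K => _ [n ->].
exists (sup E); first by move=> n; apply: sup_upper_bound => //; exists n.
move=> e e0; have [_ [N ->] hN] := sup_adherent e0 hE.
by exists N => n /um h; lra.
Qed.

End SquareSums.

Section MehlerRelation.
Variable R : realType.
Variable l : R.
Hypothesis hl : 1 / 2 < l < 1.
Local Notation c := (bet (l - 1)).
Local Notation mu := (1 - l).

Lemma l01 : 0 < l < 1. Proof. by move/andP: hl => [a b]; apply/andP; split; lra. Qed.

Let c_gt0 n : 0 < c n. Proof. exact: (bet_gt0 (hlm1 l01)). Qed.

(** The coefficients decay like [n^-l], and [l > 1 / 2] makes the series converge. The induction
    follows [c N * sqrt (N + 1)], which drops by at least [(l - 1 / 2) c N / sqrt (N + 1)] at each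
    step. *)
Lemma sum_c_sqrt N : \sum_(n < N) c n / Num.sqrt n.+1%:R <= (l - 1 / 2)^-1.
Proof.
have /andP[l0 l1] := hl; have q0 : 0 < l - 1 / 2 by lra.
suff h : \sum_(n < N) c n / Num.sqrt n.+1%:R <=
    (1 - c N * Num.sqrt N.+1%:R) / (l - 1 / 2).
  apply: le_trans h _; rewrite ler_pdivrMr // mulVf ?gt_eqF //.
  by rewrite gerBl mulr_ge0 ?sqrtr_ge0 // ltW.
elim: N => [|N IH].
  by rewrite big_ord0 /= sqrtr1 mulr1 subrr mul0r.
rewrite big_ord_recr /=; apply: le_trans (lerD IH (lexx _)) _.
set r := Num.sqrt N.+1%:R; set r' := Num.sqrt N.+2%:R.
have r2 : r ^+ 2 = N.+1%:R by rewrite sqr_sqrtr ?ler0n.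
have r'2 : r' ^+ 2 = r ^+ 2 + 1 by rewrite r2 sqr_sqrtr ?ler0n // -natr1.
have r1 : 1 <= r by rewrite -(@sqrtr1 R) ler_wsqrtr // ler1n.
have r0 : 0 < r by lra.
have r'0 : 0 <= r' by exact: sqrtr_ge0.
have r'r : r' <= r + 1 / (2 * r).
  rewrite -(@ler_pXn2r _ 2) ?nnegrE //; last first.
    by rewrite addr_ge0 ?divr_ge0 ?mulr_ge0 // ltW.
  rewrite r'2; have -> : (r + 1 / (2 * r)) ^+ 2 = r ^+ 2 + 1 + (1 / (2 * r)) ^+ 2.
    by field; rewrite gt_eqF.
  by rewrite lerDl sqr_ge0.
have cE : c N * ((N%:R - (l - 1)) / N.+1%:R) = c N * (1 - l / r ^+ 2).
  rewrite r2 -natr1; field; rewrite natr1 pnatr_eq0 //.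
rewrite cE -lerBrDl -mulrBl ler_pdivlMr //.
have -> : 1 - c N * (1 - l / r ^+ 2) * r' - (1 - c N * r) =
  c N * (r - (1 - l / r ^+ 2) * r') by ring.
rewrite -mulrA ler_wpM2l ?(ltW (c_gt0 N)) //.
have p0 : 0 <= 1 - l / r ^+ 2.
  rewrite subr_ge0 ler_pdivrMr ?exprn_gt0 // mul1r; nra.
have := ler_wpM2l p0 r'r.
have -> : (1 - l / r ^+ 2) * (r + 1 / (2 * r)) =
  r + (1 / 2 - l) / r - l / (2 * r ^+ 3) by field; rewrite gt_eqF.
have : 0 <= l / (2 * r ^+ 3) by rewrite divr_ge0 ?mulr_ge0 ?exprn_ge0 //; lra.
have -> : r^-1 * (l - 1 / 2) = - ((1 / 2 - l) / r) by field; rewrite gt_eqF.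
lra.
Qed.

Section Kernel.
Variable nu : R.
Hypothesis hnu : 0 < nu <= 1.

Definition kern (n k : nat) : R := c n * c k / (n%:R + k%:R + nu).

Lemma den_gt0 (n k : nat) : 0 < n%:R + k%:R + nu :> R.
Proof. by case/andP: hnu => a b; rewrite ltr_wpDl // addr_ge0. Qed.

Lemma kern_ge0 n k : 0 <= kern n k.
Proof. by rewrite /kern divr_ge0 ?mulr_ge0 ?(ltW (c_gt0 _)) ?(ltW (den_gt0 _ _)). Qed.

Definition kern_bound := nu^-1 * (l - 1 / 2)^-1 ^+ 2.

(** As [nu sqrt (n + 1) sqrt (k + 1) <= n + k + nu], the double sum is dominated by the square of
    the single sum in [sum_c_sqrt]. *)
Lemma kern_sum_le N : sqsum N kern <= kern_bound.
Proof.
have /andP[l0 l1] := hl; have q0 : 0 < l - 1 / 2 by lra.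
have /andP[n0 n1] := hnu.
pose h n : R := c n / Num.sqrt n.+1%:R.
apply: (@le_trans _ _ (sqsum N (fun n k => nu^-1 * (h n * h k)))).
  apply: ler_sqsum => n k; rewrite /kern /h.
  set a := Num.sqrt n.+1%:R; set b := Num.sqrt k.+1%:R.
  have a0 : 0 < a by rewrite sqrtr_gt0 ltr0n.
  have b0 : 0 < b by rewrite sqrtr_gt0 ltr0n.
  have a2 : a ^+ 2 = n%:R + 1 by rewrite sqr_sqrtr ?ler0n // natr1.
  have b2 : b ^+ 2 = k%:R + 1 by rewrite sqr_sqrtr ?ler0n // natr1.
  have -> : nu^-1 * (c n / a * (c k / b)) = c n * c k / (nu * (a * b)).
    by field; rewrite !gt_eqF.
  rewrite ler_wpM2l ?mulr_ge0 ?(ltW (c_gt0 _)) //.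
  rewrite lef_pV2 ?posrE ?den_gt0 ?mulr_gt0 //.
  have ab : a * b <= n%:R + k%:R + 1.
    have n_0 : 0 <= n%:R :> R by rewrite ler0n.
    have k_0 : 0 <= k%:R :> R by rewrite ler0n.
    have := sqr_ge0 (a - b); nra.
  apply: le_trans (ler_wpM2l (ltW n0) ab) _.
  have : nu * (n%:R + k%:R) <= n%:R + k%:R by rewrite ler_piMl // addr_ge0.
  lra.
rewrite sqsumZ sqsum_prod /kern_bound ler_wpM2l ?invr_ge0 ?(ltW n0) // expr2.
have s0 : 0 <= \sum_(n < N) h n.
  by apply: sumr_ge0 => i _; rewrite divr_ge0 ?sqrtr_ge0 // ltW.
by apply: ler_pM => //; exact: sum_c_sqrt.
Qed.

Definition sinJ N x := sqsum N (fun n k => kern n k * sin ((2 * n%:R + nu) * x)).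
Definition cosJ N x := sqsum N (fun n k => kern n k * cos ((2 * n%:R + nu) * x)).

(** Extends [sinJ] off the diagonal [y = t]; it vanishes at [y = 0], and differentiation in [y]
    cancels the denominators of [kern]. *)
Definition sinS N t y := sqsum N (fun n k =>
  kern n k * cos ((n%:R - k%:R) * t) * sin ((n%:R + k%:R + nu) * y)).

(** By the symmetry of [kern] in [n] and [k], and the formula for the sum of two sines. *)
Lemma sinS_diag N t : sinS N t t = sinJ N t.
Proof.
suff e : 2 * sinS N t t = 2 * sinJ N t.
  have n2 : 2 != 0 :> R by rewrite pnatr_eq0.
  exact: (mulfI n2 e).
have -> : 2 * sinJ N t = sqsum N (fun n k =>
    kern n k * (sin ((2 * n%:R + nu) * t) + sin ((2 * k%:R + nu) * t))).
  rewrite mulr2n mulrDl mul1r {2}/sinJ -sqsum_swap /sinJ -sqsumD.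
  apply: eq_sqsum => n k; rewrite /kern; have := den_gt0 n k; have := den_gt0 k n.
  move=> h1 h2; field; rewrite !gt_eqF //.
rewrite /sinS -sqsumZ; apply: eq_sqsum => n k.
have -> : (2 * n%:R + nu) * t = (n%:R + k%:R + nu) * t + (n%:R - k%:R) * t by ring.
have -> : (2 * k%:R + nu) * t = (n%:R + k%:R + nu) * t - (n%:R - k%:R) * t by ring.
rewrite sinD sinB; ring.
Qed.

Lemma sinS0 N t : sinS N t 0 = 0.
Proof.
rewrite /sinS /sqsum big1 // => n _; rewrite big1 // => k _.
by rewrite mulr0 sin0 mulr0.
Qed.

Lemma sinS_deriv N t y : has_deriv (sinS N t) y (sqsum N (fun n k =>
  c n * c k * cos ((n%:R - k%:R) * t) * cos ((n%:R + k%:R + nu) * y))).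
Proof.
apply: (@has_deriv_sqsum _ N (fun n k y =>
  kern n k * cos ((n%:R - k%:R) * t) * sin ((n%:R + k%:R + nu) * y))) => n k.
have h := has_derivZ (kern n k * cos ((n%:R - k%:R) * t))
  (has_deriv_sin_affine (n%:R + k%:R + nu) 0 y).
apply: has_deriv_eq (eq_has_deriv _ h); last by move=> z; rewrite addr0.
by rewrite addr0 /kern; field; rewrite gt_eqF // den_gt0.
Qed.

(** Low terms are Lipschitz in [y], high ones are bounded by [kern]. The estimate bridges the gap
    next to [y = t], where the bounds on the derivative blow up. *)
Lemma sinS_cont M N t y : (M <= N)%N ->
  `|sinS N t t - sinS N t y| <= sqsum M (fun n k => c n * c k) * `|t - y| +
     2 * (sqsum N kern - sqsum M kern).
Proof.
move=> MN; rewrite /sinS -sqsumB.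
rewrite mulrC -sqsumZ mulrBr -!sqsumZ.
have lip (a b : R) : `|sin a - sin b| <= `|a - b|.
  wlog ab : a b / b <= a => [h|].
    have [ba|/ltW ba] := leP b a; first exact: h.
    by rewrite (distrC (sin a)) (distrC a); exact: h.
  have := @mean_value_bound _ (@sin R) (@cos R) b a 1 ab
    (fun x _ => is_derive_sin x) (fun x _ => cos_max x).
  by rewrite mul1r (ger0_norm (_ : 0 <= a - b)) // subr_ge0.
apply: sqsum_split => // n k; rewrite -mulrBr normrM normrM (ger0_norm (kern_ge0 n k)).
  apply: (@le_trans _ _ (kern n k * 1 * ((n%:R + k%:R + nu) * `|t - y|))).
    apply: ler_pM; [by apply: mulr_ge0 => //; exact: kern_ge0|by []| |].
      by rewrite ler_wpM2l ?kern_ge0 // cos_max.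
    apply: le_trans (lip _ _) _; rewrite -mulrBr normrM gtr0_norm //; exact: den_gt0.
  rewrite mulr1 /kern mulrA divfK ?gt_eqF ?den_gt0 // mulrC //.
rewrite [2 * _]mulrC.
apply: ler_pM; [by apply: mulr_ge0 => //; exact: kern_ge0|by []| |].
  by rewrite ler_piMr ?kern_ge0 ?cos_max.
apply: le_trans (ler_normB _ _) _.
have := sin_max ((n%:R + k%:R + nu) * t); have := sin_max ((n%:R + k%:R + nu) * y); lra.
Qed.

End Kernel.

(** With this phase [e^(i mu (x - pi) / 2) (1 - e^(i x))^-mu] is the real number
    [(2 sin (x / 2))^-mu], so [sinB_] tends to [0] while [cosB_] stays bounded. *)
Definition phs (n : nat) x := n%:R * x + mu * (x - pi) / 2.
Definition sinB_ N x := \sum_(n < N) c n * sin (phs n x).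
Definition cosB_ N x := \sum_(n < N) c n * cos (phs n x).

(** As [nu] and [nu'] are symmetric about [mu], the cosines differ by a product of two sines. What
    remains is the imaginary part of the sum at [t + y] times the conjugate of the sum at
    [t - y]. *)
Lemma kern_diff (nu nu' : R) N t y : nu + nu' = 2 * mu ->
  sqsum N (fun n k => c n * c k * cos ((n%:R - k%:R) * t) * cos ((n%:R + k%:R + nu) * y)) -
  sqsum N (fun n k => c n * c k * cos ((n%:R - k%:R) * t) * cos ((n%:R + k%:R + nu') * y)) =
  - 2 * sin ((nu - mu) * y) *
    (sinB_ N (t + y) * cosB_ N (t - y) - cosB_ N (t + y) * sinB_ N (t - y)).
Proof.
move=> hnn; have -> : nu' = 2 * mu - nu by lra.
pose A (n k : nat) : R := (n%:R + k%:R + mu) * y.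
rewrite -sqsumB.
have -> : sinB_ N (t + y) * cosB_ N (t - y) - cosB_ N (t + y) * sinB_ N (t - y) =
    sqsum N (fun n k => c n * c k * (sin (A n k) * cos ((n%:R - k%:R) * t))).
  have -> : sqsum N (fun n k => c n * c k * (sin (A n k) * cos ((n%:R - k%:R) * t))) =
     sqsum N (fun n k => c n * c k * sin (A n k + (n%:R - k%:R) * t)).
    have z : sqsum N (fun n k => c n * c k * (cos (A n k) * sin ((n%:R - k%:R) * t))) = 0.
      set s := sqsum _ _; suff : s = - s by lra.
      rewrite /s -{1}sqsum_swap -[RHS]mulN1r -sqsumZ; apply: eq_sqsum => n k.
      have -> : A k n = A n k by rewrite /A; ring.
      have -> : (k%:R - n%:R) * t = - ((n%:R - k%:R) * t) :> R by ring.
      by rewrite sinN; ring.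
    rewrite -[LHS]addr0 -[in LHS]z -sqsumD; apply: eq_sqsum => n k.
    by rewrite sinD; ring.
  rewrite /sinB_ /cosB_.
  rewrite -(sqsum_prod N (fun n => c n * sin (phs n (t + y))) (fun n => c n * cos (phs n (t - y)))).
  rewrite -(sqsum_prod N (fun n => c n * cos (phs n (t + y))) (fun n => c n * sin (phs n (t - y)))).
  rewrite -sqsumB; apply: eq_sqsum => n k.
  have -> : A n k + (n%:R - k%:R) * t = phs n (t + y) - phs k (t - y).
    by rewrite /A /phs; field.
  by rewrite sinB; ring.
rewrite -sqsumZ; apply: eq_sqsum => n k.
have -> : (n%:R + k%:R + nu) * y = A n k + (nu - mu) * y by rewrite /A; ring.
have -> : (n%:R + k%:R + (2 * mu - nu)) * y = A n k - (nu - mu) * y by rewrite /A; ring.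
rewrite cosD cosB; ring.
Qed.

Lemma phs_ang n x : phs n x - x / 2 = ang l n x - pi / 2.
Proof. by rewrite /phs /ang; field. Qed.

Lemma phs_succ n x : phs n x + x / 2 = ang l n.+1 x - pi / 2.
Proof. by rewrite -phs_ang /phs -natr1; field. Qed.

(** Multiplication by [1 - e^(i x)] raises the exponent from [-mu] to [1 - mu = l], for which the
    sine sums are already estimated. *)
Lemma sinB_id M x : 2 * sin (x / 2) * sinB_ M.+1 x =
  sinser l M x - c M * cos (phs M x + x / 2).
Proof.
have step n : 2 * sin (x / 2) * sin (phs n x) =
    cos (phs n x - x / 2) - cos (phs n x + x / 2).
  by move: (phs n x) => p; rewrite cosB cosD; ring.
elim: M => [|M IH].
  rewrite /sinB_ /sinser !big_ord_recl !big_ord0 /= !addr0 !mul1r step phs_ang.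
  by rewrite cosBpihalf.
rewrite /sinB_ big_ord_recr /sinser [in RHS]big_ord_recr -/(sinB_ M.+1 x) -/(sinser l M x).
rewrite mulrDr IH mulrCA step phs_ang phs_succ !cosBpihalf.
have -> : nat_of_ord (@ord_max M.+1) = M.+1 by [].
rewrite (bet_diff l M); move: (c M.+1) (c M) => p q /=; ring.
Qed.

Lemma cosB_id M x : 2 * sin (x / 2) * cosB_ M.+1 x =
  cosser l M x + c M * sin (phs M x + x / 2).
Proof.
have step n : 2 * sin (x / 2) * cos (phs n x) =
    sin (phs n x + x / 2) - sin (phs n x - x / 2).
  by move: (phs n x) => p; rewrite sinB sinD; ring.
elim: M => [|M IH].
  rewrite /cosB_ /cosser !big_ord_recl !big_ord0 /= !addr0 !mul1r step phs_ang.
  by rewrite sinBpihalf opprK addrC.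
rewrite /cosB_ big_ord_recr /cosser [in RHS]big_ord_recr -/(cosB_ M.+1 x) -/(cosser l M x).
rewrite mulrDr IH mulrCA step phs_ang phs_succ !sinBpihalf.
have -> : nat_of_ord (@ord_max M.+1) = M.+1 by [].
rewrite (bet_diff l M); move: (c M.+1) (c M) => p q /=; ring.
Qed.

Lemma sinB_small M x (s : R) : 0 < x < pi *+ 2 -> 0 < s -> s <= sin (x / 2) ->
  `|sinB_ M.+1 x| <= (pi / s ^+ 2 + 1) / s * c M.
Proof.
move=> hx s0 hs; have sp : 0 < sin (x / 2) by apply: lt_le_trans hs.
have c0 := c_gt0 M.
have h := sinser_bound l01 M hx s0 hs.
have pc : `|c M * cos (phs M x + x / 2)| <= c M.
  by rewrite normrM gtr0_norm // ler_piMr ?cos_max // ltW.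
have hb : 2 * sin (x / 2) * `|sinB_ M.+1 x| <= (pi / s ^+ 2 + 1) * c M.
  rewrite -[2 * sin (x / 2)]gtr0_norm ?mulr_gt0 // -normrM sinB_id.
  apply: le_trans (ler_normB _ _) _.
  have -> : (pi / s ^+ 2 + 1) * c M = pi * c M / s ^+ 2 + c M by field; rewrite gt_eqF.
  lra.
rewrite mulrAC ler_pdivlMr //; apply: le_trans hb; rewrite mulrC.
apply: ler_wpM2r => //; lra.
Qed.

Lemma cosB_bound M x (s : R) : 0 < s -> s <= sin (x / 2) -> `|cosB_ M.+1 x| <= 3 / s.
Proof.
move=> s0 hs; have sp : 0 < sin (x / 2) by apply: lt_le_trans hs.
have pc : `|c M * sin (phs M x + x / 2)| <= 1.
  rewrite normrM gtr0_norm ?c_gt0 //; apply: le_trans (bet_le1 (hlm1 l01) M).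
  by rewrite ler_piMr ?sin_max // ltW.
have cs : `|cosser l M x| <= 2.
  apply: le_trans (norm_bet_sum_le l01 M.+1); apply: le_trans (ler_norm_sum _ _ _) _.
  by apply: ler_sum => j _; rewrite normrM ler_piMr ?cos_max.
rewrite ler_pdivlMr //.
have hb : 2 * sin (x / 2) * `|cosB_ M.+1 x| <= 3.
  rewrite -[2 * sin (x / 2)]gtr0_norm ?mulr_gt0 // -normrM cosB_id.
  by apply: le_trans (ler_normD _ _) _; lra.
apply: le_trans hb; rewrite mulrC; apply: ler_wpM2r => //; lra.
Qed.

Lemma sin_ge_min (a b x : R) : 0 <= a -> a <= x <= b -> b <= pi ->
  Num.min (sin a) (sin b) <= sin x.
Proof.
move=> a0 /andP[ax xb] bpi; rewrite ge_min.
have [h|h] := lerP x (pi / 2); apply/orP; [left|right].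
  by rewrite leNgt ltr_sin ?in_itv /= -?leNgt; lra.
have e (y : R) : sin y = sin (pi - y) by rewrite sinB sinpi cospi mul0r mulN1r sub0r opprK.
by rewrite (e b) (e x) leNgt ltr_sin ?in_itv /= -?leNgt; lra.
Qed.

Variables nu nu' : R.
Hypothesis hnu : 0 < nu <= 1.
Hypothesis hnu' : 0 < nu' <= 1.
Hypothesis hsum : nu + nu' = 2 * mu.

(* The derivatives in [y] of the two sums [sinS] differ by [sin ((nu - mu) y)] times the
   imaginary part of partial sums of [z^mu (1 - 2 z cos t + z^2)^-mu], [z = e^(i y)], which
   is real for [|y| < t]. *)
Lemma sinJ_diff_pointwise t e : 0 < t < pi -> 0 < e ->
  exists N0, forall N, (N0 <= N)%N -> `|sinJ nu N t - sinJ nu' N t| <= e.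
Proof.
move=> /andP[t0 tpi] e0.
have [L hL Lc] := mono_sup (fun m n => @sqsum_mono _ (kern nu) m n (kern_ge0 hnu))
  (kern_sum_le hnu).
have [L' hL' Lc'] := mono_sup (fun m n => @sqsum_mono _ (kern nu') m n (kern_ge0 hnu'))
  (kern_sum_le hnu').
have e16 : 0 < e / 16 by lra.
have [N1 hN1] := Lc _ e16; have [N1' hN1'] := Lc' _ e16.
pose M := maxn N1 N1'.
have hM := hN1 M (leq_maxl _ _); have hM' := hN1' M (leq_maxr _ _).
pose W := sqsum M (fun n k => c n * c k).
have W0 : 0 <= W by apply: sqsum_ge0 => n k; rewrite mulr_ge0 // ltW.
(* On [[t - d, t]] the bound is [sinS_cont]; on [[0, t - d]] it is the derivative, which tends to
   [0] uniformly. *)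
pose d := Num.min (t / 2) (e / (16 * (W + 1))).
have d0 : 0 < d by rewrite lt_min !divr_gt0 // mulr_gt0 // ltr_wpDl.
have dt : d <= t / 2 by rewrite ge_min lexx.
have dW : W * d <= e / 16.
  have : d * (16 * (W + 1)) <= e.
    by rewrite -ler_pdivlMr ?ge_min ?lexx ?orbT // mulr_gt0 // ltr_wpDl.
  nra.
(* For [y] in [[0, t - d]] both [(t - y) / 2] and [(t + y) / 2] lie in [[d / 2, t]]. *)
pose s := Num.min (sin (d / 2)) (sin t).
have s0 : 0 < s by rewrite lt_min !sin_gt0_pi //; lra.
pose K := 4 * ((pi / s ^+ 2 + 1) / s) * (3 / s).
have K0 : 0 < K.
  have p1 : 0 < pi / s ^+ 2 + 1 by rewrite ltr_wpDl // divr_ge0 ?pi_ge0 // sqr_ge0.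
  by rewrite /K !mulr_gt0 ?invr_gt0.
have Kp : 0 < K * pi by exact: mulr_gt0 K0 (pi_gt0 R).
have eK : 0 < e / (4 * (K * pi)) by apply: divr_gt0 => //; exact: mulr_gt0.
have [N2 hN2] := bet_cvg0 (hlm1 l01) eK.
exists (maxn M N2.+1) => N; rewrite geq_max => /andP[MN N2N].
have [P hP] : exists P, N = P.+1 by exists N.-1; rewrite prednK // (leq_trans _ N2N).
have cP : c P * (K * pi) <= e / 4.
  have := hN2 P; rewrite hP ltnS in N2N => /(_ N2N).
  have K4 : 0 < 4 * (K * pi) by exact: mulr_gt0.
  rewrite ler_pdivlMr // => h; rewrite -(@ler_pM2l _ 4) //; lra.
pose y0 := t - d.
have y00 : 0 <= y0 by rewrite /y0; lra.
pose D y := sinS nu N t y - sinS nu' N t y.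
have Dder y : has_deriv D y (- 2 * sin ((nu - mu) * y) *
    (sinB_ N (t + y) * cosB_ N (t - y) - cosB_ N (t + y) * sinB_ N (t - y))).
  rewrite -(kern_diff _ _ _ hsum).
  have h := has_derivD (sinS_deriv hnu N t y) (has_derivZ (-1) (sinS_deriv hnu' N t y)).
  rewrite mulN1r in h.
  by apply: eq_has_deriv h => z; rewrite mulN1r.
have DB y : 0 <= y <= y0 -> `|- 2 * sin ((nu - mu) * y) *
    (sinB_ N (t + y) * cosB_ N (t - y) - cosB_ N (t + y) * sinB_ N (t - y))| <= K * c P.
  move=> hy; rewrite /y0 in hy.
  have s1 : s <= sin ((t + y) / 2).
    by apply: sin_ge_min; lra.
  have s2 : s <= sin ((t - y) / 2).
    by apply: sin_ge_min; lra.
  have r1 : 0 < t + y < pi *+ 2 by rewrite mulr2n; lra.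
  have r2 : 0 < t - y < pi *+ 2 by rewrite mulr2n; lra.
  have a1 := sinB_small P r1 s0 s1; have a2 := sinB_small P r2 s0 s2.
  have b1 := cosB_bound P s0 s1; have b2 := cosB_bound P s0 s2.
  rewrite hP; set q := (pi / s ^+ 2 + 1) / s in a1 a2.
  rewrite !normrM normrN (@ger0_norm _ 2) //.
  have m1 := sin_max ((nu - mu) * y).
  have q1 : `|sinB_ P.+1 (t + y) * cosB_ P.+1 (t - y)| <= q * c P * (3 / s).
    by rewrite normrM; apply: ler_pM.
  have q2 : `|cosB_ P.+1 (t + y) * sinB_ P.+1 (t - y)| <= 3 / s * (q * c P).
    by rewrite normrM; apply: ler_pM.
  have q3 := ler_normB (sinB_ P.+1 (t + y) * cosB_ P.+1 (t - y))
    (cosB_ P.+1 (t + y) * sinB_ P.+1 (t - y)).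
  have -> : K * c P = 2 * 1 * (q * c P * (3 / s) + 3 / s * (q * c P)) by rewrite /K -/q; ring.
  apply: ler_pM; rewrite ?mulr_ge0 //; last by lra.
  by rewrite ler_wpM2l.
have := mean_value_bound y00 (fun y _ => Dder y) DB.
rewrite {2}/D !sinS0 subrr subr0 subr0 => hD.
have hD' : `|D y0| <= e / 4.
  apply: le_trans hD (le_trans _ cP).
  have -> : c P * (K * pi) = K * c P * pi by ring.
  apply: ler_wpM2l; first exact: mulr_ge0 (ltW K0) (ltW (c_gt0 P)).
  by rewrite /y0; lra.
have c1 := sinS_cont hnu t y0 MN; have c2 := sinS_cont hnu' t y0 MN.
rewrite !sinS_diag // in c1 c2.
have ty : `|t - y0| = d by rewrite /y0 opprB addrC subrK gtr0_norm.
rewrite ty -/W in c1 c2.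
have n1 := hL N; have n2 := hL' N.
have -> : sinJ nu N t - sinJ nu' N t = (sinJ nu N t - sinS nu N t y0) -
  (sinJ nu' N t - sinS nu' N t y0) + D y0 by rewrite /D; ring.
apply: le_trans (ler_normD _ _) _; apply: le_trans (lerD (ler_normB _ _) (lexx _)) _.
lra.
Qed.

(** The pointwise limit is [0] and the tails are dominated by those of [kern], whatever [t]; these
    tails are the common rate. *)
Lemma sinJ_diff_uniform : exists2 r : nat -> R,
  (forall e, 0 < e -> exists N0, forall N, (N0 <= N)%N -> r N <= e) &
  forall N t, 0 <= t < pi -> `|sinJ nu N t - sinJ nu' N t| <= r N.
Proof.
have [L hL Lc] := mono_sup (fun m n => @sqsum_mono _ (kern nu) m n (kern_ge0 hnu))
  (kern_sum_le hnu).
have [L' hL' Lc'] := mono_sup (fun m n => @sqsum_mono _ (kern nu') m n (kern_ge0 hnu'))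
  (kern_sum_le hnu').
exists (fun N => (L - sqsum N (kern nu)) + (L' - sqsum N (kern nu'))).
  move=> e e0; have e2 : 0 < e / 2 by lra.
  have [N1 h1] := Lc _ e2; have [N2 h2] := Lc' _ e2.
  exists (maxn N1 N2) => N; rewrite geq_max => /andP[/h1 a /h2 b]; lra.
move=> N t /andP[]; rewrite le_eqVlt => /orP[/eqP <- _|t0 tpi].
  have z nn : sinJ nn N 0 = 0.
    rewrite /sinJ /sqsum big1 // => n _; rewrite big1 // => k _.
    by rewrite mulr0 sin0 mulr0.
  rewrite !z subrr normr0; have := hL N; have := hL' N; lra.
apply/ler_addgt0Pl => e e0.
have tt : 0 < t < pi by rewrite t0 tpi.
have [N0 hN0] := sinJ_diff_pointwise tt e0.
pose M := maxn N0 N.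
have h := hN0 M (leq_maxl _ _).
have tl nn (hn : 0 < nn <= 1) : `|sinJ nn M t - sinJ nn N t| <=
    sqsum M (kern nn) - sqsum N (kern nn).
  apply: sqsum_tail; first exact: leq_maxr.
  by move=> n k; rewrite normrM (ger0_norm (kern_ge0 hn n k)) ler_piMr ?kern_ge0 ?sin_max.
have a := tl _ hnu; have b := tl _ hnu'.
have -> : sinJ nu N t - sinJ nu' N t = (sinJ nu M t - sinJ nu' M t) -
  (sinJ nu M t - sinJ nu N t) + (sinJ nu' M t - sinJ nu' N t) by ring.
apply: le_trans (ler_normD _ _) _; apply: le_trans (lerD (ler_normB _ _) (lexx _)) _.
have := hL M; have := hL' M; lra.
Qed.

End MehlerRelation.

(** * Exponential sums and the maximum principle *)

Section ExponentialSums.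
Variable R : realType.
Local Notation C := R[i].
Local Notation C2 := 'cV[C]_2.
Local Notation nc := (@Normc.normc R).

(* [cexp l s t] is [exp (l (s + i t))]. *)
Definition cexp (l s t : R) : C := (expR (l * s) * cos (l * t) +i* (expR (l * s) * sin (l * t)))%C.

Lemma cexpD l m s t : cexp (l + m) s t = cexp l s t * cexp m s t.
Proof.
apply: complex_ext; rewrite /cexp ?cReM ?cImM /= !mulrDl expRD ?cosD ?sinD; ring.
Qed.

Lemma cexp0 s t : cexp 0 s t = 1.
Proof. by apply: complex_ext; rewrite /= !mul0r expR0 ?cos0 ?sin0 mul1r. Qed.

Lemma nc_cexp l s t : nc (cexp l s t) = expR (l * s).
Proof.
have h : nc (cexp l s t) ^+ 2 = expR (l * s) ^+ 2.
  by rewrite nc_sq /= !exprMn -mulrDr cos2Dsin2 mulr1.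
apply/eqP; rewrite -(@eqrXn2 _ 2) ?nc_ge0 ?expR_ge0 //; exact/eqP.
Qed.

(** Finite sums of this kind are closed under polynomials and are differentiated term by term, so
    that the Laplace equation is an identity between coefficients. *)
Definition esum (r : seq (C * R)) s t : C := \sum_(m <- r) m.1 * cexp m.2 s t.

Definition is_esum (g : R -> R -> C) := exists r, forall s t, g s t = esum r s t.

Lemma eq_is_esum g h : (forall s t, g s t = h s t) -> is_esum g -> is_esum h.
Proof. by move=> gh [r hr]; exists r => s t; rewrite -gh. Qed.

Lemma is_esum_cexp (c : C) l : is_esum (fun s t => c * cexp l s t).
Proof. by exists [:: (c, l)] => s t; rewrite /esum big_seq1. Qed.

Lemma is_esum_cst (c : C) : is_esum (fun _ _ => c).
Proof. by apply: eq_is_esum (is_esum_cexp c 0) => s t; rewrite cexp0 mulr1. Qed.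

Lemma is_esumD g h : is_esum g -> is_esum h -> is_esum (fun s t => g s t + h s t).
Proof. by move=> [r hr] [q hq]; exists (r ++ q) => s t; rewrite /esum big_cat hr hq. Qed.

Lemma is_esumM g h : is_esum g -> is_esum h -> is_esum (fun s t => g s t * h s t).
Proof.
move=> [r hr] [q hq]; exists [seq (a.1 * b.1, a.2 + b.2) | a <- r, b <- q] => s t.
rewrite /esum big_allpairs_dep hr hq /esum mulr_suml.
apply: eq_bigr => a _; rewrite mulr_sumr; apply: eq_bigr => b _ /=.
by rewrite cexpD; ring.
Qed.

Lemma is_esumX g n : is_esum g -> is_esum (fun s t => g s t ^+ n).
Proof.
move=> hg; elim: n => [|n IH]; first exact: is_esum_cst.
by apply: eq_is_esum (is_esumM hg IH) => s t; rewrite exprS.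
Qed.

Lemma is_esum_sum n (F : nat -> R -> R -> C) : (forall i, is_esum (F i)) ->
  is_esum (fun s t => \sum_(i < n) F i s t).
Proof.
move=> hF; elim: n => [|n IH].
  by apply: eq_is_esum (is_esum_cst 0) => s t; rewrite big_ord0.
by apply: eq_is_esum (is_esumD IH (hF n)) => s t; rewrite big_ord_recr.
Qed.

Lemma is_esum_polyfun f a b : polyfun f -> is_esum a -> is_esum b ->
  is_esum (fun s t => f (mk2 (a s t) (b s t))).
Proof.
move=> [p hp] ha hb; apply: (@eq_is_esum (fun s t => heval p (mk2 (a s t) (b s t)))).
  by move=> s t; rewrite hp.
rewrite /heval; elim: p {hp} => [|m p IH].
  by apply: eq_is_esum (is_esum_cst 0) => s t; rewrite big_nil.
apply: (@eq_is_esum (fun s t => m.2 * a s t ^+ m.1.1 * b s t ^+ m.1.2 +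
    \sum_(m <- p) m.2 * mk2 (a s t) (b s t) 0 0 ^+ m.1.1 * mk2 (a s t) (b s t) 1 0 ^+ m.1.2)).
  by move=> s t; rewrite big_cons mk2_0 mk2_1.
apply: is_esumD => //.
by apply: is_esumM (is_esumX _ hb); apply: is_esumM (is_esumX _ ha); exact: is_esum_cst.
Qed.

(** Differentiation acting on coefficients: the factor is [l] for the derivative in [s] and [i l]
    for the one in [t]. *)
Definition emul (f : R -> C) (r : seq (C * R)) := [seq (f m.2 * m.1, m.2) | m <- r].

Lemma Re_esum_cons m r s t : Re (esum (m :: r) s t) = Re (m.1 * cexp m.2 s t) + Re (esum r s t).
Proof. by rewrite /esum big_cons cReD. Qed.

Lemma esum_deriv_s r s t : has_deriv (fun x => Re (esum r x t)) s
  (Re (esum (emul (fun l => l%:C) r) s t)).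
Proof.
elim: r => [|[w l] r IH].
  apply: has_deriv_eq (eq_has_deriv _ (has_deriv_cst 0 s)).
    by rewrite /esum big_nil.
  by move=> x; rewrite /esum big_nil.
have h1 := has_deriv_expR (has_deriv_affine l 0 s).
have h2 := has_derivD (has_derivZ (Re w * cos (l * t) - Im w * sin (l * t)) h1) IH.
apply: has_deriv_eq (eq_has_deriv _ h2).
  by rewrite addr0 /= Re_esum_cons /= !cReM /= cImM /=; ring.
by move=> x; rewrite addr0 Re_esum_cons cReM /=; ring.
Qed.

Lemma esum_deriv_t r s t : has_deriv (fun x => Re (esum r s x)) t
  (Re (esum (emul (fun l => (0 +i* l)%C) r) s t)).
Proof.
elim: r => [|[w l] r IH].
  apply: has_deriv_eq (eq_has_deriv _ (has_deriv_cst 0 t)).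
    by rewrite /esum big_nil.
  by move=> x; rewrite /esum big_nil.
have h1 := has_derivZ (expR (l * s) * Re w) (has_deriv_cos_affine l 0 t).
have h2 := has_derivZ (- (expR (l * s) * Im w)) (has_deriv_sin_affine l 0 t).
have h3 := has_derivD (has_derivD h1 h2) IH.
apply: has_deriv_eq (eq_has_deriv _ h3).
  by rewrite !addr0 /= Re_esum_cons /= !cReM /= cImM /=; ring.
by move=> x; rewrite !addr0 Re_esum_cons cReM /=; ring.
Qed.

Lemma esum_harmonic r s t :
  Re (esum (emul (fun l => (0 +i* l)%C) (emul (fun l => (0 +i* l)%C) r)) s t) =
  - Re (esum (emul (fun l => l%:C) (emul (fun l => l%:C) r)) s t).
Proof.
elim: r => [|[w l] r IH]; first by rewrite /esum /= big_nil /= oppr0.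
by rewrite /= !Re_esum_cons IH /= !cReM !cImM /= ?cReM ?cImM /=; ring.
Qed.

Lemma esum_continuous r : continuous (fun p : R * R => Re (esum r p.1 p.2)).
Proof.
elim: r => [|[w l] r IH] p.
  rewrite (_ : (fun p => _) = (fun=> 0)); first exact: cvg_cst.
  by apply/funext => q; rewrite /esum big_nil.
rewrite (_ : (fun p => _) = (fun p : R * R => expR (l * p.1) *
    (Re w * cos (l * p.2) - Im w * sin (l * p.2)) + Re (esum r p.1 p.2))); last first.
  by apply/funext => q; rewrite Re_esum_cons cReM /=; ring.
have c1 : (l * q.1 @[q --> p] --> l * p.1)%classic.
  by apply: cvgMr; exact: cvg_fst.
have c2 : (l * q.2 @[q --> p] --> l * p.2)%classic.
  by apply: cvgMr; exact: cvg_snd.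
apply: cvgD; last exact: IH.
apply: cvgM.
  by apply: (cvg_comp _ _ c1); exact: continuous_expR.
apply: cvgB; apply: cvgMr.
  by apply: (cvg_comp _ _ c2); exact: continuous_cos.
by apply: (cvg_comp _ _ c2); exact: continuous_sin.
Qed.

(* A harmonic function plus [e s^2] is strictly subharmonic, hence has no interior
   maximum. *)
Lemma esum_max_Re r (a b h M : R) s t : a <= s <= b -> 0 <= t <= h ->
  (forall x y, a <= x <= b -> 0 <= y <= h -> [|| x == a, x == b, y == 0 | y == h] ->
     Re (esum r x y) <= M) ->
  Re (esum r s t) <= M.
Proof.
move=> hs ht hM; rewrite leNgt; apply/negP => hlt.
set g := Re (esum r s t) in hlt.
pose D := (b - a) ^+ 2 + 1.
have D0 : 0 < D by rewrite ltr_wpDl ?sqr_ge0.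
(* The perturbation then costs at most half of the gap [g - M], which excludes a maximum on the
   boundary. *)
pose e := (g - M) / (2 * D).
have e0 : 0 < e by rewrite divr_gt0 ?mulr_gt0 ?subr_gt0.
have eD : e * D = (g - M) / 2 by rewrite /e; field; rewrite gt_eqF.
pose v (p : R * R) := Re (esum r p.1 p.2) + e * ((p.1 - a) * (p.1 - a)).
pose A := (`[a, b] `*` `[0, h])%classic : set (R * R).
have cA : compact A by apply: compact_setX; exact: segment_compact.
have A0 : (A !=set0)%classic by exists (s, t); split; rewrite /= in_itv.
have cv : {within A, continuous v}%classic.
  apply: continuous_subspaceT => p; apply: cvgD; first exact: esum_continuous.
  apply: cvgMr; apply: cvgM; apply: cvgB;
    [exact: cvg_fst|exact: cvg_cst|exact: cvg_fst|exact: cvg_cst].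
have [[s0 t0]] := compact_EVT_max A0 cA cv.
rewrite inE /A /= => -[]; rewrite /= !in_itv /= => hs0 ht0 hmax.
have inA x y : a <= x <= b -> 0 <= y <= h -> v (x, y) <= v (s0, t0).
  by move=> hx hy; apply: hmax; rewrite inE /A; split; rewrite /= in_itv.
have vst := inA s t hs ht.
have sq x : a <= x <= b -> (x - a) * (x - a) <= D.
  by move=> hx; rewrite /D; nra.
have intr : ~~ [|| s0 == a, s0 == b, t0 == 0 | t0 == h].
  apply/negP => hb; have := hM _ _ hs0 ht0 hb.
  have := sq s0 hs0; move: vst; rewrite /v /= -/g => x1 x2 x3.
  have : e * ((s0 - a) * (s0 - a)) <= e * D by rewrite ler_wpM2l // ltW.
  have : 0 <= e * ((s - a) * (s - a)) by rewrite mulr_ge0 -?expr2 ?sqr_ge0 // ltW.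
  lra.
move: intr; rewrite !negb_or => /and4P[na nb n0 nh].
have sa : a < s0 by rewrite lt_neqAle eq_sym na; case/andP: hs0.
have sb : s0 < b by rewrite lt_neqAle nb; case/andP: hs0.
have tp : 0 < t0 by rewrite lt_neqAle eq_sym n0; case/andP: ht0.
have th : t0 < h by rewrite lt_neqAle nh; case/andP: ht0.
pose d := Num.min (Num.min (s0 - a) (b - s0)) (Num.min t0 (h - t0)).
have d0 : 0 < d by rewrite !lt_min !subr_gt0 sa sb tp th.
have [d1 d2 d3 d4] : [/\ d <= s0 - a, d <= b - s0, d <= t0 & d <= h - t0].
  by rewrite /d; split; rewrite !ge_min lexx ?orbT.
have dq x : has_deriv (fun x => e * ((x - a) * (x - a))) x (2 * e * (x - a)).
  have h1 : has_deriv (fun x => x - a) x 1.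
    apply: eq_has_deriv (has_deriv_affine 1 (- a) x) => y; by rewrite mul1r.
  by apply: has_deriv_eq (has_derivZ e (has_derivM h1 h1)); ring.
have ss : Re (esum (emul (fun l => l%:C) (emul (fun l => l%:C) r)) s0 t0) + 2 * e <= 0.
  apply: (@second_deriv_at_max _ (fun x => v (x, t0))
    (fun x => Re (esum (emul (fun l => l%:C) r) x t0) + 2 * e * (x - a)) s0 d) => //.
  - move=> y hy; apply: has_derivD; first exact: esum_deriv_s.
    exact: dq.
  - apply: has_derivD; first exact: esum_deriv_s.
    apply: has_deriv_eq (eq_has_deriv _ (has_deriv_affine (2 * e) (- (2 * e * a)) s0)) => //.
    by move=> y; rewrite mulrBr.
  - move=> y hy; apply: inA => //; lra.
have tt : Re (esum (emul (fun l => (0 +i* l)%C) (emul (fun l => (0 +i* l)%C) r)) s0 t0) <= 0.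
  apply: (@second_deriv_at_max _ (fun x => v (s0, x))
    (fun x => Re (esum (emul (fun l => (0 +i* l)%C) r) s0 x)) t0 d) => //.
  - move=> y hy; have hd := has_derivD (esum_deriv_t r s0 y)
      (has_deriv_cst (e * ((s0 - a) * (s0 - a))) y).
    by rewrite addr0 in hd; exact: hd.
  - exact: esum_deriv_t.
  - move=> y hy; apply: inA => //; lra.
move: tt; rewrite esum_harmonic; lra.
Qed.

(** A unimodular constant makes the value at the given point positive; this reduces the modulus to
    the real part. *)
Lemma esum_max g (a b h M : R) s t : is_esum g -> a <= s <= b -> 0 <= t <= h ->
  (forall x y, a <= x <= b -> 0 <= y <= h -> [|| x == a, x == b, y == 0 | y == h] ->
     nc (g x y) <= M) ->
  nc (g s t) <= M.
Proof.
move=> hg hs ht hM; have [z|z] := eqVneq (g s t) 0.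
  rewrite z nc0; apply: le_trans (hM a 0 _ _ _); rewrite ?nc_ge0 ?eqxx ?lexx //=.
    by case/andP: hs => /le_trans h1 /h1.
  by case/andP: ht => /le_trans h1 /h1.
have z0 : 0 < nc (g s t) by rewrite nc_gt0.
pose w := (nc (g s t))^-1%:C * (g s t)^*%C.
have nw : nc w = 1.
  rewrite /w ncM nc_real gtr0_norm ?invr_gt0 //.
  have -> : nc (g s t)^*%C = nc (g s t) by case: (g s t) => x y; rewrite /= sqrrN.
  by rewrite mulVf // gt_eqF.
have [r hr] := is_esumM (is_esum_cst w) hg.
have -> : nc (g s t) = Re (esum r s t).
  rewrite -hr /w -mulrA [(g s t)^*%C * _]mulrC.
  have -> : g s t * (g s t)^*%C = (nc (g s t) ^+ 2)%:C.
    by rewrite nc_sq; case: (g s t) => x y; apply: complex_ext => /=; ring.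
  by rewrite cReM /= mul0r subr0 expr2 mulKf // gt_eqF.
apply: (esum_max_Re hs ht) => x y hx hy hb; rewrite -hr.
apply: le_trans (ler_norm _) _; apply: le_trans (Re_le_nc _) _.
by rewrite ncM nw mul1r; exact: hM.
Qed.

End ExponentialSums.

(** * A family of triples of planes *)

Section TwoPlanes.
Variable R : realType.
Local Notation C := R[i].
Implicit Types (A B T : 'M[R]_2).

Lemma cone_cvx_R2_graph A : 0 < discr A -> cone_cvx (setU2 (@R2 R) (graph_plane A)).
Proof.
move=> /diagonalize [T [l1 [l2 [uT _ e]]]].
have h : cone_cvx (setU2 (@R2 R) (graph_plane (diag2 l1 l2))).
  by apply: cone_cvx_tri2; rewrite diag2_mx2 mx2E.
move: h => /(@cone_cvx_mulmx _ _ (mxC T)); apply: eq_cone_cvx => z.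
by rewrite /setU2 R2_mulmx // -e graph_mulmx.
Qed.

Lemma spec_real_two_diag (l1 l2 : R) : l1 != l2 -> spec_real_two (diag2 l1 l2).
Proof.
move=> l12; have sp z : spectrum (diag2 l1 l2) z <-> z = l1%:C \/ z = l2%:C.
  rewrite spectrumP diag2_mx2 !mx2E mul0r; split.
    by move=> /eqP; rewrite mulf_eq0 !subr_eq0 => /orP[] /eqP; [left|right].
  by case=> ->; rewrite subrr ?mul0r ?mulr0.
split; first by move=> z /sp [] ->; rewrite -complexIm.
exists l1%:C, l2%:C; split=> //.
by apply/eqP => /complexI /eqP; rewrite (negbTE l12).
Qed.

Lemma tr_conj T A : T \in unitmx ->
  Defs.conj T A 0 0 + Defs.conj T A 1 1 = A 0 0 + A 1 1.
Proof.
move=> uT; have tr2 B : \tr B = B 0 0 + B 1 1.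
  by rewrite /mxtrace big_ord_recl big_ord1; congr (_ + B _ _); exact/val_inj.
by rewrite -!tr2 /Defs.conj -mulmxA mxtrace_mulC mulmxKV.
Qed.

Lemma discr_trdet A : discr A = (A 0 0 + A 1 1) ^+ 2 - 4 * \det A.
Proof. by rewrite det2 /discr; ring. Qed.

Lemma discr_conj T A : T \in unitmx -> discr (Defs.conj T A) = discr A.
Proof. by move=> uT; rewrite !discr_trdet tr_conj // det_conj. Qed.

(* The matrices diagonalizing [diag2 l1 l2] are diagonal or antidiagonal, so that the
   signs of [B 0 1 * B 1 0] and of [B 0 0 * B 1 1] are invariants of the pair. *)
Lemma not_OmegaStar (l1 l2 : R) B : l1 != l2 -> B 0 1 * B 1 0 < 0 -> B 0 0 * B 1 1 < 0 ->
  ~ OmegaStar (diag2 l1 l2) B.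
Proof.
move=> l12 bc ad; have l12' : l1 - l2 != 0 by rewrite subr_eq0.
have l2_0 : 0 < (l1 - l2) ^+ 2 by rewrite lt_def sqrf_eq0 l12' sqr_ge0.
have dpos : 0 < discr (diag2 l1 l2) by rewrite diag2_mx2 /discr !mx2E; lra.
move=> [_ [[_ [d0|[T [[uT st] [fT [_ dT]]]]]]|[/spec_nonreal_discr dn _]]]; last by lra.
  by move: d0; rewrite det_comm_diag => /eqP; rewrite mulf_eq0 (gt_eqF l2_0) (lt_eqF bc).
case: st => [[m1 [m2 [m12 e]]]|[s [t [t0 e]]]]; last first.
  have := discr_conj (diag2 l1 l2) uT; rewrite e.
  have t2 : 0 < t ^+ 2 by rewrite lt_def sqrf_eq0 t0 sqr_ge0.
  by rewrite /discr !mx2E -/(discr _); lra.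
set B' := Defs.conj T B in fT dT.
have key : (m1 - m2) ^+ 2 * (B' 0 1 * B' 1 0) = (l1 - l2) ^+ 2 * (B 0 1 * B 1 0).
  by rewrite -!det_comm_diag -e /B' conj_comm // det_conj.
have m0 : 0 < (m1 - m2) ^+ 2 by rewrite lt_def sqrf_eq0 subr_eq0 m12 sqr_ge0.
have bc' : B' 0 1 * B' 1 0 < 0.
  by rewrite -(pmulr_rlt0 _ m0) key pmulr_rlt0.
have trm : m1 + m2 = l1 + l2.
  by have := tr_conj (diag2 l1 l2) uT; rewrite e !diag2_mx2 !mx2E.
have dm : (m1 - m2) ^+ 2 = (l1 - l2) ^+ 2.
  by have := discr_conj (diag2 l1 l2) uT; rewrite e !diag2_mx2 /discr !mx2E; lra.
have bb : B' 0 1 * B' 1 0 = B 0 1 * B 1 0.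
  by apply: (mulfI (lt0r_neq0 m0)); rewrite key dm.
have detB : B' 0 0 * B' 1 1 - B' 0 1 * B' 1 0 = B 0 0 * B 1 1 - B 0 1 * B 1 0.
  by rewrite -!det2 det_conj.
have ad' : B' 0 0 * B' 1 1 < 0 by move: detB; rewrite bb; lra.
(* The determinant in [dT] is four times the product of the diagonal entries of [B'] minus a square,
   hence negative. *)
move: dT; rewrite det2 -/B'; clearbody B'; rewrite !mxE => dT.
have := sqr_ge0 (B' 0 1 + B' 1 0); lra.
Qed.

End TwoPlanes.

Section ThreePlanes.
Variable R : realType.
Local Notation C := R[i].
Local Notation nc := (@Normc.normc R).
Variables p q d : R.
Hypothesis hd : 0 < d.
Hypothesis hdp : d < p.
Hypothesis hpq : p < q.
Hypothesis hq : 2 * q - d < pi / 2.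
Hypothesis hs : p + q < pi / 2.

Ltac angles := move: hd hdp hpq hq hs (pi_gt0 R) => ? ? ? ? ? ?; lra.

Definition cotan (x : R) := cos x / sin x.
(* The graph of [planeA] is [diag (e^(i (p - d)), e^(i (q - d))) R^2]; that of [planeB] is cut
   out by [Im (e^(i d) (z0 - z1)) = 0] and
   [Im (e^(i (d - 2 p)) z0) = Im (e^(i (d - 2 q)) z1)]. *)
Definition planeA := diag2 (cotan (p - d)) (cotan (q - d)).

Local Notation S1 := (sin (2 * p - d)).
Local Notation S2 := (sin (2 * q - d)).
Local Notation C1 := (cos (2 * p - d)).
Local Notation C2 := (cos (2 * q - d)).
Local Notation k := (cotan d).

Definition planeB := mx2 ((C1 + S2 * k) / (S1 - S2)) (- (C2 + S2 * k) / (S1 - S2))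
                         ((C1 + S1 * k) / (S1 - S2)) (- (C2 + S1 * k) / (S1 - S2)).

Lemma sin_pos_small (x : R) : 0 < x -> x < pi / 2 -> 0 < sin x.
Proof. by move=> x0 x1; apply: sin_gt0_pi; rewrite x0 /=; have := pi_gt0 R; lra. Qed.

Lemma cos_pos_small (x : R) : 0 < x -> x < pi / 2 -> 0 < cos x.
Proof. by move=> x0 x1; apply: cos_gt0_pihalf; have := pi_gt0 R; lra. Qed.

Lemma sin_d_gt0 : 0 < sin d. Proof. by apply: sin_pos_small; angles. Qed.
Lemma sin1_gt0 : 0 < S1. Proof. by apply: sin_pos_small; angles. Qed.
Lemma cos2_gt0 : 0 < C2. Proof. by apply: cos_pos_small; angles. Qed.
Lemma sin12_lt : S1 < S2.
Proof. by rewrite ltr_sin ?in_itv /=; angles. Qed.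
Lemma cos12_lt : C2 < C1.
Proof. by rewrite ltr_cos ?in_itv /=; angles. Qed.
Lemma cot_d_gt0 : 0 < k.
Proof. by apply: divr_gt0; [apply: cos_pos_small; angles|exact: sin_d_gt0]. Qed.

Lemma planeAP (z : 'cV[C]_2) : graph_plane planeA z <->
  sin (p - d) * Re (z 0 0) = cos (p - d) * Im (z 0 0) /\
  sin (q - d) * Re (z 1 0) = cos (q - d) * Im (z 1 0).
Proof.
have sa : sin (p - d) != 0 by rewrite gt_eqF // sin_pos_small; angles.
have sb : sin (q - d) != 0 by rewrite gt_eqF // sin_pos_small; angles.
rewrite graph_planeP /planeA diag2_mx2 !mx2E !mul0r addr0 add0r /cotan.
split=> -[e1 e2]; split.
- by rewrite e1; field.
- by rewrite e2; field.
- by apply: (mulfI sa); rewrite e1; field.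
- by apply: (mulfI sb); rewrite e2; field.
Qed.

Definition planeB_form1 (z : 'cV[C]_2) : R :=
  cos d * (Im (z 0 0) - Im (z 1 0)) + sin d * (Re (z 0 0) - Re (z 1 0)).
Definition planeB_form2 (z : 'cV[C]_2) : R :=
  (C1 * Im (z 0 0) - S1 * Re (z 0 0)) - (C2 * Im (z 1 0) - S2 * Re (z 1 0)).

(** The defects in the equations of the graph are combinations of the two forms. Beyond the
    equivalence [planeBP], this measures how far a point that nearly annihilates both forms is from
    the plane. *)
Lemma planeB_res (z : 'cV[C]_2) : let t := S2 - S1 in
  Re (z 0 0) - (planeB 0 0 * Im (z 0 0) + planeB 0 1 * Im (z 1 0)) =
    (planeB_form2 z + S2 * planeB_form1 z / sin d) / t /\
  Re (z 1 0) - (planeB 1 0 * Im (z 0 0) + planeB 1 1 * Im (z 1 0)) =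
    (planeB_form2 z + S1 * planeB_form1 z / sin d) / t.
Proof.
have s0 := lt0r_neq0 sin_d_gt0; have t0 : S2 - S1 != 0 by rewrite subr_eq0 gt_eqF // sin12_lt.
have t0' : S1 - S2 != 0 by rewrite subr_eq0 lt_eqF // sin12_lt.
rewrite /planeB_form1 /planeB_form2 /planeB !mx2E /cotan /=; split; field; by rewrite s0 t0.
Qed.

Lemma planeBP (z : 'cV[C]_2) : graph_plane planeB z <-> planeB_form1 z = 0 /\ planeB_form2 z = 0.
Proof.
have [r0 r1] := planeB_res z; have s0 := sin_d_gt0; have t0 := sin12_lt.
rewrite graph_planeP; split=> [[e0 e1]|[e1 e2]]; last first.
  by move: r0 r1; rewrite e1 e2 !mulr0 !mul0r addr0 mul0r => r0 r1; split; lra.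
move: r0 r1; rewrite e0 e1 !subrr => /esym/eqP r0 /esym/eqP r1.
have t0' : S2 - S1 != 0 by rewrite subr_eq0 gt_eqF.
move: r0 r1; rewrite !mulf_eq0 invr_eq0 (negbTE t0') !orbF => /eqP r0 /eqP r1.
have : (S2 - S1) * (planeB_form1 z / sin d) = 0 by move: r0 r1; rewrite -!mulrA; lra.
move=> /eqP; rewrite mulf_eq0 (negbTE t0') /= mulf_eq0 invr_eq0 (gt_eqF s0) orbF => /eqP e.
by split=> //; move: r0; rewrite e mulr0 mul0r addr0.
Qed.

Lemma cotan_neq : cotan (p - d) != cotan (q - d).
Proof.
have sa : 0 < sin (p - d) by apply: sin_pos_small; angles.
have sb : 0 < sin (q - d) by apply: sin_pos_small; angles.
have : 0 < sin ((q - d) - (p - d)) by apply: sin_pos_small; angles.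
move: sa sb; move: (p - d) (q - d) => x y sx sy; rewrite sinB => h.
rewrite /cotan; apply/eqP => e; move: h.
have -> : sin y * cos x = sin y * sin x * (cos x / sin x) by field; rewrite gt_eqF.
have -> : cos y * sin x = sin y * sin x * (cos y / sin y) by field; rewrite gt_eqF.
by rewrite e subrr ltxx.
Qed.

Lemma planeB_offdiag : planeB 0 1 * planeB 1 0 < 0.
Proof.
have := cot_d_gt0; have := sin1_gt0; have := cos2_gt0; have := cos12_lt; have := sin12_lt.
rewrite /planeB !mx2E; set t1 := S1; set t2 := S2; set c1 := C1; set c2 := C2; set kk := k.
move=> h1 h2 h3 h4 h5.
have -> : - (c2 + t2 * kk) / (t1 - t2) * ((c1 + t1 * kk) / (t1 - t2)) =
  - ((c2 + t2 * kk) * (c1 + t1 * kk) / (t1 - t2) ^+ 2).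
  by field; rewrite subr_eq0 lt_eqF.
rewrite oppr_lt0; apply: divr_gt0; last by rewrite lt_def sqr_ge0 sqrf_eq0 subr_eq0 lt_eqF.
apply: mulr_gt0; nra.
Qed.

Lemma planeB_diag : planeB 0 0 * planeB 1 1 < 0.
Proof.
have := cot_d_gt0; have := sin1_gt0; have := cos2_gt0; have := cos12_lt; have := sin12_lt.
rewrite /planeB !mx2E; set t1 := S1; set t2 := S2; set c1 := C1; set c2 := C2; set kk := k.
move=> h1 h2 h3 h4 h5.
have -> : (c1 + t2 * kk) / (t1 - t2) * (- (c2 + t1 * kk) / (t1 - t2)) =
  - ((c1 + t2 * kk) * (c2 + t1 * kk) / (t1 - t2) ^+ 2).
  by field; rewrite subr_eq0 lt_eqF.
rewrite oppr_lt0; apply: divr_gt0; last by rewrite lt_def sqr_ge0 sqrf_eq0 subr_eq0 lt_eqF.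
apply: mulr_gt0; nra.
Qed.

(** The discriminant is a square whose root is proportional to [sin (2 q) - sin (2 p) = 2 cos (p +
    q) sin (q - p)]; here [p + q < pi / 2] enters. *)
Lemma planeB_discr : 0 < discr planeB.
Proof.
have s0 := sin_d_gt0; have := sin12_lt.
have key : 0 < cos d * (S2 - S1) - sin d * (C1 - C2).
  have -> : cos d * (S2 - S1) - sin d * (C1 - C2) =
      sin (d + (2 * q - d)) - sin (d + (2 * p - d)).
    by move: (2 * q - d) (2 * p - d) => x y; rewrite !sinD; ring.
  have -> : d + (2 * q - d) = (p + q) + (q - p) by ring.
  have -> : d + (2 * p - d) = (p + q) - (q - p) by ring.
  have h1 : 0 < cos (p + q) by apply: cos_pos_small; angles.
  have h2 : 0 < sin (q - p) by apply: sin_pos_small; angles.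
  move: h1 h2; move: (p + q) (q - p) => x y h1 h2; rewrite sinB sinD.
  by have := mulr_gt0 h1 h2; lra.
move: key; rewrite /discr /planeB !mx2E /cotan.
set t1 := S1; set t2 := S2; set c1 := C1; set c2 := C2 => key h1.
have h1' : t1 - t2 != 0 by rewrite subr_eq0 lt_eqF.
have -> : ((c1 + t2 * (cos d / sin d)) / (t1 - t2) -
    - (c2 + t1 * (cos d / sin d)) / (t1 - t2)) ^+ 2 +
  4 * (- (c2 + t2 * (cos d / sin d)) / (t1 - t2) * ((c1 + t1 * (cos d / sin d)) / (t1 - t2))) =
  ((cos d * (t2 - t1) - sin d * (c1 - c2)) / (sin d * (t1 - t2))) ^+ 2.
  by field; rewrite h1' gt_eqF.
by rewrite lt_def sqr_ge0 sqrf_eq0 mulf_neq0 // ?invr_eq0 ?mulf_neq0 // gt_eqF.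
Qed.

(* The pencil of the two planes contains the complex form
   [sin p * e^(-i (p - d)) * z0 - sin q * e^(-i (q - d)) * z1], real on the first one
   and imaginary on the second one. *)
Lemma cone_cvx_planeAB : cone_cvx (setU2 (graph_plane planeA) (graph_plane planeB)).
Proof.
have sp0 : 0 < sin p by apply: sin_pos_small; angles.
have sq0 : 0 < sin q by apply: sin_pos_small; angles.
have cq0 : 0 < cos q by apply: cos_pos_small; angles.
have sqp : 0 < sin (q - p) by apply: sin_pos_small; angles.
pose ca : C := (cos (p - d) -i* sin (p - d))%C.
pose cb : C := (cos (q - d) -i* sin (q - d))%C.
pose u (z : 'cV[C]_2) := (sin p)%:C * ca * z 0 0 + (- (sin q)%:C * cb) * z 1 0.
have Imu z : Im (u z) = sin p * Im (ca * z 0 0) - sin q * Im (cb * z 1 0).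
  by rewrite /u cImD !cImM !cReM !cImN !cReN /=; ring.
have Reu z : Re (u z) = sin p * Re (ca * z 0 0) - sin q * Re (cb * z 1 0).
  by rewrite /u cReD !cReM !cImM !cImN !cReN /=; ring.
have hA z : graph_plane planeA z <-> Im (ca * z 0 0) = 0 /\ Im (cb * z 1 0) = 0.
  by rewrite planeAP !cImM /=; split=> -[e1 e2]; split; lra.
have hB z : graph_plane planeB z -> sin p * Re (ca * z 0 0) = sin q * Re (cb * z 1 0) /\
    cos p * Im (ca * z 0 0) = cos q * Im (cb * z 1 0).
  move=> /planeBP []; rewrite /planeB_form1 /planeB_form2.
  have -> : 2 * p - d = p + (p - d) by ring.
  have -> : 2 * q - d = q + (q - d) by ring.
  have e (x : R) : d = x - (x - d) by ring.
  rewrite !cReM !cImM /= !mulrBr {1}(e p) [in X in _ - X + _](e q).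
  rewrite [in X in _ + (X - _)](e p) [in X in _ + (_ - X)](e q).
  move: (p - d) (q - d) => x y; rewrite !cosB !sinB !cosD !sinD => e1 e2.
  by split; lra.
have pu : polyfun u by exact: polyfun_lin.
have u0 : u 0 = 0 by rewrite /u !mxE !mulr0 addr0.
have sA : sep_by u 1 1 (graph_plane planeA).
  move=> w /hA [e1 e2]; rewrite Re_gsq nc_sq Imu e1 e2 /=; lra.
have sB : sep_by u (- 1) 1 (graph_plane planeB).
  move=> w /hB [e1 e2]; rewrite Re_gsq nc_sq Reu e1 subrr /=; lra.
(* [Im (ca * z0)] vanishes on the first plane, and on the second one it is [Im u] times
   [- cos q / sin (q - p)]. So it is small wherever [u] is. *)
pose K := cos q / sin (q - p) + 1.
have K0 : 0 < K by rewrite /K ltr_wpDl // divr_ge0 // ltW.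
have lipu w : setU2 (graph_plane planeA) (graph_plane planeB) w ->
    `|Im (ca * w 0 0)| <= K * nc (u w).
  move=> [/hA [-> _]|/hB [_ e]]; first by rewrite normr0 mulr_ge0 ?nc_ge0 // ltW.
  have e' : sin (q - p) * Im (ca * w 0 0) = - (cos q * Im (u w)).
    rewrite Imu mulrBr [cos q * (sin q * _)]mulrCA -e sinB; ring.
  have -> : Im (ca * w 0 0) = - (cos q / sin (q - p) * Im (u w)).
    by apply: (mulfI (lt0r_neq0 sqp)); rewrite e'; field; rewrite gt_eqF.
  rewrite normrN normrM ger0_norm ?divr_ge0 ?(ltW cq0) ?(ltW sqp) //.
  apply: ler_pM; rewrite ?divr_ge0 ?(ltW cq0) ?(ltW sqp) ?Im_le_nc //.
  by rewrite /K lerDl.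
move=> r r0 z hz.
have [//|[uz hq0]] := kallin_square pu u0 (graph_plane0 planeA) (graph_plane0 planeB)
  (@cone_cvx_graph _ planeA) (@cone_cvx_graph _ planeB) ltr01 sA sB
  (fun z => iff_refl _) r0 hz.
(* Near the fibre [u = 0] this real linear form is small on the union, so [hull_linear] applies and
   places the point on the first plane. *)
have Ia : Im (ca * z 0 0) = 0.
  have e (w : 'cV[C]_2) : Re (- 'i * ca * w 0 0 + 0 * w 1 0) = Im (ca * w 0 0).
    by rewrite cReD !cReM !cImM /=; ring.
  rewrite -e; apply: (@hull_linear _ (setU2 (graph_plane planeA) (graph_plane planeB)) _ _ r) => //.
  move=> x x0; apply/poly_hullP => f M pf hf.
  apply: (hq0 f M (x / K)) => //; first by rewrite divr_gt0.
  move=> w Ew dw; rewrite ler_pdivlMr // mulrC => ux; apply: hf; split=> //; split=> //.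
  by rewrite e; apply: le_trans (lipu w Ew) ux.
left; apply/hA; split=> //; have := Imu z; rewrite uz Ia /= mulr0 sub0r => /esym/eqP.
by rewrite oppr_eq0 mulf_eq0 (gt_eqF sq0) => /eqP.
Qed.

End ThreePlanes.

(** * Complex double series *)

Section ComplexSequences.
Variable R : realType.
Local Notation C := R[i].
Local Notation nc := (@Normc.normc R).
Implicit Types (u v : nat -> C) (F : nat -> nat -> C).

Definition tends0 (a : nat -> R) :=
  forall e, 0 < e -> exists N0, forall N, (N0 <= N)%N -> a N <= e.

Definition tends u (x : C) := tends0 (fun N => nc (u N - x)).

Lemma tends0D a b : tends0 a -> tends0 b -> tends0 (fun N => a N + b N).
Proof.
move=> ha hb e e0; have e2 : 0 < e / 2 by lra.
have [N1 h1] := ha _ e2; have [N2 h2] := hb _ e2.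
exists (maxn N1 N2) => N; rewrite geq_max => /andP[/h1 x /h2 y]; lra.
Qed.

Lemma tends0Z (K : R) a : 0 <= K -> tends0 a -> tends0 (fun N => K * a N).
Proof.
move=> K0 ha e e0; have K1 : 0 < K + 1 by lra.
have [|N h] := ha (e / (K + 1)); first by rewrite divr_gt0.
exists N => M /h hM; apply: le_trans (ler_wpM2l K0 hM) _.
by rewrite mulrCA ler_piMr ?(ltW e0) // ler_pdivrMr // mul1r lerDl.
Qed.

Lemma tends0_le a b : (forall N, a N <= b N) -> tends0 b -> tends0 a.
Proof. by move=> ab hb e /hb [N h]; exists N => M /h; apply: le_trans. Qed.

Lemma tendsM u v x y (K : R) : (forall N, nc (u N) <= K) -> tends u x -> tends v y ->
  tends (fun N => u N * v N) (x * y).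
Proof.
move=> uK hu hv; have K0 : 0 <= K by apply: le_trans (uK 0%N); exact: nc_ge0.
apply: tends0_le (tends0D (tends0Z K0 hv) (tends0Z (nc_ge0 y) hu)) => N.
have -> : u N * v N - x * y = u N * (v N - y) + y * (u N - x) by ring.
by apply: le_trans (ncD _ _) _; rewrite !ncM lerD2r ler_wpM2r ?nc_ge0.
Qed.

Lemma tends_le u x (f : C -> R) (K : R) : (forall z w, f z <= f w + nc (z - w)) ->
  (forall N, (0 < N)%N -> f (u N) <= K) -> tends u x -> f x <= K.
Proof.
move=> hf uK ux; apply/ler_addgt0Pl => e e0; have [N h] := ux _ e0.
have := hf x (u N.+1); have := h N.+1 (leqW (leqnn _)); have := uK N.+1 isT.
rewrite ncBC; lra.
Qed.

Lemma real_cauchy (a : nat -> R) b : tends0 b ->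
  (forall m n, (m <= n)%N -> `|a n - a m| <= b m) ->
  exists x, tends0 (fun N => `|a N - x|).
Proof.
move=> hb ha; have cv : cvgn a.
  apply/cauchy_cvgP/cauchy_exP => e e0; have e2 : 0 < e / 2 by lra.
  have [N hN] := hb _ e2; exists (a N); exists N => // n /= hn.
  by have := ha _ _ hn; have := hN N (leqnn _); rewrite /ball /= distrC; lra.
exists (limn a) => e e0.
move/cvgrPdist_le : cv => /(_ _ e0) [N _ h].
by exists N => n hn; rewrite distrC; exact: h.
Qed.

Lemma complex_cauchy u b : tends0 b ->
  (forall m n, (m <= n)%N -> nc (u n - u m) <= b m) -> exists x, tends u x.
Proof.
move=> hb hu.
have [x hx] : exists x, tends0 (fun N => `|Re (u N) - x|).
  apply: real_cauchy hb _ => m n mn; apply: le_trans (hu _ _ mn).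
  by rewrite -cReN -cReD; exact: Re_le_nc.
have [y hy] : exists x, tends0 (fun N => `|Im (u N) - x|).
  apply: real_cauchy hb _ => m n mn; apply: le_trans (hu _ _ mn).
  by rewrite -cImN -cImD; exact: Im_le_nc.
exists (x +i* y)%C; apply: tends0_le (tends0D hx hy) => N.
by apply: le_trans (nc_le_ReIm _) _; rewrite cReD cImD cReN cImN.
Qed.

Lemma nc_sum n (F : nat -> C) : nc (\sum_(j < n) F j) <= \sum_(j < n) nc (F j).
Proof.
elim: n => [|n IH]; first by rewrite !big_ord0 nc0.
by rewrite !big_ord_recr /=; apply: le_trans (ncD _ _) _; rewrite lerD2r.
Qed.

Definition csqsum N F : C := \sum_(n < N) \sum_(k < N) F n k.

Lemma Re_csqsum N F : Re (csqsum N F) = sqsum N (fun n k => Re (F n k)).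
Proof.
rewrite /csqsum /sqsum (big_morph _ (@cReD R) (@cRe0 R)); apply: eq_bigr => n _.
by rewrite (big_morph _ (@cReD R) (@cRe0 R)).
Qed.

Lemma Im_csqsum N F : Im (csqsum N F) = sqsum N (fun n k => Im (F n k)).
Proof.
rewrite /csqsum /sqsum (big_morph _ (@cImD R) (@cIm0 R)); apply: eq_bigr => n _.
by rewrite (big_morph _ (@cImD R) (@cIm0 R)).
Qed.

Lemma csqsumZ N (c : C) F : csqsum N (fun n k => c * F n k) = c * csqsum N F.
Proof. by rewrite /csqsum mulr_sumr; apply: eq_bigr => n _; rewrite mulr_sumr. Qed.

Lemma csqsum_bound N F (a : nat -> nat -> R) : (forall n k, nc (F n k) <= a n k) ->
  nc (csqsum N F) <= sqsum N a.
Proof.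
move=> h; apply: le_trans (nc_sum _ (fun n => \sum_(k < N) F n k)) _.
apply: ler_sum => n _; apply: le_trans (nc_sum _ (F n)) _.
by apply: ler_sum => k _.
Qed.

Lemma csqsum_tail M N F (a : nat -> nat -> R) : (M <= N)%N ->
  (forall n k, nc (F n k) <= a n k) ->
  nc (csqsum N F - csqsum M F) <= 2 * (sqsum N a - sqsum M a).
Proof.
move=> MN h; apply: le_trans (nc_le_ReIm _) _.
rewrite cReD cImD cReN cImN !Re_csqsum !Im_csqsum mulr2n mulrDl mul1r.
apply: lerD; apply: sqsum_tail => // n k; apply: le_trans (h n k);
  [exact: Re_le_nc|exact: Im_le_nc].
Qed.

End ComplexSequences.

(** * Boundary values of the disc *)

Section Disc.
Variable R : realType.
Local Notation C := R[i].
Local Notation nc := (@Normc.normc R).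
Variables al l : R.
Hypothesis hal : 0 < al < 1.
Hypothesis hl : 1 / 2 < l < 1.

(* With [w = s + i t], [binser] and [Jser] are partial sums of [(1 - e^(2 w))^al] and of
   [e^(- al w)] times the sum of [kern l nu n k e^((2 n + nu) w)]. *)
Definition binser N s t : C := \sum_(m < N.+1) (bet al m)%:C * cexp (2 * m%:R) s t.

Lemma expR_le1 (a s : R) : 0 <= a -> s <= 0 -> expR (a * s) <= 1.
Proof. by move=> a0 s0; rewrite -[X in _ <= X](@expR0 R) ler_expR mulr_ge0_le0. Qed.

Lemma nc_binser_term (m : nat) s t : s <= 0 ->
  nc ((bet al m)%:C * cexp (2 * m%:R) s t) <= `|bet al m|.
Proof.
by move=> s0; rewrite ncM nc_real nc_cexp ler_piMr // expR_le1 // mulr_ge0.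
Qed.

Lemma binser_bound N s t : s <= 0 -> nc (binser N s t) <= 2.
Proof.
move=> s0; apply: le_trans (norm_bet_sum_le hal N.+1).
apply: le_trans (nc_sum _ (fun m => (bet al m)%:C * cexp (2 * m%:R) s t)) _.
by apply: ler_sum => m _; exact: nc_binser_term.
Qed.

Lemma binser_tail m n s t : s <= 0 -> (m <= n)%N ->
  nc (binser n s t - binser m s t) <= bet (al - 1) m.
Proof.
move=> s0 /subnK <-; move: (n - m)%N => k.
suff h : nc (binser (k + m) s t - binser m s t) <= bet (al - 1) m - bet (al - 1) (k + m).
  by apply: le_trans h _; rewrite lerBlDr lerDl; exact/ltW/bet_gt0/hlm1.
elim: k => [|k IH]; first by rewrite !subrr nc0.
have -> : binser (k.+1 + m) s t - binser m s t = (binser (k + m) s t - binser m s t) +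
    (bet al (k + m).+1)%:C * cexp (2 * (k + m).+1%:R) s t.
  by rewrite addSn /binser [in LHS]big_ord_recr addrAC.
apply: le_trans (ncD _ _) _; have := @nc_binser_term (k + m).+1 s t s0.
by rewrite ler0_norm ?betS_le0 // bet_diff addSn; lra.
Qed.

Lemma binser_near1 N s t : s <= 0 -> nc (binser N s t - 1) <= 2 * expR (2 * s).
Proof.
move=> s0; have -> : binser N s t - 1 =
    \sum_(m < N) (bet al m.+1)%:C * cexp (2 * m.+1%:R) s t.
  by rewrite /binser big_ord_recl /= mulr0 cexp0 mulr1 addrAC subrr add0r.
apply: le_trans (nc_sum _ (fun m => (bet al m.+1)%:C * cexp (2 * m.+1%:R) s t)) _.
apply: (@le_trans _ _ (\sum_(m < N) `|bet al m.+1| * expR (2 * s))).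
  apply: ler_sum => m _; rewrite ncM nc_real nc_cexp ler_wpM2l // ler_expR.
  rewrite -mulrA ler_pM2l // -subr_ge0 -natr1.
  have : m%:R * s <= 0 by rewrite mulr_ge0_le0.
  lra.
rewrite -mulr_suml ler_wpM2r ?expR_ge0 //.
by have := norm_bet_sum_le hal N.+1; rewrite big_ord_recl /=; have := normr_ge0 (1 : R); lra.
Qed.

Definition ei (x : R) : C := (cos x +i* sin x)%C.

Lemma eiD x y : ei (x + y) = ei x * ei y.
Proof. by apply: complex_ext; rewrite /ei ?cReM ?cImM /= ?cosD ?sinD; ring. Qed.

Lemma cexp_ei (a s t : R) : cexp a s t = (expR (a * s))%:C * ei (a * t).
Proof. by apply: complex_ext; rewrite ?cReM ?cImM /=; ring. Qed.

Lemma nc_ei x : nc (ei x) = 1.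
Proof. by have := nc_cexp x 0 1; rewrite cexp_ei mulr0 expR0 mul1r mulr1. Qed.

(** At [s = 0] the phase compensates the argument of [(1 - e^(2 i t))^al]; the sums of the binomial
    series reappear at the angle [2 t]. *)
Lemma binser_side N t : ei (al * pi / 2 - al * t) * binser N 0 t =
  (cosser al N (2 * t) +i* sinser al N (2 * t))%C.
Proof.
have e (m : nat) : ang al m (2 * t) = (al * pi / 2 - al * t) + 2 * m%:R * t.
  by rewrite /ang; field.
apply: complex_ext; rewrite /binser mulr_sumr.
  rewrite (big_morph _ (@cReD R) (@cRe0 R)); apply: eq_bigr => m _.
  rewrite cexp_ei mulr0 expR0 mul1r e mulrCA -eiD cReM /=; ring.
rewrite (big_morph _ (@cImD R) (@cIm0 R)); apply: eq_bigr => m _.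
rewrite cexp_ei mulr0 expR0 mul1r e mulrCA -eiD cImM /=; ring.
Qed.

(** For fixed [x] the limit is [0] by [sinser_bound], and the tail estimate does not depend on [x];
    at [x = 0], outside that bound, the sum is explicit. *)
Lemma sinser_le N (x : R) : 0 <= x <= pi -> `|sinser al N x| <= bet (al - 1) N.
Proof.
move=> /andP[]; have b0 n := bet_gt0 (hlm1 hal) n.
rewrite le_eqVlt => /orP[/eqP <- _|x0 xpi].
  have -> : sinser al N 0 = bet (al - 1) N * sin (al * pi / 2).
    rewrite -bet_sum mulr_suml; apply: eq_bigr => m _.
    by rewrite /ang mulr0 add0r.
  by rewrite normrM gtr0_norm // ler_piMr ?sin_max // ltW.
have p0 := pi_gt0 R.
pose s := sin (x / 2); have s0 : 0 < s by apply: sin_gt0_pi; lra.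
apply/ler_addgt0Pl => e e0.
have q0 : 0 < pi / s ^+ 2 by rewrite divr_gt0 // exprn_gt0.
have [M hM] := bet_cvg0 (hlm1 hal) (divr_gt0 e0 q0).
have h1 := sinser_tail hal x (leq_maxl N M).
have xx : 0 < x < pi *+ 2 by rewrite mulr2n; lra.
have h2 := sinser_bound hal (maxn N M) xx s0 (lexx _).
have h3 : pi * bet (al - 1) (maxn N M) / s ^+ 2 <= e.
  rewrite mulrAC -ler_pdivlMl //; apply: le_trans (hM _ (leq_maxr _ _)) _.
  by rewrite mulrC.
have := ler_normB (sinser al (maxn N M) x) (sinser al (maxn N M) x - sinser al N x).
rewrite opprB addrC subrK; lra.
Qed.

Lemma cosser_le N (x : R) : `|cosser al N x| <= 2.
Proof.
apply: le_trans (norm_bet_sum_le hal N.+1); apply: le_trans (ler_norm_sum _ _ _) _.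
by apply: ler_sum => j _; rewrite normrM ler_piMr ?cos_max.
Qed.

(** Serves the corner [t = 0], where [sinJ_diff_uniform] does not reach [pi - t = pi] and the factor
    [cosser] has to be small instead. *)
Lemma cosser0_le N : `|cosser al N 0| <= bet (al - 1) N.
Proof.
have -> : cosser al N 0 = bet (al - 1) N * cos (al * pi / 2).
  rewrite -bet_sum mulr_suml; apply: eq_bigr => m _.
  by rewrite /ang mulr0 add0r.
have b0 := bet_gt0 (hlm1 hal) N.
by rewrite normrM gtr0_norm // ler_piMr ?cos_max // ltW.
Qed.

Lemma cos_nat2pi n (x : R) : cos (n%:R * (pi *+ 2) - x) = cos x.
Proof.
elim: n => [|n IH]; first by rewrite mul0r sub0r cosN.
by rewrite -natr1 mulrDl mul1r addrAC cosD2pi.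
Qed.

Section Coordinate.
Variable nu : R.
Hypothesis hnu : al < nu <= 1.

Lemma nu01 : 0 < nu <= 1.
Proof. by move: hal hnu => ? ?; apply/andP; split; lra. Qed.

Definition Jser N s t : C :=
  csqsum N (fun n k => (kern l nu n k)%:C * cexp (2 * n%:R + nu - al) s t).

Local Notation K := (kern_bound l nu).

Lemma K_ge0 : 0 <= K.
Proof. by apply: le_trans (kern_sum_le hl nu01 0); rewrite /sqsum big_ord0. Qed.

Lemma nc_Jser_term n k s t : s <= 0 ->
  nc ((kern l nu n k)%:C * cexp (2 * n%:R + nu - al) s t) <= expR ((nu - al) * s) * kern l nu n k.
Proof.
move=> s0; rewrite ncM nc_real nc_cexp ger0_norm ?(kern_ge0 hl nu01) // mulrC.
rewrite ler_wpM2r ?(kern_ge0 hl nu01) // ler_expR.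
have : n%:R * s <= 0 by rewrite mulr_ge0_le0.
lra.
Qed.

Lemma Jser_bound N s t : s <= 0 -> nc (Jser N s t) <= K * expR ((nu - al) * s).
Proof.
move=> s0; apply: le_trans (csqsum_bound _ (fun n k => nc_Jser_term n k t s0)) _.
by rewrite sqsumZ mulrC ler_wpM2r ?expR_ge0 // (kern_sum_le hl nu01).
Qed.

Lemma kern_tail : exists2 b, tends0 b & forall m n, (m <= n)%N ->
  sqsum n (kern l nu) - sqsum m (kern l nu) <= b m.
Proof.
have [L hL Lc] := mono_sup (fun m n => @sqsum_mono _ (kern l nu) m n (kern_ge0 hl nu01))
  (kern_sum_le hl nu01).
exists (fun m => L - sqsum m (kern l nu)) => // m n mn.
by have := hL n; lra.
Qed.

Lemma coord_cvg s t : s <= 0 -> exists x, tends (fun N => binser N s t * Jser N s t) x.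
Proof.
move=> s0.
have [x hx] : exists x, tends (fun N => binser N s t) x.
  apply: (@complex_cauchy _ _ (bet (al - 1))); first exact: (bet_cvg0 (hlm1 hal)).
  by move=> m n; exact: binser_tail.
have [b b0 hb] := kern_tail.
have [y hy] : exists y, tends (fun N => Jser N s t) y.
  apply: (@complex_cauchy _ _ (fun m => 2 * b m)); first exact: tends0Z.
  move=> m n mn; apply: le_trans (csqsum_tail mn (fun n k => nc_Jser_term n k t s0)) _.
  rewrite ler_pM2l // !sqsumZ -mulrBr.
  have e1 : expR ((nu - al) * s) <= 1.
    by move: hnu => /andP[? _]; apply: expR_le1 => //; lra.
  apply: le_trans (hb _ _ mn); apply: ler_piMl => //.
  by rewrite subr_ge0; apply: sqsum_mono => //; exact: (kern_ge0 hl nu01).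
by exists (x * y); apply: tendsM (fun N => binser_bound N t s0) hx hy.
Qed.

Lemma is_esum_coord N : is_esum (fun s t => binser N s t * Jser N s t).
Proof.
apply: is_esumM.
  by apply: (@is_esum_sum _ N.+1 (fun m s t => (bet al m)%:C * cexp (2 * m%:R) s t)) => m;
     exact: is_esum_cexp.
apply: (@is_esum_sum _ N (fun n s t => \sum_(k < N)
  (kern l nu n k)%:C * cexp (2 * n%:R + nu - al) s t)) => n.
apply: (@is_esum_sum _ N (fun k s t => (kern l nu n k)%:C * cexp (2 * n%:R + nu - al) s t)) => k.
exact: is_esum_cexp.
Qed.

Lemma coord_bound N s t : s <= 0 ->
  nc (binser N s t * Jser N s t) <= 2 * K * expR ((nu - al) * s).
Proof.
move=> s0; rewrite ncM -mulrA; apply: ler_pM; rewrite ?nc_ge0 ?binser_bound //.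
exact: Jser_bound.
Qed.

Lemma Im_binser (a : R) N s t : (forall m : nat, sin (2 * m%:R * t) = 0) -> Im (binser N s t) = 0.
Proof.
move=> h; rewrite /binser (big_morph _ (@cImD R) (@cIm0 R)) big1 // => m _.
by rewrite cImM /= h; ring.
Qed.

(** On these lines [binser] is real and every exponential of [Jser] has argument [(nu - al) t]
    modulo [pi]. *)
Lemma coord_line N s t : (forall m : nat, sin (2 * m%:R * t) = 0) ->
  let z := binser N s t * Jser N s t in
  sin ((nu - al) * t) * Re z = cos ((nu - al) * t) * Im z.
Proof.
move=> h z; rewrite /z cReM cImM (Im_binser 0) // !mul0r addr0 subr0.
have e : sin ((nu - al) * t) * Re (Jser N s t) = cos ((nu - al) * t) * Im (Jser N s t).
  rewrite Re_csqsum Im_csqsum -!sqsumZ; apply: eq_sqsum => n k.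
  rewrite cReM cImM /=.
  have -> : (2 * n%:R + nu - al) * t = 2 * n%:R * t + (nu - al) * t by ring.
  by have := h n; move: (2 * n%:R * t) ((nu - al) * t) => x y hx; rewrite sinD cosD hx; ring.
by rewrite mulrCA e; ring.
Qed.

Lemma Jser_side N t : ei (al * t) * Jser N 0 t = (cosJ l nu N t +i* sinJ l nu N t)%C.
Proof.
apply: complex_ext; rewrite /Jser -csqsumZ ?Re_csqsum ?Im_csqsum; apply: eq_sqsum => n k;
  rewrite cexp_ei mulr0 expR0 mul1r mulrCA -eiD ?cReM ?cImM /=;
  have -> : al * t + (2 * n%:R + nu - al) * t = (2 * n%:R + nu) * t by ring.
  ring.
ring.
Qed.

Lemma coord_side N t : Im (ei (al * pi / 2) * (binser N 0 t * Jser N 0 t)) =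
  cosser al N (2 * t) * sinJ l nu N t + sinser al N (2 * t) * cosJ l nu N t.
Proof.
have -> : al * pi / 2 = (al * pi / 2 - al * t) + al * t by ring.
rewrite eiD mulrACA binser_side Jser_side cImM /=; ring.
Qed.

(** The factor [e^(- i pi nu)] turns each term of the series at [t] into the conjugate of its value
    at [pi - t], whence a second equation from the same equality of imaginary parts. *)
Lemma coord_side' N t : Im (ei (al * pi / 2 - pi * nu) * (binser N 0 t * Jser N 0 t)) =
  - (cosser al N (2 * t) * sinJ l nu N (pi - t)) + sinser al N (2 * t) * cosJ l nu N (pi - t).
Proof.
have -> : al * pi / 2 - pi * nu = (al * pi / 2 - al * t) + (- (pi * nu) + al * t) by ring.
rewrite eiD mulrACA binser_side eiD -mulrA Jser_side.
have -> : ei (- (pi * nu)) * (cosJ l nu N t +i* sinJ l nu N t)%C =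
    (cosJ l nu N (pi - t) -i* sinJ l nu N (pi - t))%C.
  have e (n : nat) : (2 * n%:R + nu) * (pi - t) =
    n%:R * (pi *+ 2) - ((2 * n%:R + nu) * t - pi * nu) by rewrite mulr2n; ring.
  rewrite /ei cosN sinN; apply: complex_ext; rewrite ?cReM ?cImM /= /cosJ /sinJ.
    rewrite -!sqsumZ -sqsumB; apply: eq_sqsum => n k; rewrite e cos_nat2pi.
    by move: ((2 * n%:R + nu) * t) => y; rewrite cosB; ring.
  rewrite -[RHS]mulN1r -!sqsumZ -sqsumD; apply: eq_sqsum => n k; rewrite e sin_nat2pi.
  by move: ((2 * n%:R + nu) * t) => y; rewrite sinB; ring.
rewrite cImM /=; ring.
Qed.

Lemma cosJ_le N (t : R) : `|cosJ l nu N t| <= K.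
Proof.
apply: le_trans (ler_norm_sqsum _ _) (le_trans _ (kern_sum_le hl nu01 N)).
apply: ler_sqsum => n k; rewrite normrM ger0_norm ?(kern_ge0 hl nu01) //.
by rewrite ler_piMr ?cos_max ?(kern_ge0 hl nu01).
Qed.

Lemma sinJ_le N (t : R) : `|sinJ l nu N t| <= K.
Proof.
apply: le_trans (ler_norm_sqsum _ _) (le_trans _ (kern_sum_le hl nu01 N)).
apply: ler_sqsum => n k; rewrite normrM ger0_norm ?(kern_ge0 hl nu01) //.
by rewrite ler_piMr ?sin_max ?(kern_ge0 hl nu01).
Qed.

(** Far to the left the coordinate is close to [g e^((nu - al) w)], where [g] collects the kernel
    entries with [n = 0]. It is at least [1 / nu], the entry at [k = 0], so the argument of the
    coordinate is under control. *)
Lemma coord_angle N s t b : s <= 0 -> (0 < N)%N ->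
  expR ((nu - al) * s) * (`|sin ((nu - al) * t + b)| / nu - 3 * K * expR (2 * s)) <=
  `|Im (ei b * (binser N s t * Jser N s t))|.
Proof.
move=> s0 N0; have k0 n k := kern_ge0 hl nu01 n k; have [n0 n1] := andP nu01.
pose F (n k : nat) := (kern l nu n k)%:C * cexp (2 * n%:R) s t.
pose G (n k : nat) := if n == 0%N then kern l nu n k else 0.
have eJ : Jser N s t = cexp (nu - al) s t * csqsum N F.
  rewrite -csqsumZ /Jser /csqsum; apply: eq_bigr => n _; apply: eq_bigr => k _.
  have -> : 2 * (n : nat)%:R + nu - al = (nu - al) + 2 * (n : nat)%:R by ring.
  by rewrite cexpD /F mulrCA.
have hF : nc (csqsum N F) <= K.
  apply: le_trans (_ : sqsum N (kern l nu) <= _); last exact: (kern_sum_le hl nu01).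
  apply: csqsum_bound => n k; rewrite /F ncM nc_real nc_cexp ger0_norm // ler_piMr //.
  by rewrite expR_le1 // mulr_ge0.
pose g := sqsum N G.
have hg : nu^-1 <= g.
  have -> : nu^-1 = sqsum 1 G.
    by rewrite /sqsum !big_ord_recl !big_ord0 /G /kern /= !addr0 !mulr1 add0r mul1r.
  by apply: sqsum_mono => // n k; rewrite /G; case: ifP.
have hFg : nc (csqsum N F - g%:C) <= K * expR (2 * s).
  have -> : csqsum N F - g%:C = csqsum N (fun n k => F n k - (G n k)%:C).
    apply: complex_ext; rewrite ?cReD ?cReN ?cImD ?cImN !(Re_csqsum, Im_csqsum).
      rewrite cReC /g -sqsumB; apply: eq_sqsum => n k.
      by rewrite cReD cReN.
    rewrite cImC subr0; apply: eq_sqsum => n k.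
    by rewrite cImD cImN cImC subr0.
  apply: (@le_trans _ _ (sqsum N (fun n k => expR (2 * s) * kern l nu n k))).
    apply: csqsum_bound => n k; rewrite /F; case: n => [|n].
      rewrite (_ : G _ _ = kern l nu 0 k) //.
      have -> : 2 * 0%:R = 0 :> R by rewrite mulr0.
      by rewrite cexp0 mulr1 subrr nc0 mulr_ge0 ?expR_ge0.
    rewrite (_ : G _ _ = 0) // subr0 ncM nc_real nc_cexp ger0_norm // mulrC ler_wpM2r // ler_expR.
    rewrite -mulrA ler_pM2l // -subr_ge0 -natr1.
    have : n%:R * s <= 0 by rewrite mulr_ge0_le0.
    lra.
  by rewrite sqsumZ mulrC ler_wpM2r ?expR_ge0 // (kern_sum_le hl nu01).
pose E := binser N s t * csqsum N F - g%:C.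
have hE : nc E <= 3 * K * expR (2 * s).
  have -> : E = (binser N s t - 1) * csqsum N F + (csqsum N F - g%:C) by rewrite /E; ring.
  apply: le_trans (ncD _ _) _; rewrite ncM.
  have : nc (binser N s t - 1) * nc (csqsum N F) <= 2 * expR (2 * s) * K.
    by apply: ler_pM; rewrite ?nc_ge0 ?binser_near1.
  move: hFg; lra.
have -> : ei b * (binser N s t * Jser N s t) =
  (expR ((nu - al) * s))%:C * (ei ((nu - al) * t + b) * (g%:C + E)).
  by rewrite eJ /E cexp_ei eiD; ring.
clearbody E; rewrite cImM /= mul0r addr0 normrM ger0_norm ?expR_ge0 //.
rewrite ler_wpM2l ?expR_ge0 // mulrDr cImD.
move: ((nu - al) * t + b) => y.
have -> : Im (ei y * g%:C) = sin y * g by rewrite cImM /=; ring.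
have h1 : `|Im (ei y * E)| <= 3 * K * expR (2 * s).
  by apply: le_trans (Im_le_nc _) _; rewrite ncM nc_ei mul1r.
have h2 : `|sin y| / nu <= `|sin y * g|.
  rewrite normrM ler_wpM2l // (le_trans hg) // ler_norm //.
have := ler_normB (sin y * g + Im (ei y * E)) (Im (ei y * E)).
rewrite addrK; lra.
Qed.

End Coordinate.
End Disc.

(** * Polynomial hull of the boundary of the disc *)

Section NotConvex.
Variable R : realType.
Local Notation C := R[i].
Local Notation nc := (@Normc.normc R).

(** The maximum principle is applied to [P (f N, g N)] on a rectangle whose left side depends on the
    accuracy [e]; the Lipschitz bound of [P] replaces boundary values by values on [E]. *)
Lemma disc_hull (E : cset R) (f g : nat -> R -> R -> C) (x y : C) (B h s0 t0 : R) :
  0 <= B -> s0 <= 0 -> 0 <= t0 <= h ->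
  (forall N, is_esum (f N)) -> (forall N, is_esum (g N)) ->
  (forall N s t, s <= 0 -> nc (f N s t) <= B /\ nc (g N s t) <= B) ->
  tends (fun N => f N s0 t0) x -> tends (fun N => g N s0 t0) y ->
  (forall e, 0 < e -> exists2 L, L <= s0 & exists N0, forall N s t, (N0 <= N)%N ->
     L <= s <= 0 -> 0 <= t <= h -> [|| s == L, s == 0, t == 0 | t == h] ->
     exists w, [/\ E w, nc (f N s t - w 0 0) <= e & nc (g N s t - w 1 0) <= e]) ->
  exists2 r, 0 <= r & poly_hull (fun w => E w /\ disk r w) (mk2 x y).
Proof.
move=> B0 s00 ht0 ef eg bfg fx gy hb.
pose r := (B + 1) + (B + 1); have r0 : 0 <= r by rewrite /r; lra.
have indisk (u v : C) : nc u <= B + 1 -> nc v <= B + 1 -> disk r (mk2 u v).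
  by move=> hu hv; apply: sqn_bound; rewrite ?mk2_0 ?mk2_1.
exists r => //; apply/poly_hullP => P M pP hP.
have [L L0 hL] := polyfun_lip pP r0.
apply/ler_addgt0Pl => e e0.
pose e1 := Num.min 1 (e / (4 * (L + 1))).
have L1 : 0 < 4 * (L + 1) by lra.
have e10 : 0 < e1 by rewrite lt_min ltr01 divr_gt0.
have e11 : e1 <= 1 by rewrite ge_min lexx.
have Le : 4 * (L * e1) <= e.
  apply: (@le_trans _ _ (4 * (L + 1) * e1)); first by lra.
  by rewrite mulrC -ler_pdivlMr // ge_min lexx orbT.
have [a as0 [N0 hN0]] := hb _ e10.
have [N1 hN1] := fx _ e10; have [N2 hN2] := gy _ e10.
pose N := maxn N0 (maxn N1 N2).
have g0 : (N0 <= N)%N by rewrite leq_max leqnn.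
have g1 : (N1 <= N)%N by rewrite !leq_max leqnn orbT.
have g2 : (N2 <= N)%N by rewrite !leq_max leqnn !orbT.
have bound : nc (P (mk2 (f N s0 t0) (g N s0 t0))) <= M + 2 * (L * e1).
  apply: (@esum_max _ (fun s t => P (mk2 (f N s t) (g N s t))) a 0 h) => //.
  - exact: is_esum_polyfun.
  - by rewrite as0.
  move=> s t hs ht hst; have [w [Ew w0 w1]] := hN0 N s t g0 hs ht hst.
  have [|bf bg] := bfg N s t; first by case/andP: hs.
  have nw0 : nc (w 0 0) <= B + 1.
    have -> : w 0 0 = f N s t - (f N s t - w 0 0) by ring.
    by apply: le_trans (ncB _ _) _; lra.
  have nw1 : nc (w 1 0) <= B + 1.
    have -> : w 1 0 = g N s t - (g N s t - w 1 0) by ring.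
    by apply: le_trans (ncB _ _) _; lra.
  have dw : disk r w by apply: sqn_bound.
  have := hL (mk2 (f N s t) (g N s t)) w; rewrite mk2_0 mk2_1 => hh.
  have bf1 : nc (f N s t) <= B + 1 by lra.
  have bg1 : nc (g N s t) <= B + 1 by lra.
  have := hh (indisk _ _ bf1 bg1) dw.
  have := hP w (Logic.conj Ew dw).
  have := ncD (P (mk2 (f N s t) (g N s t)) - P w) (P w); rewrite subrK.
  have : L * (nc (f N s t - w 0 0) + nc (g N s t - w 1 0)) <= L * (e1 + e1).
    by rewrite ler_wpM2l // lerD.
  lra.
have [bf bg] := bfg N s0 t0 s00.
have xb : nc x <= B + 1.
  have -> : x = f N s0 t0 - (f N s0 t0 - x) by ring.
  by apply: le_trans (ncB _ _) _; have := hN1 _ g1; lra.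
have yb : nc y <= B + 1.
  have -> : y = g N s0 t0 - (g N s0 t0 - y) by ring.
  by apply: le_trans (ncB _ _) _; have := hN2 _ g2; lra.
have bf1 : nc (f N s0 t0) <= B + 1 by lra.
have bg1 : nc (g N s0 t0) <= B + 1 by lra.
have := hL _ _ (indisk _ _ xb yb) (indisk _ _ bf1 bg1).
rewrite !mk2_0 !mk2_1 [nc (x - _)]ncBC [nc (y - _)]ncBC.
have : L * (nc (f N s0 t0 - x) + nc (g N s0 t0 - y)) <= L * (e1 + e1).
  by rewrite ler_wpM2l // lerD // ?hN1 ?hN2.
have := ncD (P (mk2 x y) - P (mk2 (f N s0 t0) (g N s0 t0))) (P (mk2 (f N s0 t0) (g N s0 t0))).
rewrite subrK; lra.
Qed.

Variables al nu nu' l : R.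
Hypothesis hal : 0 < al.
Hypothesis haln : al < nu.
Hypothesis hnn : nu < nu'.
Hypothesis hsum : nu + nu' = 2 * (1 - l).
Hypothesis hl : 1 / 2 < l < 1.
Hypothesis hn2 : 2 * nu' - al < 1.

Ltac pars := move: hal haln hnn hsum hl hn2 (pi_gt0 R) => ? ? ? ? ? ? ?.

Local Notation d := (al * pi / 2).
Local Notation p := (nu * pi / 2).
Local Notation q := (nu' * pi / 2).

Lemma al_range : 0 < al < 1. Proof. by pars; lra. Qed.
Lemma nu_range : al < nu <= 1. Proof. by pars; lra. Qed.
Lemma nu'_range : al < nu' <= 1. Proof. by pars; lra. Qed.

Lemma ang_d : 0 < d. Proof. by pars; rewrite divr_gt0 // mulr_gt0. Qed.
Lemma ang_dp : d < p. Proof. by pars; rewrite ltr_pM2r ?invr_gt0 // ltr_pM2r. Qed.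
Lemma ang_pq : p < q. Proof. by pars; rewrite ltr_pM2r ?invr_gt0 // ltr_pM2r. Qed.
Lemma ang_q : 2 * q - d < pi / 2.
Proof.
pars; have -> : 2 * q - d = (2 * nu' - al) * (pi / 2) by field.
by rewrite gtr_pMl // divr_gt0.
Qed.
Lemma ang_s : p + q < pi / 2.
Proof.
pars; have -> : p + q = (nu + nu') * (pi / 2) by field.
by rewrite gtr_pMl ?divr_gt0 //; lra.
Qed.

Local Notation K := (kern_bound l nu + kern_bound l nu').
Local Notation f1 N s t := (binser al N s t * Jser al l nu N s t).
Local Notation f2 N s t := (binser al N s t * Jser al l nu' N s t).
Local Notation pA := (planeA p q d).
Local Notation pB := (planeB p q d).

Lemma kern_bound_nu_ge0 : 0 <= kern_bound l nu. Proof. exact: K_ge0 al_range hl _ nu_range. Qed.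
Lemma kern_bound_nu'_ge0 : 0 <= kern_bound l nu'. Proof. exact: K_ge0 al_range hl _ nu'_range. Qed.

(** Each form splits into [cosser] times a difference of sine sums and [sinser] times a difference
    of cosine sums. The first difference and [sinser] are uniformly small; at the corner [t = 0] it
    is [cosser] that is small in the second form. *)
Lemma side_bound : exists2 r : nat -> R, tends0 r & forall N t, 0 <= t <= pi / 2 ->
  `|planeB_form1 d (mk2 (f1 N 0 t) (f2 N 0 t))| <= r N /\
  `|planeB_form2 p q d (mk2 (f1 N 0 t) (f2 N 0 t))| <= r N.
Proof.
have n1 : 0 < nu <= 1 by pars; lra.
have n2 : 0 < nu' <= 1 by pars; lra.
have [r r0 hr] := sinJ_diff_uniform hl n1 n2 hsum.
have k1 := kern_bound_nu_ge0; have k2 := kern_bound_nu'_ge0.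
exists (fun N => 2 * r N + 2 * K * bet (al - 1) N).
  apply: tends0D; apply: tends0Z => //; first by lra.
  exact: (bet_cvg0 (hlm1 al_range)).
move=> N t /andP[t0 t1]; have p0 := pi_gt0 R.
have b0 := bet_gt0 (hlm1 al_range) N.
have rN0 : 0 <= r N by apply: le_trans (hr N 0 _); rewrite ?normr_ge0 // lexx pi_gt0.
have cs (x : R) : `|cosJ l nu N x - cosJ l nu' N x| <= K.
  apply: le_trans (ler_normB _ _) _.
  by apply: lerD; [exact: cosJ_le al_range hl _ nu_range _ _|exact: cosJ_le al_range hl _ nu'_range _ _].
have ss (x : R) : `|sinJ l nu N x - sinJ l nu' N x| <= K.
  apply: le_trans (ler_normB _ _) _.
  by apply: lerD; [exact: sinJ_le al_range hl _ nu_range _ _|exact: sinJ_le al_range hl _ nu'_range _ _].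
have sn : `|sinser al N (2 * t)| <= bet (al - 1) N by apply: (sinser_le al_range); lra.
have cn := cosser_le al_range N (2 * t).
have est (a b : R) : `|a| <= 2 -> `|a| * `|b| <= 2 * r N + K * bet (al - 1) N ->
    forall x, `|a * b + sinser al N (2 * t) * (cosJ l nu N x - cosJ l nu' N x)| <=
      2 * r N + 2 * K * bet (al - 1) N.
  move=> _ hab x; apply: le_trans (ler_normD _ _) _; rewrite !normrM.
  have : `|sinser al N (2 * t)| * `|cosJ l nu N x - cosJ l nu' N x| <= bet (al - 1) N * K.
    exact: ler_pM.
  lra.
split.
  have -> : planeB_form1 d (mk2 (f1 N 0 t) (f2 N 0 t)) =
      Im (ei d * f1 N 0 t) - Im (ei d * f2 N 0 t).
    by rewrite /planeB_form1 mk2_0 mk2_1 2!(cImM (ei d)) /=; ring.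
  rewrite !coord_side.
  have := @est (cosser al N (2 * t)) (sinJ l nu N t - sinJ l nu' N t) cn _ t.
  set u := sinser _ _ _; set v := cosser _ _ _ => h.
  have -> : v * sinJ l nu N t + u * cosJ l nu N t - (v * sinJ l nu' N t + u * cosJ l nu' N t) =
    v * (sinJ l nu N t - sinJ l nu' N t) + u * (cosJ l nu N t - cosJ l nu' N t) by ring.
  apply: h; apply: (@le_trans _ _ (2 * r N)); last by have := mulr_ge0 (addr_ge0 k1 k2) (ltW b0); lra.
  by apply: ler_pM => //; apply: hr; lra.
have -> : planeB_form2 p q d (mk2 (f1 N 0 t) (f2 N 0 t)) =
    Im (ei (d - pi * nu) * f1 N 0 t) - Im (ei (d - pi * nu') * f2 N 0 t).
  have -> : d - pi * nu = - (2 * p - d) by field.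
  have -> : d - pi * nu' = - (2 * q - d) by field.
  by rewrite /planeB_form2 mk2_0 mk2_1 (cImM (ei _)) (cImM (ei (- (2 * q - d)))) /ei !cosN !sinN /=; ring.
rewrite !coord_side'.
have := @est (- cosser al N (2 * t)) (sinJ l nu N (pi - t) - sinJ l nu' N (pi - t)) _ _ (pi - t).
set u := sinser _ _ _; set v := cosser _ _ _ => h.
have -> : - (v * sinJ l nu N (pi - t)) + u * cosJ l nu N (pi - t) -
    (- (v * sinJ l nu' N (pi - t)) + u * cosJ l nu' N (pi - t)) =
  - v * (sinJ l nu N (pi - t) - sinJ l nu' N (pi - t)) +
    u * (cosJ l nu N (pi - t) - cosJ l nu' N (pi - t)) by ring.
apply: h; rewrite normrN //.
have kb := mulr_ge0 (addr_ge0 k1 k2) (ltW b0).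
move: t0; rewrite le_eqVlt => /orP[/eqP t0|t0].
  apply: (@le_trans _ _ (bet (al - 1) N * K)); last by lra.
  by apply: ler_pM; rewrite ?normr_ge0 ?ss // /v -t0 mulr0; exact: cosser0_le al_range _.
apply: (@le_trans _ _ (2 * r N)); last by lra.
by apply: ler_pM => //; apply: hr; lra.
Qed.

Lemma coord_bound_max N s t : s <= 0 ->
  nc (f1 N s t) <= 2 * K * expR ((nu - al) * s) /\
  nc (f2 N s t) <= 2 * K * expR ((nu - al) * s).
Proof.
move=> s0; have k1 := kern_bound_nu_ge0; have k2 := kern_bound_nu'_ge0; split.
  apply: le_trans (coord_bound al_range hl nu_range N t s0) _.
  by rewrite ler_wpM2r ?expR_ge0 //; lra.
apply: le_trans (coord_bound al_range hl nu'_range N t s0) _.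
apply: ler_pM; [lra|exact: expR_ge0|lra|].
by rewrite ler_expR; apply: ler_wnM2r => //; pars; lra.
Qed.

Lemma expR_small (a e : R) : 0 < a -> 0 < e -> expR (a * (ln e / a)) = e.
Proof. by move=> a0 e0; rewrite mulrC divfK ?gt_eqF // lnK. Qed.

(** The lower and upper sides lie exactly in [R^2] and in the first graph, the left side is close to
    the origin, and the right side is close to the second graph by [side_bound]. *)
Lemma boundary_near (s0 e : R) : s0 <= 0 -> 0 < e -> exists2 L, L <= s0 & exists N0, forall N s t,
  (N0 <= N)%N -> L <= s <= 0 -> 0 <= t <= pi / 2 -> [|| s == L, s == 0, t == 0 | t == pi / 2] ->
  exists w, [/\ setU3 (@R2 R) (graph_plane pA) (graph_plane pB) w,
    nc (f1 N s t - w 0 0) <= e & nc (f2 N s t - w 1 0) <= e].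
Proof.
move=> s00 e0; have k1 := kern_bound_nu_ge0; have k2 := kern_bound_nu'_ge0.
have n0 : 0 < nu - al by pars; lra.
have t12 := sin12_lt ang_d ang_dp ang_pq ang_q ang_s.
have d0 := sin_d_gt0 ang_d ang_dp ang_pq ang_q ang_s.
pose e1 := e / (2 * K + 1).
have e10 : 0 < e1 by rewrite divr_gt0 //; lra.
exists (Num.min s0 (ln e1 / (nu - al))); first by rewrite ge_min lexx.
have hL : 2 * K * expR ((nu - al) * Num.min s0 (ln e1 / (nu - al))) <= e.
  apply: (@le_trans _ _ (2 * K * e1)).
    apply: ler_wpM2l; first by lra.
    by rewrite -(expR_small n0 e10) ler_expR ler_pM2l // ge_min expR_small // lexx orbT.
  rewrite /e1 mulrCA ler_piMr ?(ltW e0) // ler_pdivrMr; lra.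
have [r r0 hr] := side_bound.
pose Q := (1 + (sin d)^-1) / (sin (2 * q - d) - sin (2 * p - d)).
have Q0 : 0 < Q.
  apply: divr_gt0; last by rewrite subr_gt0.
  by apply: addr_gt0 => //; rewrite invr_gt0.
have [N0 hN0] := r0 _ (divr_gt0 e0 Q0).
exists N0 => N s t NN /andP[_ sle0] ht /or4P[/eqP es|/eqP es|/eqP et|/eqP et].
- have [b1 b2] := coord_bound_max N t sle0; rewrite es in b1 b2 *.
  by exists 0; split; [left; exact: R2_0| |]; rewrite mxE subr0;
    [exact: le_trans b1 hL|exact: le_trans b2 hL].
- subst s; have [q1 q2] := hr N t ht.
  set z := mk2 _ _ in q1 q2.
  have [h0 h1] := planeB_res ang_d ang_dp ang_pq ang_q ang_s z.
  set B0 := pB 0 0 * _ + _ in h0; set B1 := pB 1 0 * _ + _ in h1.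
  (* The point of the graph with the same imaginary parts as [z]; its distance to [z] is read off
     from [planeB_res]. *)
  pose w := mk2 (B0 +i* Im (z 0 0))%C (B1 +i* Im (z 1 0))%C.
  exists w.
  have est (S : R) : 0 < S <= 1 -> `|(planeB_form2 p q d z + S * planeB_form1 d z / sin d) /
      (sin (2 * q - d) - sin (2 * p - d))| <= e.
    move=> /andP[S0 S1]; have t0 : 0 < sin (2 * q - d) - sin (2 * p - d) by rewrite subr_gt0.
    apply: (@le_trans _ _ (Q * r N)); last first.
      by rewrite mulrC -ler_pdivlMr //; exact: hN0.
    rewrite normrM normfV (gtr0_norm t0) /Q [X in _ <= X]mulrAC ler_wpM2r ?invr_ge0 ?(ltW t0) //.
    apply: le_trans (ler_normD _ _) _; rewrite mulrDl mul1r; apply: lerD => //.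
    rewrite !normrM normfV (gtr0_norm d0) (gtr0_norm S0) mulrC ler_wpM2l ?invr_ge0 ?(ltW d0) //.
    by apply: le_trans q1; rewrite ler_piMl.
  have Sb (x : R) : 0 < sin x -> 0 < sin x <= 1 by move=> ->; rewrite sin_le1.
  split.
  + right; right; apply/graph_planeP; rewrite mk2_0 mk2_1 /=; split=> //.
  + have -> : f1 N 0 t - mk2 (B0 +i* Im (z 0 0))%C (B1 +i* Im (z 1 0))%C 0 0 = (Re (z 0 0) - B0)%:C.
      by apply: complex_ext; rewrite ?cReD ?cReN ?cImD ?cImN !mk2_0 /= ?subrr.
    rewrite nc_real h0; apply: est; apply: Sb.
    exact: lt_trans (sin1_gt0 ang_d ang_dp ang_pq ang_q ang_s) t12.
  + have -> : f2 N 0 t - mk2 (B0 +i* Im (z 0 0))%C (B1 +i* Im (z 1 0))%C 1 0 = (Re (z 1 0) - B1)%:C.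
      by apply: complex_ext; rewrite ?cReD ?cReN ?cImD ?cImN !mk2_1 /= ?subrr.
    rewrite nc_real h1; apply: est; apply: Sb; exact: sin1_gt0 ang_d ang_dp ang_pq ang_q ang_s.
- exists (mk2 (f1 N s t) (f2 N s t)); split; rewrite ?mk2_0 ?mk2_1 ?subrr ?nc0 ?(ltW e0) //.
  have h0 (m : nat) : sin (2 * m%:R * t) = 0 by rewrite et mulr0 sin0.
  left; apply/R2P; rewrite mk2_0 mk2_1.
  have := coord_line al l nu N s h0; have := coord_line al l nu' N s h0.
  by rewrite /= et !mulr0 !sin0 !cos0 !mul0r !mul1r.
- exists (mk2 (f1 N s t) (f2 N s t)); split; rewrite ?mk2_0 ?mk2_1 ?subrr ?nc0 ?(ltW e0) //.
  have h0 (m : nat) : sin (2 * m%:R * t) = 0.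
    have -> : 2 * m%:R * t = m%:R * pi by rewrite et; field.
    exact: sin_natpi.
  right; left; apply/(planeAP ang_d ang_dp ang_pq ang_q ang_s); rewrite mk2_0 mk2_1.
  have := coord_line al l nu N s h0; have := coord_line al l nu' N s h0.
  have -> : p - d = (nu - al) * t by rewrite et; field.
  by have -> : q - d = (nu' - al) * t by rewrite et; field.
Qed.

(** The point is taken over [t0 = pi / 4], midway between the horizontal sides, and far to the left.
    The argument of its first coordinate is close to [om], which excludes [R^2] and the first graph.
    Its second coordinate is negligible, which excludes the second graph, where
    [Im (e^(i d) x) = Im (e^(i d) y)]. *)
Lemma union_not_cone_cvx :
  ~ cone_cvx (setU3 (@R2 R) (graph_plane pA) (graph_plane pB)).
Proof.
have k1 := kern_bound_nu_ge0; have k2 := kern_bound_nu'_ge0; have pi0 := pi_gt0 R.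
have n0 : 0 < nu - al by pars; lra.
have n1 : 0 < nu by pars; lra.
have n2 : 0 < nu' - nu by pars; lra.
pose t0 : R := pi / 4; pose om := (nu - al) * t0.
have om0 : 0 < sin om by apply: sin_gt0_pi; rewrite /om /t0; pars; nra.
have om1 : 0 < sin (om + d) by apply: sin_gt0_pi; rewrite /om /t0; pars; nra.
pose sg := Num.min (sin om) (sin (om + d)).
have sg0 : 0 < sg by rewrite lt_min om0.
(* The error terms [3 K v] and [2 K v] together stay below the main term [sg / nu]. *)
pose v := sg / nu / (3 * K + 2 * K + 1).
have v0 : 0 < v by rewrite !divr_gt0 //; lra.
pose s0 := Num.min 0 (Num.min (ln v / 2) (ln v / (nu' - nu))).
have s00 : s0 <= 0 by rewrite ge_min lexx.
have X : expR (2 * s0) <= v.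
  rewrite -(@expR_small 2 v) // ler_expR ler_pM2l // !ge_min lexx !orbT //.
have Z : expR ((nu' - nu) * s0) <= v.
  by rewrite -(expR_small n2 v0) ler_expR ler_pM2l // !ge_min lexx !orbT.
have [x hx] := coord_cvg al_range hl nu_range t0 s00.
have [y hy] := coord_cvg al_range hl nu'_range t0 s00.
pose rho := expR ((nu - al) * s0); have rho0 : 0 < rho by exact: expR_gt0.
have small : 3 * K * v + 2 * K * v < sg / nu.
  have -> : sg / nu = (3 * K + 2 * K + 1) * v by rewrite [RHS]mulrC /v divfK // gt_eqF //; lra.
  lra.
have low b : sg <= `|sin (om + b)| -> rho * (2 * K * v) < `|Im (ei b * x)|.
  move=> hb; rewrite -ltrN2.
  apply: (@le_lt_trans _ _ (- (rho * (sg / nu - 3 * K * v)))); last first.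
    by rewrite ltrN2 ltr_pM2l //; lra.
  apply: (@tends_le _ _ _ (fun z => - `|Im (ei b * z)|) _ _ _ hx).
    move=> z w; have : `|Im (ei b * (z - w))| <= nc (z - w).
      by apply: le_trans (Im_le_nc _) _; rewrite ncM nc_ei mul1r.
    rewrite mulrBr cImD cImN.
    have := ler_normD (Im (ei b * z)) (Im (ei b * w) - Im (ei b * z)).
    rewrite addrC subrK distrC; lra.
  move=> N N0; rewrite lerN2; apply: le_trans (coord_angle al_range hl nu_range t0 b s00 N0).
  rewrite ler_pM2l //.
  have : 3 * kern_bound l nu * expR (2 * s0) <= 3 * K * v.
    by apply: ler_pM; [lra|exact: expR_ge0|lra|].
  have : sg / nu <= `|sin (om + b)| / nu by rewrite ler_wpM2r // invr_ge0 ltW.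
  rewrite -/om; lra.
have yb : nc y <= rho * (2 * K * v).
  apply: (@tends_le _ _ _ (fun z => nc z) _ _ _ hy).
    by move=> z w; have := ncD (z - w) w; rewrite subrK; lra.
  move=> N _; apply: le_trans (coord_bound al_range hl nu'_range N t0 s00) _.
  have -> : (nu' - al) * s0 = (nu - al) * s0 + (nu' - nu) * s0 by ring.
  rewrite expRD mulrCA ler_pM2l //.
  by apply: ler_pM; [lra|exact: expR_ge0|lra|].
have ht0 : 0 <= t0 <= pi / 2 by rewrite /t0; lra.
have B0 : 0 <= 2 * K by lra.
have bnd N s t : s <= 0 -> nc (f1 N s t) <= 2 * K /\ nc (f2 N s t) <= 2 * K.
  move=> sle; have [b1 b2] := coord_bound_max N t sle.
  have e1 : 2 * K * expR ((nu - al) * s) <= 2 * K.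
    by rewrite ler_piMr // expR_le1 // ltW.
  by split; [apply: le_trans b1 _|apply: le_trans b2 _].
move=> hE.
have [r r0 /(hE r r0)] := disc_hull B0 s00 ht0
  (fun N => is_esum_coord al l nu N) (fun N => is_esum_coord al l nu' N) bnd hx hy
  (fun e => boundary_near s00).
have nonneg : 0 <= rho * (2 * K * v) by apply: mulr_ge0; [exact: ltW|apply: mulr_ge0 => //; exact: ltW].
have far b : sg <= `|sin (om + b)| -> `|Im (ei b * x)| <= rho * (2 * K * v) -> False.
  by move=> /low lt /(lt_le_trans lt); rewrite ltxx.
case=> [/R2P[]|[/(planeAP ang_d ang_dp ang_pq ang_q ang_s) []|
                /(planeBP ang_d ang_dp ang_pq ang_q ang_s) []]].
- rewrite mk2_0 => ix _; apply: (@far 0).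
    by rewrite addr0 (gtr0_norm om0) ge_min lexx.
  by rewrite cImM /= ix sin0 cos0 mul0r mulr0 addr0 normr0.
- rewrite mk2_0 => ix _; apply: (@far (- (p - d))).
    have -> : om - (p - d) = - om by rewrite /om /t0; field.
    by rewrite sinN normrN (gtr0_norm om0) ge_min lexx.
  rewrite cImM /= cosN sinN.
  have -> : cos (p - d) * Im x + - sin (p - d) * Re x = 0 by rewrite -ix; ring.
  by rewrite normr0.
- rewrite /planeB_form1 mk2_0 mk2_1 => e1 _; apply: (@far d).
    by rewrite (gtr0_norm om1) ge_min lexx orbT.
  have -> : Im (ei d * x) = Im (ei d * y) by rewrite !cImM /=; lra.
  by apply: le_trans (Im_le_nc _) _; rewrite ncM nc_ei mul1r.
Qed.

End NotConvex.

(** * Optimality *)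

Section Optimality.
Variable R : realType.

Lemma mx_near_mx2 (d a b b' c e : R) : `|b - b'| < d -> mx_near d (mx2 a b c e) (mx2 a b' c e).
Proof.
move=> h i j; have d0 : 0 < d by apply: le_lt_trans h.
by rewrite !mxE; case: ifP => _; case: ifP => _ //; rewrite subrr normr0.
Qed.

Lemma mx_near_refl (d : R) (A : 'M[R]_2) : 0 < d -> mx_near d A A.
Proof. by move=> d0 i j; rewrite subrr normr0. Qed.

Lemma scale_conj (e a b c x : R) : 0 < e ->
  Defs.conj (mx2 e 0 0 1) (mx2 a b c x) = mx2 a (e * b) (c / e) x.
Proof.
move=> /lt0r_neq0 e0; apply: conjP; first by apply: mx2_unit; rewrite mulr1 mulr0 subr0.
by apply: mx2P; rewrite !mulmx22E !mx2E; field.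
Qed.

(** A zero off-diagonal entry makes the commutator singular, and an arbitrarily small entry of sign
    opposite to [c] leads out of [OmegaStar] by [not_OmegaStar]. *)
Lemma rel_boundary_diag (l1 l2 a b c x : R) : l1 != l2 -> b * c < 0 -> a * x < 0 ->
  rel_boundary (diag2 l1 l2) (mx2 a 0 c x).
Proof.
move=> l12 bc ax; have sp := spec_real_two_diag l12; split; first by right.
move=> d d0; split.
  exists (diag2 l1 l2), (mx2 a 0 c x); split; last by split; exact: mx_near_refl.
  split; [by right|left; split=> //; left].
  by rewrite det_comm_diag !mx2E mul0r mulr0.
have b1 : 0 < `|b| + 1 by rewrite ltr_wpDl.
pose k := d / (`|b| + 1); have k0 : 0 < k by rewrite divr_gt0.
exists (diag2 l1 l2), (mx2 a (k * b) c x); split; first by right.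
split; first by apply: not_OmegaStar; rewrite ?mx2E // -mulrA pmulr_rlt0.
split; first exact: mx_near_refl.
apply: mx_near_mx2; rewrite sub0r normrN normrM gtr0_norm //.
by rewrite /k -mulrA gtr_pMr // mulrC ltr_pdivrMr // mul1r ltrDl.
Qed.

Lemma optimal_family (l1 l2 : R) (B : 'M[R]_2) : l1 != l2 ->
  B 0 1 * B 1 0 < 0 -> B 0 0 * B 1 1 < 0 ->
  cone_cvx (setU2 (@R2 R) (graph_plane (diag2 l1 l2))) ->
  cone_cvx (setU2 (@R2 R) (graph_plane B)) ->
  cone_cvx (setU2 (graph_plane (diag2 l1 l2)) (graph_plane B)) ->
  ~ cone_cvx (setU3 (@R2 R) (graph_plane (diag2 l1 l2)) (graph_plane B)) ->
  exists (e0 : R) (F1 F2 : R -> 'M[R]_2),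
      0 < e0 /\
      (forall e : R, 0 < e < e0 ->
         Omega (F1 e) (F2 e) /\ ~ OmegaStar (F1 e) (F2 e) /\
         loc_poly_convex (setU2 (@R2 R) (graph_plane (F1 e))) 0 /\
         loc_poly_convex (setU2 (@R2 R) (graph_plane (F2 e))) 0 /\
         loc_poly_convex (setU2 (graph_plane (F1 e)) (graph_plane (F2 e))) 0 /\
         ~ loc_poly_convex (setU3 (@R2 R) (graph_plane (F1 e)) (graph_plane (F2 e))) 0) /\
      (forall d : R, 0 < d -> exists eta : R, 0 < eta /\
         forall e : R, 0 < e < eta -> e < e0 ->
           exists B1 B2, rel_boundary B1 B2 /\
                         mx_near d (F1 e) B1 /\ mx_near d (F2 e) B2).
Proof.
move=> l12 bc ad cA cB cAB nc; have BE := mx2_eta B.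
have FE (e : R) : 0 < e -> Defs.conj (mx2 e 0 0 1) B =
    mx2 (B 0 0) (e * B 0 1) (B 1 0 / e) (B 1 1).
  by move=> e0; rewrite {1}BE scale_conj.
have AE (e : R) : 0 < e -> Defs.conj (mx2 e 0 0 1) (diag2 l1 l2) = diag2 l1 l2.
  by move=> e0; rewrite diag2_mx2 scale_conj // mulr0 mul0r.
have off (e : R) : 0 < e -> e * B 0 1 * (B 1 0 / e) < 0.
  move=> /lt0r_neq0 e0.
  by have -> : e * B 0 1 * (B 1 0 / e) = B 0 1 * B 1 0 by field.
exists 1, (fun=> diag2 l1 l2), (fun e => Defs.conj (mx2 e 0 0 1) B); split=> //; split.
  move=> e /andP[e0 _].
  have uD : mx2 e 0 0 1 \in unitmx.
    by apply: mx2_unit; rewrite mulr1 mulr0 subr0 gt_eqF.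
  split; first by right; exact: spec_real_two_diag.
  split; first by rewrite FE //; apply: not_OmegaStar; rewrite ?mx2E ?off.
  split; first by apply: cone_cvx_loc => //; left; exact: R2_0.
  split; first by apply: cone_cvx_loc; [left; exact: R2_0|exact: R2_graph_conj].
  split.
    apply: cone_cvx_loc; first by left; exact: graph_plane0.
    by rewrite -[X in graph_plane X](AE e) //; exact: graph_graph_conj.
  move=> h; apply: nc; apply: (cone_cvx_R2_graph_conj uD); rewrite AE //.
  apply: loc_cone_cvx h; apply: (real_coneU (@real_cone_R2 R)).
  by apply: real_coneU; exact: real_cone_graph.
move=> d d0; have b1 : 0 < `|B 0 1| + 1 by rewrite ltr_wpDl.
exists (d / (`|B 0 1| + 1)); split; first by rewrite divr_gt0.
(* The boundary point moves with [e], since its lower left entry is [B 1 0 / e]; what tends to [0]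
   is its distance to the pair. *)
move=> e /andP[e0 ed] _; exists (diag2 l1 l2), (mx2 (B 0 0) 0 (B 1 0 / e) (B 1 1)).
split; first by apply: rel_boundary_diag (off e e0) ad.
split; first exact: mx_near_refl.
rewrite FE //; apply: mx_near_mx2; rewrite subr0 normrM gtr0_norm //.
move: ed; rewrite ltr_pdivlMr // => ed.
by apply: le_lt_trans ed; rewrite ler_pM2l // lerDl.
Qed.

End Optimality.

Theorem theorem1p4 (R : realType) :
  (* Part (i)/(ii): sufficient conditions *)
  (forall (P0 P1 P2 : cset R) (G : 'M[R[i]]_2) (A1 A2 : 'M[R]_2),
      totally_real_plane P0 -> totally_real_plane P1 -> totally_real_plane P2 ->
      (forall z, (P0 z /\ P1 z) <-> z = 0) ->
      (forall z, (P0 z /\ P2 z) <-> z = 0) ->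
      G \in unitmx ->
      set_eq (mx_image G P0) (@R2 R) ->
      set_eq (mx_image G P1) (graph_plane A1) ->
      set_eq (mx_image G P2) (graph_plane A2) ->
      Omega A1 A2 ->
      (exists T, star T A1) /\
      (loc_poly_convex (setU2 P0 P1) 0 ->
       loc_poly_convex (setU2 P0 P2) 0 ->
       loc_poly_convex (setU2 P1 P2) 0 ->
       (spec_real_two A1 ->
          (\det (comm A1 A2) = 0 \/ exists T, star T A1 /\ form_i T A2) /\
          (\det (comm A1 A2) = 0 -> loc_poly_convex (setU3 P0 P1 P2) 0) /\
          ((exists T, star T A1 /\ form_i T A2 /\ det_cond T A1 A2) ->
             loc_poly_convex (setU3 P0 P1 P2) 0)) /\
       (spec_nonreal A1 ->
          (exists T, star T A1 /\ form_ii T A2) /\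
          ((exists T, star T A1 /\ form_ii T A2 /\ det_cond T A1 A2) ->
             loc_poly_convex (setU3 P0 P1 P2) 0)))) /\
  (* optimality *)
  (exists (e0 : R) (F1 F2 : R -> 'M[R]_2),
      0 < e0 /\
      (forall e : R, 0 < e < e0 ->
         Omega (F1 e) (F2 e) /\ ~ OmegaStar (F1 e) (F2 e) /\
         loc_poly_convex (setU2 (@R2 R) (graph_plane (F1 e))) 0 /\
         loc_poly_convex (setU2 (@R2 R) (graph_plane (F2 e))) 0 /\
         loc_poly_convex (setU2 (graph_plane (F1 e)) (graph_plane (F2 e))) 0 /\
         ~ loc_poly_convex (setU3 (@R2 R) (graph_plane (F1 e)) (graph_plane (F2 e))) 0) /\
      (forall d : R, 0 < d -> exists eta : R, 0 < eta /\
         forall e : R, 0 < e < eta -> e < e0 ->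
           exists B1 B2, rel_boundary B1 B2 /\
                         mx_near d (F1 e) B1 /\ mx_near d (F2 e) B2)).
Proof.
split.
  move=> P0 P1 P2 G A1 A2 _ _ _ _ _ uG h0 h1 h2 om.
  split; first exact: star_exists om.
  move=> l01 l02 l12; split=> sp; split.
  - exact: form_i_exists.
  - split=> [dc|[T [[uT _] [_ dT]]]]; apply: sufficient_conditions uG h0 h1 h2 l01 l12 _.
      by left.
    by right; exists T.
  - exact: form_ii_exists.
  - move=> [T [[uT _] [_ dT]]]; apply: sufficient_conditions uG h0 h1 h2 l01 l12 _.
    by right; exists T.
(* The parameters are [al = 1 / 8], [nu = 1 / 4], [nu' = 1 / 2] and [l = 5 / 8], so [mu = 3 / 8] is
   the mean of [nu] and [nu']. *)
have a1 : 0 < 1 / 8 :> R by lra.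
have a2 : 1 / 8 < 1 / 4 :> R by lra.
have a3 : 1 / 4 < 1 / 2 :> R by lra.
have a4 : 1 / 4 + 1 / 2 = 2 * (1 - 5 / 8) :> R by lra.
have a5 : (1 / 2 < 5 / 8 :> R) && (5 / 8 < 1 :> R) by apply/andP; split; lra.
have a6 : 2 * (1 / 2) - 1 / 8 < 1 :> R by lra.
have d0 := ang_d a1 a2 a3 a4 a5 a6; have d1 := ang_dp a1 a2 a3 a4 a5 a6.
have d2 := ang_pq a1 a2 a3 a4 a5 a6; have d3 := ang_q a1 a2 a3 a4 a5 a6.
have d4 := ang_s a1 a2 a3 a4 a5 a6.
have A1 := planeB_offdiag d0 d1 d2 d3 d4; have A2 := planeB_diag d0 d1 d2 d3 d4.
have A3 := cone_cvx_R2_graph (planeB_discr d0 d1 d2 d3 d4).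
have A4 := cone_cvx_planeAB d0 d1 d2 d3 d4.
have A5 := union_not_cone_cvx a1 a2 a3 a4 a5 a6.
apply: optimal_family (cotan_neq d0 d1 d2 d3 d4) A1 A2 _ A3 A4 A5.
by apply: cone_cvx_tri2; rewrite diag2_mx2 mx2E.
Qed.
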